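(* Let $1+\sqrt2<p<3$ and let $f,g\in C_0^\infty(\mathbb{R}^3)$ with $\operatorname{supp} f,\ \operatorname{supp} g\subset\{x:|x|\le 1\}$. Then, for small data (that is, for all sufficiently small $\varepsilon>0$), the Cauchy problem $$\partial_t^2\phi-\Delta\phi=|\phi|^p\ \text{ in } \mathbb{R}_+\times\mathbb{R}^3,\qquad \phi(0,x)=\varepsilon f(x),\quad \partial_t\phi(0,x)=\varepsilon g(x),\quad x\in\mathbb{R}^3,$$ has a global solution.
   Context: $\mathbb{R}_+$ denotes the time half-line $t\ge0$. ''Global'' means that the solution exists for all times $t\ge 0$. The parameter $\varepsilon>0$ measures the size of the initial data. *)

(* Defs.v *)
(* Stdlib's real numbers, with Coquelicot. *)
From Stdlib Require Import Reals List Lra.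
From Coquelicot Require Import Coquelicot.
Import ListNotations.
Open Scope R_scope.

(* Calculus relative to a subset [D] of a normed space.  Difference quotients
   only use points of [D], so that derivatives at the boundary of [D] are
   one-sided where necessary; at interior points of [D] they are the usual
   directional derivatives. *)

Definition is_pderiv {V : NormedModule R_AbsRing} (D : V -> Prop) (e : V)
    (u : V -> R) (q : V) (l : R) : Prop :=
  filterlim (fun h : R => (u (plus q (scal h e)) - u q) / h)
    (within (fun h : R => D (plus q (scal h e))) (locally' 0)) (locally l).

Definition ex_pderiv {V : NormedModule R_AbsRing} (D : V -> Prop) (e : V)
    (u : V -> R) (q : V) : Prop :=
  exists l : R, is_pderiv D e u q l.

(* Like [Derive], this is total: its value is meaningful only if [ex_pderiv]
   holds and [q] is a limit of points [q + h e], [h <> 0], of [D]. *)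
Definition pderiv {V : NormedModule R_AbsRing} (D : V -> Prop) (e : V)
    (u : V -> R) (q : V) : R :=
  iota (is_pderiv D e u q).

(* All iterated derivatives of order at most [n] in the directions of [basis]
   exist at every point of [D] and are continuous on [D]. *)
Fixpoint C_k {V : NormedModule R_AbsRing} (basis : list V) (D : V -> Prop)
    (n : nat) (u : V -> R) : Prop :=
  continuous_on D u /\
  match n with
  | O => True
  | S m => forall e : V, In e basis ->
      (forall q : V, D q -> ex_pderiv D e u q) /\ C_k basis D m (pderiv D e u)
  end.

Definition R3 : Type := (R * R * R)%type.

(* Coquelicot's product norm is the Euclidean one. *)
Lemma norm_R3 (x y z : R) :
  norm ((x, y, z) : R3) = sqrt (x ^ 2 + y ^ 2 + z ^ 2).
Proof.
  change (sqrt (sqrt (Rabs x ^ 2 + Rabs y ^ 2) ^ 2 + Rabs z ^ 2)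
          = sqrt (x ^ 2 + y ^ 2 + z ^ 2)).
  rewrite !pow2_abs, pow2_sqrt; [reflexivity | nra].
Qed.

Definition e1 : R3 := (1, 0, 0).
Definition e2 : R3 := (0, 1, 0).
Definition e3 : R3 := (0, 0, 1).

Definition smooth (f : R3 -> R) : Prop :=
  forall n : nat, C_k [e1; e2; e3] (fun _ => True) n f.

(* The closure of [{x | f x <> 0}]. *)
Definition supp (f : R3 -> R) (x : R3) : Prop :=
  forall P : R3 -> Prop, locally x P -> exists y : R3, P y /\ f y <> 0.

(* [supp f] is closed, so it is compact exactly when it is bounded. *)
Definition C0_infty (f : R3 -> R) : Prop :=
  smooth f /\ exists rho : R, forall x : R3, supp f x -> norm x <= rho.

Definition spacetime : Type := (R * R3)%type.

Definition half_space (q : spacetime) : Prop := 0 <= fst q.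

Definition dt : spacetime := (1, zero).
Definition dx (e : R3) : spacetime := (0, e).

(* Partial derivatives on the closed half space; the time derivative at
   [t = 0] is the right derivative. *)
Definition partial (e : spacetime) (phi : spacetime -> R) : spacetime -> R :=
  pderiv half_space e phi.

Definition laplacian (phi : spacetime -> R) (q : spacetime) : R :=
  partial (dx e1) (partial (dx e1) phi) q +
  partial (dx e2) (partial (dx e2) phi) q +
  partial (dx e3) (partial (dx e3) phi) q.

(* [|u|^p] for [p > 0]; the case distinction is needed because
   [Rpower 0 p = 1]. *)
Definition abs_pow (u p : R) : R :=
  if Req_EM_T u 0 then 0 else Rpower (Rabs u) p.

(* Classical solution, of class C^2 up to [t = 0], for all times [t >= 0].
   The values of [phi] at negative times are irrelevant. *)
Definition global_solution (p : R) (phi0 phi1 : R3 -> R)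
    (phi : spacetime -> R) : Prop :=
  C_k [dt; dx e1; dx e2; dx e3] half_space 2 phi /\
  (forall (t : R) (x : R3), 0 <= t ->
     partial dt (partial dt phi) (t, x) - laplacian phi (t, x)
     = abs_pow (phi (t, x)) p) /\
  (forall x : R3, phi (0, x) = phi0 x) /\
  (forall x : R3, partial dt phi (0, x) = phi1 x).

(* Main.v *)
Require Import Defs.
From Stdlib Require Import Reals Lra Lia List Classical ClassicalEpsilon.
From Coquelicot Require Import Coquelicot.
Open Scope R_scope.

(** Everything is done on all of [R * R^3], with [t] of either sign, and restricted
    to the half space only at the end.  The Duhamel operator [Duh w (t, x)] is the
    integral over [0 <= s <= t] of [(t - s)] times the mean of [w s] over the sphere
    of radius [t - s] about [x].  It satisfies [Dx (Duh w) = Duh (Dx w)] and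
    [Dt^2 (Duh w) = w + Duh (Laplacian w)], so that it gains two time derivatives
    and only the space derivatives of the fixed point of
    [phi = eps (f + t g) + Duh (|phi|^p + eps (Laplacian f + t Laplacian g))]
    have to be controlled.

    Following F. John, the iterates stay below a small multiple of the weight
    [Phi = (1 + |t| + |x|)^(-1) (1 + ||t| - |x||)^(2 - p)].  In the radial
    variables [s = |t|], [l = |x|] one has [l Phi^p <= a (s + l) b (s - l)] with
    [a y = (1 + |y|)^(1 - p)] and [b y = (1 + |y|)^(- p (p - 2))], and [b] is integrable
    because [p (p - 2) > 1], that is, [p > 1 + sqrt 2].  Given this
    uniform bound, the iterates and their first and second space derivatives converge
    geometrically on every strip [|t| <= T], since [Duh] is a Volterra operator. *)

(** * Continuity and integrals depending on a point *)

(** Smallness and convergence are kept apart. The size of [eps] enters only through the a priori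
    bound of the iterates by [N * Phi]: the nonlinear term costs [N^p <= N^2], which leaves a factor
    [N] to absorb the constant of John's estimate. Since [Phi <= 1], the iterates then stay in
    [[-1, 1]], where [|u|^p] and its two derivatives have absolute bounds; convergence on a strip
    comes from the Volterra structure, with constants that may grow with [T]. The delicate point is
    the second derivative of [|u|^p]. It is continuous because [p > 2], but only Hoelder continuous
    of order [p - 2], an exponent at most 1 because [p <= 3]. This turns a geometric ratio [r] into
    [r^(p - 2)], which is still below 1. The power [2 - p] in [Phi] comes from [a]: its integral
    from [||t| - |x||] to [|t| + |x|], divided by [2 |x|], is at most a multiple of [Phi]. Double
    integrals are handled by differentiating in a parameter under the integral sign: the divergence
    theorem on the sphere, the rotation invariance of zonal means and the integral over [s] and [l]
    in John's estimate are all of this kind. *)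

Definition cont {U V : UniformSpace} (f : U -> V) : Prop :=
  forall u, continuous f u.

Lemma cont_comp {U V W : UniformSpace} (g : V -> W) (f : U -> V) :
  cont g -> cont f -> cont (fun u => g (f u)).
Proof. intros Hg Hf u. apply continuous_comp; auto. Qed.

Lemma cont_id {U : UniformSpace} : cont (fun u : U => u).
Proof. intros u. apply continuous_id. Qed.

Lemma cont_const {U V : UniformSpace} (c : V) : cont (fun _ : U => c).
Proof. intros u. apply continuous_const. Qed.

Lemma cont_fst {U V W : UniformSpace} (f : U -> V * W) :
  cont f -> cont (fun u => fst (f u)).
Proof. intros H. apply (cont_comp (fun x : V * W => fst x)); [ | exact H].
  intros u. apply continuous_fst. Qed.

Lemma cont_snd {U V W : UniformSpace} (f : U -> V * W) :
  cont f -> cont (fun u => snd (f u)).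
Proof. intros H. apply (cont_comp (fun x : V * W => snd x)); [ | exact H].
  intros u. apply continuous_snd. Qed.

Lemma cont_pair {U V W : UniformSpace} (f : U -> V) (g : U -> W) :
  cont f -> cont g -> cont (fun u => (f u, g u)).
Proof.
  intros Hf Hg u. apply (continuous_comp_2 f g (fun x y => (x, y))); auto.
  apply continuous_ext with (fun x => x); [now intros [] | apply continuous_id].
Qed.

Lemma cont_plus {U : UniformSpace} (f g : U -> R) :
  cont f -> cont g -> cont (fun u => f u + g u).
Proof. intros Hf Hg u. apply (continuous_plus f g); auto. Qed.

Lemma cont_minus {U : UniformSpace} (f g : U -> R) :
  cont f -> cont g -> cont (fun u => f u - g u).
Proof. intros Hf Hg u. apply (continuous_minus f g); auto. Qed.

Lemma cont_opp {U : UniformSpace} (f : U -> R) :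
  cont f -> cont (fun u => - f u).
Proof. intros Hf u. apply (continuous_opp f); auto. Qed.

Lemma cont_mult {U : UniformSpace} (f g : U -> R) :
  cont f -> cont g -> cont (fun u => f u * g u).
Proof. intros Hf Hg u. apply (continuous_mult f g); auto. Qed.

Lemma cont_vplus {U : UniformSpace} {V : NormedModule R_AbsRing} (f g : U -> V) :
  cont f -> cont g -> cont (fun u => plus (f u) (g u)).
Proof. intros Hf Hg u. apply (continuous_plus f g); auto. Qed.

Lemma cont_scal {U : UniformSpace} {V : NormedModule R_AbsRing}
  (f : U -> R) (g : U -> V) :
  cont f -> cont g -> cont (fun u => scal (f u) (g u)).
Proof. intros Hf Hg u. apply (continuous_scal f g); auto. Qed.

Lemma cont_norm {U : UniformSpace} {V : NormedModule R_AbsRing} (f : U -> V) :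
  cont f -> cont (fun u => norm (f u)).
Proof.
  intros Hf. apply (cont_comp (fun v : V => norm v)); [ | exact Hf].
  intros v. apply (@filterlim_norm R_AbsRing V).
Qed.

Lemma cont_abs {U : UniformSpace} (f : U -> R) :
  cont f -> cont (fun u => Rabs (f u)).
Proof. exact (cont_norm f). Qed.

Lemma cont_of_derive (f f' : R -> R) :
  (forall x, is_derive f x (f' x)) -> cont f.
Proof. intros H x. apply (@ex_derive_continuous R_AbsRing). eexists; apply H. Qed.

Lemma cont_sin {U : UniformSpace} (f : U -> R) :
  cont f -> cont (fun u => sin (f u)).
Proof. apply cont_comp. apply (cont_of_derive _ cos). intros x; auto_derive; [easy | ring]. Qed.

Lemma cont_cos {U : UniformSpace} (f : U -> R) :
  cont f -> cont (fun u => cos (f u)).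
Proof. apply cont_comp. apply (cont_of_derive _ (fun x => - sin x)). intros x; auto_derive; [easy | ring]. Qed.

Lemma cont_exp {U : UniformSpace} (f : U -> R) :
  cont f -> cont (fun u => exp (f u)).
Proof. apply cont_comp. apply (cont_of_derive _ exp). intros x; auto_derive; [easy | ring]. Qed.

Lemma cont_sqrt {U : UniformSpace} (f : U -> R) :
  cont f -> cont (fun u => sqrt (f u)).
Proof. apply cont_comp. intros x. apply continuous_sqrt. Qed.

Lemma cont_ext {U V : UniformSpace} (f g : U -> V) :
  (forall u, f u = g u) -> cont f -> cont g.
Proof. intros E H u. apply (continuous_ext f); auto. Qed.

(** Extension point of [ct], redefined each time that a new continuous operation is introduced. *)
Ltac ct_more := fail.
(* Compares syntactically, since the hypotheses may be about local definitions. *)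
Ltac ct_hyp g k :=
  match goal with
  | H : cont ?g' |- _ => constr_eq g g'; k H
  | H : forall i, cont (?h' i) |- _ =>
      match g with ?h ?i => constr_eq h h'; k (H i) end
  | H : forall i j, cont (?h' i j) |- _ =>
      match g with ?h ?i ?j => constr_eq h h'; k (H i j) end
  end.
Ltac ct1 :=
  match goal with
  | |- cont (fun _ => ?c) => exact (cont_const c)
  | |- cont (fun u => u) => exact cont_id
  | |- cont (fun u => fst (@?f u)) => apply (cont_fst f)
  | |- cont (fun u => snd (@?f u)) => apply (cont_snd f)
  | |- cont fst => exact (cont_fst _ cont_id)
  | |- cont snd => exact (cont_snd _ cont_id)
  | |- cont sin => exact (cont_sin _ cont_id)
  | |- cont cos => exact (cont_cos _ cont_id)
  | |- cont exp => exact (cont_exp _ cont_id)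
  | |- cont (fun u => (@?f u, @?g u)) => apply (cont_pair f g)
  | |- cont (fun u => @?f u + @?g u) => apply (cont_plus f g)
  | |- cont (fun u => @?f u - @?g u) => apply (cont_minus f g)
  | |- cont (fun u => - @?f u) => apply (cont_opp f)
  | |- cont (fun u => @?f u * @?g u) => apply (cont_mult f g)
  | |- cont (fun u => Rabs (@?f u)) => apply (cont_abs f)
  | |- cont (fun u => sin (@?f u)) => apply (cont_sin f)
  | |- cont (fun u => cos (@?f u)) => apply (cont_cos f)
  | |- cont (fun u => exp (@?f u)) => apply (cont_exp f)
  | |- cont (fun u => sqrt (@?f u)) => apply (cont_sqrt f)
  | |- cont (fun u => norm (@?f u)) => apply (cont_norm f)
  | |- cont (fun u => plus (@?f u) (@?g u)) => apply (cont_vplus f g)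
  | |- cont (fun u => scal (@?f u) (@?g u)) => apply (cont_scal f g)
  | |- cont (fun u => ?g (@?f u)) => ct_hyp g ltac:(fun H => apply (cont_comp g f H))
  | |- cont ?g => ct_hyp g ltac:(fun H => exact H)
  | _ => ct_more
  end; cbv beta.
Ltac ct := repeat ct1.

(* Exposes the carrier [R] hidden behind a canonical structure. *)
Ltac rring := match goal with |- @eq _ ?a ?b => change (@eq R a b); ring end.

Lemma ex_RInt_cont (f : R -> R) a b : cont f -> ex_RInt f a b.
Proof. intros H. apply (@ex_RInt_continuous R_CompleteNormedModule). intros; apply H. Qed.

(** Compactness of [[a, b]] makes continuity at [u0] uniform in [s]. Around each [s] there is a
    radius [delta s] on which [f] stays within [eps / 2] of [f u0 s], and a common lower bound [d]
    of these radii serves finitely many tags. *)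
Lemma tube {U : UniformSpace} (f : U -> R -> R) (a b : R) (u0 : U) :
  cont (fun p : U * R => f (fst p) (snd p)) ->
  forall eps : posreal, locally u0 (fun u => forall s, a <= s <= b ->
    Rabs (f u s - f u0 s) < eps).
Proof.
  intros Hf eps.
  assert (H : forall s, exists d : posreal, forall u s', ball u0 d u -> Rabs (s' - s) < d ->
     Rabs (f u s' - f u0 s) < eps / 2).
  { intros s.
    destruct (proj1 (filterlim_locally _ _) (Hf (u0, s)) (pos_div_2 eps)) as [d Hd].
    exists d. intros u s' Hu Hs. apply (Hd (u, s')). split; [exact Hu | exact Hs]. }
  pose (delta := fun s => proj1_sig (constructive_indefinite_description _ (H s))).
  assert (Hdelta := fun s => proj2_sig (constructive_indefinite_description _ (H s))).
  destruct (compactness_value_1d a b delta) as [d Hd].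
  exists d. intros u Hu s Hs.
  (* Compactness supplies the tag [t] near [s] only up to a double negation, which is harmless
     because the goal is proved classically. *)
  apply Classical_Prop.NNPP. intros Hn. apply (Hd s Hs). intros [t (Ht & H1 & H2)].
  apply Hn.
  assert (A1 := Hdelta t u s (ball_le _ _ _ H2 _ Hu) H1).
  assert (A2 := Hdelta t u0 s (ball_center _ _) H1).
  replace (f u s - f u0 s) with ((f u s - f u0 t) - (f u0 s - f u0 t)) by ring.
  eapply Rle_lt_trans; [apply Rabs_triang | rewrite Rabs_Ropp; lra].
Qed.

Lemma cont_slice {U : UniformSpace} (f : U -> R -> R) (u : U) :
  cont (fun p : U * R => f (fst p) (snd p)) -> cont (f u).
Proof.
  intros Hf.
  apply (cont_comp (fun p : U * R => f (fst p) (snd p)) (fun s => (u, s)) Hf). ct.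
Qed.

Lemma cont_RInt {U : UniformSpace} (f : U -> R -> R) (a b : R) :
  cont (fun p : U * R => f (fst p) (snd p)) -> cont (fun u => RInt (f u) a b).
Proof.
  intros Hf.
  assert (Hle : forall c d, c <= d -> cont (fun u => RInt (f u) c d)).
  { intros c d Hcd u0. apply filterlim_locally. intros eps.
    assert (He : 0 < eps / (d - c + 1)) by (apply Rdiv_lt_0_compat; [apply cond_pos | lra]).
    assert (Hc : forall u, cont (f u)) by (intros; apply cont_slice; auto).
    generalize (tube f c d u0 Hf (mkposreal _ He)). apply filter_imp. intros u Hu.
    simpl in Hu.
    change (Rabs (RInt (f u) c d - RInt (f u0) c d) < eps).
    assert (E : RInt (f u) c d - RInt (f u0) c d = RInt (fun s => f u s - f u0 s) c d).
    { symmetry. apply (RInt_minus (f u) (f u0)); apply ex_RInt_cont; auto. }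
    rewrite E. eapply Rle_lt_trans.
    - apply (abs_RInt_le_const _ c d (eps / (d - c + 1)) Hcd).
      + apply ex_RInt_cont. pose proof (Hc u); pose proof (Hc u0). ct.
      + intros t Ht. left. now apply Hu.
    - replace (pos eps) with ((d - c + 1) * (eps / (d - c + 1))) at 2 by (field; lra).
      apply Rmult_lt_compat_r; lra. }
  destruct (Rle_dec a b) as [H | H]; [now apply Hle |].
  apply (cont_ext (fun u => - RInt (f u) b a)).
  - intros u. apply (opp_RInt_swap (f u) b a). apply ex_RInt_cont, cont_slice; auto.
  - apply (cont_opp (fun u => RInt (f u) b a)). apply Hle. lra.
Qed.

Lemma RInt_rescale (f : R -> R) (b : R) : cont f ->
  RInt f 0 b = RInt (fun s => b * f (b * s)) 0 1.
Proof.
  intros Hf.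
  transitivity (RInt f (b * 0 + 0) (b * 1 + 0)).
  { f_equal; ring. }
  rewrite <- (RInt_comp_lin f b 0 0 1).
  - apply RInt_ext. intros x _. change (b * f (b * x + 0) = b * f (b * x)). now rewrite Rplus_0_r.
  - now apply ex_RInt_cont.
Qed.

(** Rescaling to [[0, 1]] moves the dependence of the endpoint into the integrand, where [cont_RInt]
    applies. *)
Lemma cont_RInt_var {U : UniformSpace} (f : U -> R -> R) (b : U -> R) :
  cont (fun p : U * R => f (fst p) (snd p)) -> cont b ->
  cont (fun u => RInt (f u) 0 (b u)).
Proof.
  intros Hf Hb.
  apply (cont_ext (fun u => RInt (fun s => b u * f u (b u * s)) 0 1)).
  - intros u. symmetry. apply RInt_rescale. now apply cont_slice.
  - apply (cont_RInt (fun u s => b u * f u (b u * s))).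
    apply (cont_mult (fun p : U * R => b (fst p)) (fun p => f (fst p) (b (fst p) * snd p))).
    + ct.
    + apply (cont_comp (fun p : U * R => f (fst p) (snd p)) (fun p => (fst p, b (fst p) * snd p)) Hf). ct.
Qed.

Lemma cont_2d (f : R -> R -> R) x y :
  cont (fun p : R * R => f (fst p) (snd p)) -> continuity_2d_pt f x y.
Proof. intros H. apply continuity_2d_pt_filterlim. apply H. Qed.

Lemma is_derive_RInt_cont (f f' : R -> R -> R) (a b : R) :
  (forall x s, is_derive (fun y => f y s) x (f' x s)) ->
  (forall x, cont (f x)) ->
  cont (fun p : R * R => f' (fst p) (snd p)) ->
  forall x, is_derive (fun y => RInt (f y) a b) x (RInt (f' x) a b).
Proof.
  intros Hd Hf Hf' x.
  replace (RInt (f' x) a b) with (RInt (fun s => Derive (fun y => f y s) x) a b).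
  - apply (is_derive_RInt_param f).
    + apply filter_forall. intros y t _. eexists; apply Hd.
    + intros t _. apply (continuity_2d_pt_ext f').
      * intros u v. symmetry. apply is_derive_unique, Hd.
      * now apply cont_2d.
    + apply filter_forall. intros y. now apply ex_RInt_cont.
  - apply RInt_ext. intros s _. apply is_derive_unique, Hd.
Qed.

Lemma is_derive_RInt_bound_cont (f f' : R -> R -> R) (a : R) :
  (forall x s, is_derive (fun y => f y s) x (f' x s)) ->
  (forall x, cont (f x)) ->
  cont (fun p : R * R => f' (fst p) (snd p)) ->
  forall x, is_derive (fun y => RInt (f y) a y) x (f x x + RInt (f' x) a x).
Proof.
  intros Hd Hf Hf' x.
  replace (f x x + RInt (f' x) a x) with
    (RInt (fun s => Derive (fun y => f y s) x) a x + f x x * 1).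
  - assert (H2 : forall u v, continuity_2d_pt (fun u v : R => Derive (fun z : R => f z v) u) u v).
    { intros u v. apply (continuity_2d_pt_ext f').
      * intros; symmetry. apply is_derive_unique, Hd.
      * now apply cont_2d. }
    apply (is_derive_RInt_param_bound_comp_aux3 f a (fun y => y)).
    + apply filter_forall. intros; now apply ex_RInt_cont.
    + exists (mkposreal 1 Rlt_0_1). apply filter_forall. intros; now apply ex_RInt_cont.
    + auto_derive; auto.
    + exists (mkposreal 1 Rlt_0_1). apply filter_forall. intros; eexists; apply Hd.
    + intros; apply H2.
    + exists (mkposreal 1 Rlt_0_1). intros; apply H2.
    + apply continuity_pt_filterlim. apply Hf.
  - rewrite Rmult_1_r, Rplus_comm. f_equal.
    apply RInt_ext. intros s _. apply is_derive_unique, Hd.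
Qed.

Lemma RInt_FTC (f f' : R -> R) a b :
  (forall x, is_derive f x (f' x)) -> cont f' -> RInt f' a b = f b - f a.
Proof.
  intros H Hc. apply is_RInt_unique. apply (is_RInt_derive f f').
  - intros; apply H.
  - intros; apply Hc.
Qed.

Lemma RIntD (f g : R -> R) a b : cont f -> cont g ->
  RInt (fun x => f x + g x) a b = RInt f a b + RInt g a b.
Proof. intros. apply (RInt_plus f g); now apply ex_RInt_cont. Qed.

Lemma RIntB (f g : R -> R) a b : cont f -> cont g ->
  RInt (fun x => f x - g x) a b = RInt f a b - RInt g a b.
Proof. intros. apply (RInt_minus f g); now apply ex_RInt_cont. Qed.

Lemma RIntZ (c : R) (f : R -> R) a b : cont f ->
  RInt (fun x => c * f x) a b = c * RInt f a b.
Proof. intros. apply (RInt_scal f); now apply ex_RInt_cont. Qed.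

Lemma RInt_le_cont (f g : R -> R) a b : a <= b -> cont f -> cont g ->
  (forall x, a <= x <= b -> f x <= g x) -> RInt f a b <= RInt g a b.
Proof. intros H Hf Hg Hl. apply RInt_le; try apply ex_RInt_cont; auto. intros; apply Hl; lra. Qed.

Lemma RInt_constR (c a b : R) : RInt (fun _ => c) a b = (b - a) * c.
Proof. exact (RInt_const a b c). Qed.

Lemma RInt_extR (f g : R -> R) a b : (forall x, f x = g x) -> RInt f a b = RInt g a b.
Proof. intros H. apply RInt_ext. intros; apply H. Qed.

Lemma RInt_pointR (f : R -> R) a : RInt f a a = 0.
Proof. exact (RInt_point a f). Qed.

(** * Spherical means and retarded integrals *)

Definition om (th ph : R) : R3 := (sin th * cos ph, sin th * sin ph, cos th).

(** Carries no Jacobian: the factor [sin th] stays in the integrand, so that a divergence on the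
    sphere is a plain sum of two partial derivatives. *)
Definition S2 (F : R -> R -> R) : R :=
  RInt (fun th => RInt (fun ph => F th ph) 0 (2 * PI)) 0 PI.

Definition Sph (k : R3 -> R) : R :=
  / (4 * PI) * S2 (fun th ph => sin th * k (om th ph)).

Definition cont2 (F : R -> R -> R) : Prop := cont (fun p : R * R => F (fst p) (snd p)).

Lemma cont_S2 {U : UniformSpace} (F : U -> R -> R -> R) :
  cont (fun p : U * R * R => F (fst (fst p)) (snd (fst p)) (snd p)) ->
  cont (fun u => S2 (F u)).
Proof.
  intros H. apply (cont_RInt (fun u th => RInt (fun ph => F u th ph) 0 (2 * PI))).
  apply (cont_RInt (fun (p : U * R) ph => F (fst p) (snd p) ph)). exact H.
Qed.

Lemma cont_S2_inner (F : R -> R -> R) : cont2 F ->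
  cont (fun th => RInt (fun ph => F th ph) 0 (2 * PI)).
Proof. intros H. now apply cont_RInt. Qed.

Lemma cont2_slice (F : R -> R -> R) th : cont2 F -> cont (F th).
Proof. intros H. now apply (cont_slice F th). Qed.

Lemma S2_ext (F G : R -> R -> R) : (forall th ph, F th ph = G th ph) -> S2 F = S2 G.
Proof. intros H. apply RInt_ext. intros. apply RInt_ext. intros. apply H. Qed.

Lemma S2_plus (F G : R -> R -> R) : cont2 F -> cont2 G ->
  S2 (fun th ph => F th ph + G th ph) = S2 F + S2 G.
Proof.
  intros HF HG. unfold S2. rewrite <- RIntD; try now apply cont_S2_inner.
  apply RInt_ext. intros. apply RIntD; now apply cont2_slice.
Qed.

Lemma S2_scal c (F : R -> R -> R) : cont2 F ->
  S2 (fun th ph => c * F th ph) = c * S2 F.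
Proof.
  intros HF. unfold S2. rewrite <- RIntZ; try now apply cont_S2_inner.
  apply RInt_ext. intros. apply RIntZ; now apply cont2_slice.
Qed.

Lemma S2_le (F G : R -> R -> R) : cont2 F -> cont2 G ->
  (forall th ph, 0 <= th <= PI -> F th ph <= G th ph) -> S2 F <= S2 G.
Proof.
  intros HF HG H. pose proof PI_RGT_0.
  apply RInt_le_cont; try now apply cont_S2_inner. lra.
  intros. apply RInt_le_cont; try now apply cont2_slice. lra.
  intros; now apply H.
Qed.

Lemma is_derive_S2 (F F' : R -> R -> R -> R) :
  (forall x th ph, is_derive (fun y => F y th ph) x (F' x th ph)) ->
  (forall x, cont2 (F x)) ->
  cont (fun p : R * R * R => F' (fst (fst p)) (snd (fst p)) (snd p)) ->
  forall x, is_derive (fun y => S2 (F y)) x (S2 (F' x)).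
Proof.
  intros Hd Hc Hc'.
  apply (is_derive_RInt_cont (fun x th => RInt (fun ph => F x th ph) 0 (2 * PI))
           (fun x th => RInt (fun ph => F' x th ph) 0 (2 * PI))).
  - intros x th. apply (is_derive_RInt_cont (fun y ph => F y th ph) (fun y ph => F' y th ph)).
    + intros; apply Hd.
    + intros y. apply cont2_slice, Hc.
    + apply (cont_comp _ (fun p : R * R => (fst p, th, snd p)) Hc'). ct.
  - intros x. apply cont_S2_inner, Hc.
  - apply (cont_RInt (fun (p : R * R) ph => F' (fst p) (snd p) ph)). exact Hc'.
Qed.

(* No Fubini is needed: the theta-derivative is moved outside the integral over phi. *)
Lemma S2_div (A A' B B' : R -> R -> R) :
  cont2 A -> cont2 A' -> cont2 B' ->
  (forall th ph, is_derive (fun y => A y ph) th (A' th ph)) ->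
  (forall th ph, is_derive (fun y => B th y) ph (B' th ph)) ->
  (forall ph, A 0 ph = 0) -> (forall ph, A PI ph = 0) ->
  (forall th, B th (2 * PI) = B th 0) ->
  S2 (fun th ph => A' th ph + B' th ph) = 0.
Proof.
  intros CA CA' CB' HA HB A0 A1 HP.
  rewrite S2_plus; auto.
  assert (E1 : S2 A' = 0).
  { unfold S2.
    rewrite (RInt_FTC (fun th => RInt (fun ph => A th ph) 0 (2 * PI))).
    - rewrite (RInt_ext _ (fun _ => 0)); [| intros; apply A1].
      rewrite (RInt_ext (fun ph => A 0 ph) (fun _ => 0)); [| intros; apply A0]. unfold Rminus; apply Rplus_opp_r.
    - apply is_derive_RInt_cont; auto. intros; now apply cont2_slice.
    - now apply cont_S2_inner. }
  assert (E2 : S2 B' = 0).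
  { unfold S2. rewrite (RInt_ext _ (fun _ => 0)).
    - rewrite RInt_const. apply Rmult_0_r.
    - intros th _. rewrite (RInt_FTC (B th) (B' th)); auto.
      + rewrite HP. apply Rminus_diag_eq; reflexivity.
      + now apply cont2_slice. }
  lra.
Qed.

Definition ray (x : R3) (h : R) (o : R3) : R3 := plus x (scal h o).

Lemma cont_ray {U : UniformSpace} (x : U -> R3) (h : U -> R) (o : U -> R3) :
  cont x -> cont h -> cont o -> cont (fun u => ray (x u) (h u) (o u)).
Proof. intros. unfold ray. ct. Qed.

Ltac ct_more ::=
  match goal with
  | |- cont (fun u => ray (@?x u) (@?h u) (@?o u)) => apply (cont_ray x h o)
  end.

Lemma cont_om {U : UniformSpace} (f g : U -> R) :
  cont f -> cont g -> cont (fun u => om (f u) (g u)).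
Proof. intros. unfold om. ct. Qed.

Lemma cont_Sph {U : UniformSpace} (k : U -> R3 -> R) :
  cont (fun p : U * R3 => k (fst p) (snd p)) -> cont (fun u => Sph (k u)).
Proof.
  intros H. unfold Sph.
  apply (cont_mult (fun _ => / (4 * PI))); [apply cont_const |].
  apply (cont_S2 (fun u th ph => sin th * k u (om th ph))).
  apply (cont_mult (fun p : U * R * R => sin (snd (fst p)))); [ct |].
  apply (cont_comp (fun p : U * R3 => k (fst p) (snd p))
     (fun p : U * R * R => (fst (fst p), om (snd (fst p)) (snd p))) H).
  apply cont_pair; [ct |]. apply cont_om; ct.
Qed.

Lemma cont2_Sph (k : R3 -> R) : cont k -> cont2 (fun th ph => sin th * k (om th ph)).
Proof.
  intros H. unfold cont2. apply cont_mult; [ct |].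
  apply (cont_comp k); auto. apply cont_om; ct.
Qed.

Lemma Sph_ext (k l : R3 -> R) : (forall th ph, k (om th ph) = l (om th ph)) -> Sph k = Sph l.
Proof. intros H. unfold Sph. f_equal. apply S2_ext. intros. now rewrite H. Qed.

Lemma Sph_plus (k l : R3 -> R) : cont k -> cont l ->
  Sph (fun o => k o + l o) = Sph k + Sph l.
Proof.
  intros Hk Hl. unfold Sph. rewrite <- Rmult_plus_distr_l, <- S2_plus; try now apply cont2_Sph.
  f_equal. apply S2_ext. intros; ring.
Qed.

Lemma Sph_scal c (k : R3 -> R) : cont k -> Sph (fun o => c * k o) = c * Sph k.
Proof.
  intros Hk. unfold Sph.
  rewrite (S2_ext _ (fun th ph => c * (sin th * k (om th ph)))); [| intros; ring].
  rewrite S2_scal; [ring | now apply cont2_Sph].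
Qed.

Lemma Sph_const c : Sph (fun _ => c) = c.
Proof.
  unfold Sph, S2. pose proof PI_RGT_0.
  rewrite (RInt_ext _ (fun th => 2 * PI * c * sin th)).
  - rewrite RIntZ; [| ct].
    rewrite (RInt_FTC (fun x => - cos x) sin).
    + rewrite cos_0, cos_PI. field. lra.
    + intros x. auto_derive; auto. ring.
    + apply (cont_sin (fun x => x)). ct.
  - intros. rewrite (RInt_constR (sin x * c)). change (@eq R ((2 * PI - 0) * (sin x * c)) (2 * PI * c * sin x)). ring.
Qed.

Lemma Sph_le (k l : R3 -> R) : cont k -> cont l ->
  (forall th ph, k (om th ph) <= l (om th ph)) -> Sph k <= Sph l.
Proof.
  intros Hk Hl H. unfold Sph. pose proof PI_RGT_0.
  apply Rmult_le_compat_l. { left; apply Rinv_0_lt_compat; lra. }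
  apply S2_le; try now apply cont2_Sph.
  intros. apply Rmult_le_compat_l; auto. apply sin_ge_0; lra.
Qed.

Lemma Sph_abs (k h : R3 -> R) : cont k -> cont h ->
  (forall th ph, Rabs (k (om th ph)) <= h (om th ph)) -> Rabs (Sph k) <= Sph h.
Proof.
  intros Hk Hh H. apply Rabs_le. split.
  - replace (- Sph h) with (Sph (fun o => -1 * h o)).
    + apply Sph_le; auto. ct. intros. specialize (H th ph). apply Rabs_le_between in H. lra.
    + rewrite Sph_scal; auto. ring.
  - apply Sph_le; auto. intros. specialize (H th ph). apply Rabs_le_between in H. lra.
Qed.

Lemma is_derive_Sph (k k' : R -> R3 -> R) :
  (forall x th ph, is_derive (fun y => k y (om th ph)) x (k' x (om th ph))) ->
  (forall x, cont (k x)) ->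
  cont (fun p : R * R3 => k' (fst p) (snd p)) ->
  forall x, is_derive (fun y => Sph (k y)) x (Sph (k' x)).
Proof.
  intros Hd Hc Hc' x. unfold Sph.
  apply (is_derive_scal (fun y => S2 (fun th ph => sin th * k y (om th ph)))).
  apply (is_derive_S2 (fun y th ph => sin th * k y (om th ph))
     (fun y th ph => sin th * k' y (om th ph))).
  - intros y th ph. apply (is_derive_scal (fun y => k y (om th ph))). apply Hd.
  - intros y. now apply cont2_Sph.
  - apply (cont_mult (fun p : R * R * R => sin (snd (fst p)))); [ct |].
    apply (cont_comp _ (fun p : R * R * R => (fst (fst p), om (snd (fst p)) (snd p))) Hc').
    apply cont_pair; [ct |]. apply cont_om; ct.
Qed.

(** Common form of [Duh] and of its time derivative [DuhT]. The kernel sees the delay [tau], the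
    point of the light cone and the direction separately, so that a space derivative acts on the
    middle argument alone. *)
Definition Ret (z : R -> spacetime -> R3 -> R) (q : spacetime) : R :=
  RInt (fun s => Sph (fun o =>
    z (fst q - s) (s, ray (snd q) (fst q - s) o) o)) 0 (fst q).

Definition cont3 (z : R -> spacetime -> R3 -> R) : Prop :=
  cont (fun p : R * spacetime * R3 => z (fst (fst p)) (snd (fst p)) (snd p)).

Lemma cont3_comp {U : UniformSpace} (z : R -> spacetime -> R3 -> R) (a : U -> R)
  (b : U -> spacetime) (c : U -> R3) :
  cont3 z -> cont a -> cont b -> cont c -> cont (fun u => z (a u) (b u) (c u)).
Proof.
  intros H Ha Hb Hc.
  apply (cont_comp (fun p : R * spacetime * R3 => z (fst (fst p)) (snd (fst p)) (snd p))
    (fun u => (a u, b u, c u)) H). ct.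
Qed.

Lemma cont_Ret_integrand (z : R -> spacetime -> R3 -> R) : cont3 z ->
  cont (fun p : spacetime * R => Sph (fun o =>
    z (fst (fst p) - snd p) (snd p, ray (snd (fst p)) (fst (fst p) - snd p) o) o)).
Proof.
  intros Hz.
  apply (cont_Sph (fun (p : spacetime * R) o =>
    z (fst (fst p) - snd p) (snd p, ray (snd (fst p)) (fst (fst p) - snd p) o) o)).
  apply (cont3_comp z (fun p : spacetime * R * R3 => fst (fst (fst p)) - snd (fst p))
    (fun p => (snd (fst p), ray (snd (fst (fst p))) (fst (fst (fst p)) - snd (fst p)) (snd p)))
    (fun p => snd p)); auto; ct.
Qed.

Lemma cont_Ret (z : R -> spacetime -> R3 -> R) : cont3 z -> cont (Ret z).
Proof.
  intros Hz. unfold Ret.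
  apply (cont_RInt_var (fun (q : spacetime) s => Sph (fun o =>
    z (fst q - s) (s, ray (snd q) (fst q - s) o) o)) (fun q => fst q)).
  - now apply cont_Ret_integrand.
  - ct.
Qed.

Lemma Ret_ext (z z' : R -> spacetime -> R3 -> R) q :
  (forall tau y o, z tau y o = z' tau y o) -> Ret z q = Ret z' q.
Proof. intros H. apply RInt_extR. intros. apply Sph_ext. intros. apply H. Qed.

Lemma cont_Ret_slice (z : R -> spacetime -> R3 -> R) tau s (x : R3) : cont3 z ->
  cont (fun o : R3 => z tau (s, ray x tau o) o).
Proof. intros H. apply (cont3_comp z (fun _ : R3 => tau) (fun o => (s, ray x tau o)) (fun o => o)); auto; ct. Qed.

Lemma cont_Ret_slice2 (z : R -> spacetime -> R3 -> R) t (x : R3) : cont3 z ->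
  cont (fun s => Sph (fun o : R3 => z (t - s) (s, ray x (t - s) o) o)).
Proof.
  intros H. apply (cont_comp _ (fun s => ((t, x) : spacetime, s)) (cont_Ret_integrand z H)). ct.
Qed.

Lemma Ret_plus (z z' : R -> spacetime -> R3 -> R) q : cont3 z -> cont3 z' ->
  Ret (fun tau y o => z tau y o + z' tau y o) q = Ret z q + Ret z' q.
Proof.
  intros H H'. unfold Ret.
  rewrite <- RIntD; try now apply cont_Ret_slice2.
  apply RInt_extR. intros s. apply Sph_plus; now apply cont_Ret_slice.
Qed.

Lemma Ret_scal c (z : R -> spacetime -> R3 -> R) q : cont3 z ->
  Ret (fun tau y o => c * z tau y o) q = c * Ret z q.
Proof.
  intros H. unfold Ret.
  rewrite <- RIntZ; try now apply cont_Ret_slice2.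
  apply RInt_extR. intros s. apply Sph_scal; now apply cont_Ret_slice.
Qed.

Definition Duh (w : spacetime -> R) : spacetime -> R := Ret (fun tau y _ => tau * w y).

Lemma cont3_Duh (w : spacetime -> R) : cont w -> cont3 (fun tau y _ => tau * w y).
Proof. intros H. unfold cont3. ct. Qed.

Lemma cont_Duh (w : spacetime -> R) : cont w -> cont (Duh w).
Proof. intros H. now apply cont_Ret, cont3_Duh. Qed.

Lemma Duh_plus (w w' : spacetime -> R) q : cont w -> cont w' ->
  Duh (fun y => w y + w' y) q = Duh w q + Duh w' q.
Proof.
  intros H H'. unfold Duh. rewrite <- Ret_plus; try now apply cont3_Duh.
  apply Ret_ext. intros; ring.
Qed.

Lemma Duh_scal c (w : spacetime -> R) q : cont w ->
  Duh (fun y => c * w y) q = c * Duh w q.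
Proof.
  intros H. unfold Duh. rewrite <- Ret_scal; try now apply cont3_Duh.
  apply Ret_ext. intros; ring.
Qed.

Lemma Duh_minus (w w' : spacetime -> R) q : cont w -> cont w' ->
  Duh (fun y => w y - w' y) q = Duh w q - Duh w' q.
Proof.
  intros H H'.
  transitivity (Duh (fun y => w y + -1 * w' y) q).
  - apply Ret_ext. intros; ring.
  - rewrite (Duh_plus w (fun y => -1 * w' y)), Duh_scal; auto; [ring | ct].
Qed.

Ltac ct_sphere :=
  match goal with
  | |- cont (fun u => om (@?f u) (@?g u)) => apply (cont_om f g)
  | |- cont (fun u => ray (@?x u) (@?h u) (@?o u)) => apply (cont_ray x h o)
  | |- cont (fun u => Sph (@?k u)) => apply (cont_Sph k)
  | |- cont (fun u => Duh ?w (@?f u)) => apply (cont_comp (Duh w) f); [apply (cont_Duh w) |]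
  | |- cont (Duh ?w) => apply (cont_Duh w)
  end.
Ltac ct_more ::= ct_sphere.

(** * Directional derivatives *)

Lemma is_derive_quot (f : R -> R) (x l : R) :
  is_derive f x l <->
  filterlim (fun h => (f (x + h) - f x) / h) (locally' 0) (locally l).
Proof.
  rewrite is_derive_Reals. split.
  - intros H. apply filterlim_locally. intros eps.
    destruct (H eps (cond_pos eps)) as [d Hd]. exists d. intros h Hh Hne.
    apply Hd; auto. change (Rabs (h - 0) < d) in Hh. now rewrite Rminus_0_r in Hh.
  - intros H eps Heps.
    destruct (proj1 (filterlim_locally _ _) H (mkposreal eps Heps)) as [d Hd].
    exists d. intros h Hne Hh. apply Hd; auto.
    change (Rabs (h - 0) < d). now rewrite Rminus_0_r.
Qed.

Lemma plus_scal_0 {V : NormedModule R_AbsRing} (q e : V) : plus q (scal 0 e) = q.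
Proof. exact (eq_trans (f_equal (plus q) (scal_zero_l e)) (plus_zero_r q)). Qed.

(** A relation between two functions on the whole space: derivatives are carried along as explicit
    formulas, and [pderiv] is evaluated only at the very end. *)
Definition Dir {V : NormedModule R_AbsRing} (e : V) (u v : V -> R) : Prop :=
  forall q : V, is_derive (fun h : R => u (plus q (scal h e))) 0 (v q).

Lemma Dir_line {V : NormedModule R_AbsRing} (e : V) (u v : V -> R) :
  Dir e u v -> forall q h, is_derive (fun k : R => u (plus q (scal k e))) h
    (v (plus q (scal h e))).
Proof.
  intros H q h.
  apply (is_derive_ext (fun k => (fun j : R => u (plus (plus q (scal h e)) (scal j e))) (k - h))).
  - intros k. simpl. f_equal. rewrite <- plus_assoc. f_equal.
    rewrite <- scal_distr_r. f_equal. change (h + (k - h) = k). ring.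
  - replace (v (plus q (scal h e))) with (scal 1 (v (plus q (scal h e)))) by apply (scal_one (v (plus q (scal h e)))).
    apply (is_derive_comp (fun j : R => u (plus (plus q (scal h e)) (scal j e))) (fun k => k - h)).
    + replace (h - h) with 0 by ring. apply H.
    + auto_derive; auto; ring.
Qed.

(** Since [f x = 0], the difference quotient of the product is that of [f] times [g (x + h)], so
    continuity of [g] is enough. This serves twice: for the chain rule below and for [u |u|^a] at
    [u = 0]. *)
Lemma is_derive_mult_zero (f g : R -> R) (x f' : R) :
  is_derive f x f' -> f x = 0 -> continuous g x ->
  is_derive (fun y => f y * g y) x (f' * g x).
Proof.
  intros Hf H0 Hg. apply is_derive_quot. apply is_derive_quot in Hf.
  apply (filterlim_ext (fun h => (f (x + h) - f x) / h * g (x + h))).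
  { intros h. rewrite H0. unfold Rdiv. ring. }
  apply (filterlim_comp_2 (G := locally f') (H := locally (g x)) _ _ Rmult); [exact Hf | |].
  - assert (Hc : continuous (fun h => g (x + h)) 0).
    { apply continuous_comp. apply (continuous_plus (fun _ => x) (fun h => h));
      [apply continuous_const | apply continuous_id]. now rewrite Rplus_0_r. }
    unfold continuous in Hc. rewrite Rplus_0_r in Hc.
    intros P HP. destruct (Hc P HP) as [d Hd]. exists d. intros y Hy _. now apply Hd.
  - apply (@filterlim_mult R_AbsRing).
Qed.

(** Lets one slot of [G] vary along [a] while the others merely follow a continuous [b]. The
    increment is [(a r - a s)] times the mean of [G1] over the segment; the first factor vanishes at
    [s] and the second is continuous there. *)
Lemma chain1 {U : UniformSpace} (G G1 : R * U -> R) (a : R -> R) (b : R -> U) s a' :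
  (forall x u, is_derive (fun y => G (y, u)) x (G1 (x, u))) -> cont G1 ->
  is_derive a s a' -> continuous b s ->
  is_derive (fun r => G (a r, b r) - G (a s, b r)) s (a' * G1 (a s, b s)).
Proof.
  intros HG HG1 Ha Hb.
  assert (E : forall x y u, G (y, u) - G (x, u) =
     (y - x) * RInt (fun r => G1 (x + r * (y - x), u)) 0 1).
  { intros x y u. rewrite <- RIntZ.
    - rewrite (RInt_FTC (fun r => G (x + r * (y - x), u))).
      + rewrite Rmult_1_l, Rmult_0_l, Rplus_0_r.
        replace (x + (y - x)) with y by ring. reflexivity.
      + intros r. apply (is_derive_comp (fun z => G (z, u)) (fun r => x + r * (y - x))).
        * apply HG.
        * auto_derive; auto; ring.
      + ct.
    - ct. }
  apply (is_derive_ext (fun r => (a r - a s) * RInt (fun k => G1 (a s + k * (a r - a s), b r)) 0 1)).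
  { intros r. symmetry. apply E. }
  replace (G1 (a s, b s)) with (RInt (fun k => G1 (a s + k * (a s - a s), b s)) 0 1).
  2:{ rewrite (RInt_extR _ (fun _ => G1 (a s, b s))).
      - rewrite RInt_constR; rring.
      - intros k. f_equal. f_equal. rring. }
  apply (is_derive_mult_zero (fun r => a r - a s) (fun r => RInt (fun k => G1 (a s + k * (a r - a s), b r)) 0 1)).
  - replace a' with (a' - 0) by ring. apply (is_derive_minus a (fun _ => a s)); auto.
    apply (is_derive_const (a s)).
  - rring.
  - apply (continuous_comp (fun r => (a r, b r))
      (fun p : R * U => RInt (fun k => G1 (a s + k * (fst p - a s), snd p)) 0 1)).
    + apply (continuous_comp_2 a b (fun x y => (x, y))); auto.
      * apply (@ex_derive_continuous R_AbsRing). eexists; apply Ha.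
      * apply (cont_pair (fun p : R * U => fst p) (fun p => snd p)); ct.
    + apply (cont_RInt (fun (p : R * U) k => G1 (a s + k * (fst p - a s), snd p))). ct.
Qed.

Inductive axis := X1 | X2 | X3.
Definition axis_vec (i : axis) : R3 := match i with X1 => e1 | X2 => e2 | X3 => e3 end.
Definition coord (i : axis) (x : R3) : R :=
  match i with X1 => fst (fst x) | X2 => snd (fst x) | X3 => snd x end.
Definition sum3 (F : axis -> R) : R := F X1 + F X2 + F X3.

Definition rdot {V : Type} (o : R3) (g : axis -> V -> R) (y : V) : R :=
  sum3 (fun i => coord i o * g i y).

Lemma cont_sum3 {U : UniformSpace} (F : U -> axis -> R) :
  (forall i, cont (fun u => F u i)) -> cont (fun u => sum3 (F u)).
Proof. intros H. unfold sum3. apply cont_plus; [apply cont_plus |]; apply H. Qed.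

Lemma cont_coord {U : UniformSpace} i (f : U -> R3) : cont f -> cont (fun u => coord i (f u)).
Proof. intros H. destruct i; simpl; ct. Qed.

Lemma cont_rdot {U V : UniformSpace} (o : U -> R3) (g : axis -> V -> R) (y : U -> V) :
  cont o -> (forall i, cont (g i)) -> cont y -> cont (fun u => rdot (o u) g (y u)).
Proof.
  intros. apply (cont_sum3 (fun u i => coord i (o u) * g i (y u))).
  intros i. apply cont_mult; [now apply cont_coord | ct].
Qed.

Ltac ct_vector :=
  match goal with
  | |- cont (fun u => rdot (@?o u) ?g (@?y u)) => apply (cont_rdot o g y); [| intro |]
  | |- cont (fun u => coord ?i (@?f u)) => apply (cont_coord i f)
  | |- cont (fun u => sum3 (@?F u)) => apply (cont_sum3 F); intro
  end.
Ltac ct_more ::= first [ct_sphere | ct_vector].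

Definition grad (g : R3 -> R) (g' : axis -> R3 -> R) : Prop :=
  cont g /\ forall i, cont (g' i) /\ Dir (axis_vec i) g (g' i).

Lemma vec_eq (x1 x2 x3 y1 y2 y3 h : R) :
  (plus (x1, x2, x3) (scal h (y1, y2, y3)) : R3) = (x1 + h * y1, x2 + h * y2, x3 + h * y3).
Proof. reflexivity. Qed.

Lemma R3_eq (x y : R3) : (forall i, coord i x = coord i y) -> x = y.
Proof.
  destruct x as [[a b] c], y as [[a' b'] c']. intros H.
  generalize (H X1) (H X2) (H X3). simpl. intros -> -> ->. reflexivity.
Qed.

Lemma coord_plus i (x : R3) h (y : R3) : coord i (plus x (scal h y)) = coord i x + h * coord i y.
Proof. destruct i, x as [[a b] c], y as [[a' b'] c']; reflexivity. Qed.

Lemma coord_mv i (x : R3) h (y : R3) : coord i (ray x h y) = coord i x + h * coord i y.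
Proof. apply coord_plus. Qed.

Lemma ray_0 (x o : R3) : ray x 0 o = x.
Proof. apply R3_eq. intros i. rewrite coord_mv. ring. Qed.

Lemma shift_derive (f : R -> R) (x l : R) :
  is_derive (fun h => f (x + h)) 0 l <-> is_derive f x l.
Proof.
  rewrite !is_derive_quot.
  split; apply filterlim_ext; intros h; now rewrite Rplus_0_l, Rplus_0_r.
Qed.

(** Continuous partial derivatives give differentiability along a curve. The increment is telescoped
    by freezing one coordinate at a time: [chain1] treats the first two differences, and the last
    term is a chain rule in one variable. *)
Lemma chain3 (g : R3 -> R) (g' : axis -> R3 -> R) (a b c : R -> R) s a' b' c' :
  grad g g' -> is_derive a s a' -> is_derive b s b' -> is_derive c s c' ->
  is_derive (fun r => g (a r, b r, c r)) s (rdot (a', b', c') g' (a s, b s, c s)).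
Proof.
  intros [Hg Hg'] Ha Hb Hc.
  assert (cA : continuous a s) by (apply (@ex_derive_continuous R_AbsRing); eexists; eauto).
  assert (cB : continuous b s) by (apply (@ex_derive_continuous R_AbsRing); eexists; eauto).
  assert (cC : continuous c s) by (apply (@ex_derive_continuous R_AbsRing); eexists; eauto).
  assert (D1 : forall x y z, is_derive (fun r => g (r, y, z)) x (g' X1 (x, y, z))).
  { intros x y z. apply shift_derive. destruct (Hg' X1) as [_ H].
    apply (is_derive_ext (fun h : R => g (plus (x, y, z) (scal h e1)))); [| apply H].
    intros h. unfold e1. rewrite vec_eq. now rewrite Rmult_1_r, !Rmult_0_r, !Rplus_0_r. }
  assert (D2 : forall x y z, is_derive (fun r => g (x, r, z)) y (g' X2 (x, y, z))).
  { intros x y z. apply shift_derive. destruct (Hg' X2) as [_ H].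
    apply (is_derive_ext (fun h : R => g (plus (x, y, z) (scal h e2)))); [| apply H].
    intros h. unfold e2. rewrite vec_eq. now rewrite Rmult_1_r, !Rmult_0_r, !Rplus_0_r. }
  assert (D3 : forall x y z, is_derive (fun r => g (x, y, r)) z (g' X3 (x, y, z))).
  { intros x y z. apply shift_derive. destruct (Hg' X3) as [_ H].
    apply (is_derive_ext (fun h : R => g (plus (x, y, z) (scal h e3)))); [| apply H].
    intros h. unfold e3. rewrite vec_eq. now rewrite Rmult_1_r, !Rmult_0_r, !Rplus_0_r. }
  assert (C' : forall i, cont (g' i)) by (intros i; apply Hg').
  assert (P1 := chain1 (fun p : R * (R * R) => g (fst p, fst (snd p), snd (snd p)))
     (fun p => g' X1 (fst p, fst (snd p), snd (snd p))) a (fun r => (b r, c r)) s a').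
  assert (P2 := chain1 (fun p : R * R => g (a s, fst p, snd p))
     (fun p => g' X2 (a s, fst p, snd p)) b c s b').
  simpl in P1, P2.
  apply (is_derive_ext (fun r => (g (a r, b r, c r) - g (a s, b r, c r)) +
    ((g (a s, b r, c r) - g (a s, b s, c r)) + g (a s, b s, c r)))).
  { intros r. change (@eq R ((g (a r, b r, c r) - g (a s, b r, c r)) +
    ((g (a s, b r, c r) - g (a s, b s, c r)) + g (a s, b s, c r))) (g (a r, b r, c r))). ring. }
  replace (rdot (a', b', c') g' (a s, b s, c s)) with
    (a' * g' X1 (a s, b s, c s) + (b' * g' X2 (a s, b s, c s) + c' * g' X3 (a s, b s, c s)))
    by (unfold rdot, sum3; simpl; ring).
  apply (is_derive_plus (fun r => g (a r, b r, c r) - g (a s, b r, c r))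
    (fun r => (g (a s, b r, c r) - g (a s, b s, c r)) + g (a s, b s, c r))).
  - apply P1; auto.
    + ct.
    + apply (continuous_comp_2 b c (fun x y => (x, y))); auto.
      apply (cont_pair (fun p : R * R => fst p) (fun p => snd p)); ct.
  - apply (is_derive_plus (fun r => g (a s, b r, c r) - g (a s, b s, c r))
      (fun r => g (a s, b s, c r))).
    + apply P2; auto. ct.
    + apply (is_derive_comp (fun z => g (a s, b s, z)) c); auto.
Qed.

Lemma Dir_any (g : R3 -> R) (g' : axis -> R3 -> R) (v : R3) :
  grad g g' -> Dir v g (fun y => rdot v g' y).
Proof.
  intros H [[x y] z]. destruct v as [[a b] c].
  apply (is_derive_ext (fun h => g (x + h * a, y + h * b, z + h * c))).
  { intros h. reflexivity. }
  assert (A := chain3 g g' (fun h => x + h * a) (fun h => y + h * b) (fun h => z + h * c) 0 a b c H).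
  cbv beta in A. rewrite !Rmult_0_l, !Rplus_0_r in A. apply A; auto_derive; auto; ring.
Qed.

(** * The Darboux identity *)

(** The polar derivative of [om th ph]. The vectors [om th ph], [omt th ph] and [omp ph] form an
    orthonormal frame. *)
Definition omt (th ph : R) : R3 := (cos th * cos ph, cos th * sin ph, - sin th).
(* [sin th * omp ph] is the azimuthal derivative of [om th ph]; leaving out the factor
   [sin th] keeps the divergence identities below free of singularities at the poles. *)
Definition omp (ph : R) : R3 := (- sin ph, cos ph, 0).
Definition ompp (ph : R) : R3 := (- cos ph, - sin ph, 0).

Definition hess {V : Type} (o : R3) (g'' : axis -> axis -> V -> R) (y : V) : R :=
  rdot o (fun i => rdot o (g'' i)) y.
Definition lap {V : Type} (g'' : axis -> axis -> V -> R) (y : V) : R :=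
  sum3 (fun i => g'' i i y).

Definition grad2 g g' g'' : Prop := grad g g' /\ forall i, grad (g' i) (g'' i).

Lemma is_derive_plusR (f g : R -> R) (x a b : R) : is_derive f x a -> is_derive g x b ->
  is_derive (fun y => f y + g y) x (a + b).
Proof. intros. now apply (is_derive_plus f g). Qed.

Lemma is_derive_minusR (f g : R -> R) (x a b : R) : is_derive f x a -> is_derive g x b ->
  is_derive (fun y => f y - g y) x (a - b).
Proof. intros. now apply (is_derive_minus f g). Qed.

Lemma is_derive_multR (f g : R -> R) (x a b : R) : is_derive f x a -> is_derive g x b ->
  is_derive (fun y => f y * g y) x (a * g x + f x * b).
Proof. intros. apply (is_derive_mult f g); auto. intros n m; apply Rmult_comm. Qed.

Lemma is_derive_eq (f : R -> R) (x a b : R) : is_derive f x a -> a = b -> is_derive f x b.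
Proof. now intros H <-. Qed.

Lemma rdot_derive (v1 v2 v3 : R -> R) (h : axis -> R -> R) (s a b c : R) (l : axis -> R) :
  is_derive v1 s a -> is_derive v2 s b -> is_derive v3 s c ->
  (forall i, is_derive (h i) s (l i)) ->
  is_derive (fun r => rdot (v1 r, v2 r, v3 r) h r) s
   (rdot (a, b, c) h s + sum3 (fun i => coord i (v1 s, v2 s, v3 s) * l i)).
Proof.
  intros H1 H2 H3 H. unfold rdot, sum3; simpl.
  eapply is_derive_eq.
  - apply is_derive_plusR; [apply is_derive_plusR |]; apply is_derive_multR;
      solve [eassumption | apply H].
  - ring.
Qed.

Lemma is_derive_om_th (g : R3 -> R) g' (x : R3) tau th ph : grad g g' ->
  is_derive (fun r => g (ray x tau (om r ph))) th
    (tau * rdot (omt th ph) g' (ray x tau (om th ph))).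
Proof.
  intros H. destruct x as [[x y] z].
  eapply is_derive_eq.
  - apply (chain3 g g' (fun r => x + tau * (sin r * cos ph)) (fun r => y + tau * (sin r * sin ph))
     (fun r => z + tau * cos r) th (tau * (cos th * cos ph)) (tau * (cos th * sin ph)) (tau * - sin th) H);
    auto_derive; auto; ring.
  - unfold rdot, sum3; simpl. unfold ray, om. rewrite vec_eq. ring.
Qed.

Lemma is_derive_om_ph (g : R3 -> R) g' (x : R3) tau th ph : grad g g' ->
  is_derive (fun r => g (ray x tau (om th r))) ph
    (tau * sin th * rdot (omp ph) g' (ray x tau (om th ph))).
Proof.
  intros H. destruct x as [[x y] z].
  eapply is_derive_eq.
  - apply (chain3 g g' (fun r => x + tau * (sin th * cos r)) (fun r => y + tau * (sin th * sin r))
     (fun r => z + tau * cos th) ph (tau * (sin th * - sin ph)) (tau * (sin th * cos ph)) 0 H);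
    auto_derive; auto; ring.
  - unfold rdot, sum3; simpl. unfold ray, om. rewrite vec_eq. ring.
Qed.

Lemma is_derive_ray (g : R3 -> R) g' (x : R3) tau o : grad g g' ->
  is_derive (fun r => g (ray x r o)) tau (rdot o g' (ray x tau o)).
Proof. intros H. apply (Dir_line o g (fun y => rdot o g' y)). now apply Dir_any. Qed.

Lemma cont_omt {U : UniformSpace} (f g : U -> R) :
  cont f -> cont g -> cont (fun u => omt (f u) (g u)).
Proof. intros. unfold omt. ct. Qed.

Lemma cont_omp {U : UniformSpace} (f : U -> R) : cont f -> cont (fun u => omp (f u)).
Proof. intros. unfold omp. ct. Qed.

Lemma cont_ompp {U : UniformSpace} (f : U -> R) : cont f -> cont (fun u => ompp (f u)).
Proof. intros. unfold ompp. ct. Qed.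

Lemma cont_hess {U V : UniformSpace} (o : U -> R3) (g : axis -> axis -> V -> R) (y : U -> V) :
  cont o -> (forall i j, cont (g i j)) -> cont y -> cont (fun u => hess (o u) g (y u)).
Proof.
  intros. unfold hess. apply (cont_sum3 (fun u i => coord i (o u) * rdot (o u) (g i) (y u))).
  intros i. ct.
Qed.

Lemma cont_lap {U V : UniformSpace} (g : axis -> axis -> V -> R) (y : U -> V) :
  (forall i j, cont (g i j)) -> cont y -> cont (fun u => lap g (y u)).
Proof. intros. apply (cont_sum3 (fun u i => g i i (y u))). intros i. ct. Qed.

Ltac ct_frame :=
  match goal with
  | |- cont (fun u => omt (@?f u) (@?g u)) => apply (cont_omt f g)
  | |- cont (fun u => omp (@?f u)) => apply (cont_omp f)
  | |- cont (fun u => ompp (@?f u)) => apply (cont_ompp f)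
  | |- cont (fun u => hess (@?o u) ?g (@?y u)) => apply (cont_hess o g y); [| intros ? ? |]
  | |- cont (fun u => lap ?g (@?y u)) => apply (cont_lap g y); [intros ? ? |]
  | |- cont (lap ?g) => apply (cont_lap g (fun u => u)); [intros ? ? |]
  end.
Ltac ct_more ::= first [ct_sphere | ct_frame | ct_vector].

(* [sin th] times the integrand is [- (d/dth (sin th (omt . grad g)) + d/dph (omp . grad g))]. *)
Lemma Darboux_identity g g' g'' (x : R3) tau : grad2 g g' g'' ->
  Sph (fun o => 2 * rdot o g' (ray x tau o) +
     tau * (hess o g'' (ray x tau o) - lap g'' (ray x tau o))) = 0.
Proof.
  intros [Hg Hg'].
  assert (C1 : forall i, cont (g' i)) by (intros i; apply Hg).
  assert (C2 : forall i j, cont (g'' i j)) by (intros i j; apply Hg').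
  unfold Sph.
  pose (Y := fun th ph => ray x tau (om th ph)).
  pose (A := fun th ph => sin th * rdot (omt th ph) g' (Y th ph)).
  pose (A' := fun th ph => cos th * rdot (omt th ph) g' (Y th ph) +
     sin th * (- rdot (om th ph) g' (Y th ph) + tau * hess (omt th ph) g'' (Y th ph))).
  pose (B := fun th ph => rdot (omp ph) g' (Y th ph)).
  pose (B' := fun th ph => rdot (ompp ph) g' (Y th ph) + tau * sin th * hess (omp ph) g'' (Y th ph)).
  assert (HY : cont (fun p : R * R => Y (fst p) (snd p))) by (unfold Y; ct).
  assert (E : S2 (fun th ph => A' th ph + B' th ph) = 0).
  { apply (S2_div A A' B B').
    - unfold cont2, A, Y. ct.
    - unfold cont2, A', Y. ct.
    - unfold cont2, B', Y. ct.
    - intros th ph. unfold A, A'. eapply is_derive_eq.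
      + apply (is_derive_multR sin (fun y => rdot (omt y ph) g' (Y y ph)) th (cos th)
          (- rdot (om th ph) g' (Y th ph) + tau * hess (omt th ph) g'' (Y th ph))).
        * auto_derive; auto; ring.
        * eapply is_derive_eq.
          -- apply (rdot_derive (fun y => cos y * cos ph) (fun y => cos y * sin ph) (fun y => - sin y)
               (fun i y => g' i (Y y ph)) th (- sin th * cos ph) (- sin th * sin ph) (- cos th)
               (fun i => tau * rdot (omt th ph) (g'' i) (Y th ph)));
             try (auto_derive; auto; ring).
             intros i. now apply is_derive_om_th.
          -- unfold hess, rdot, sum3, om, omt; simpl. ring.
      + simpl. ring.
    - intros th ph. unfold B, B'. eapply is_derive_eq.
      + apply (rdot_derive (fun y => - sin y) (fun y => cos y) (fun y => 0)
               (fun i y => g' i (Y th y)) ph (- cos ph) (- sin ph) 0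
               (fun i => tau * sin th * rdot (omp ph) (g'' i) (Y th ph)));
             try (auto_derive; auto; ring).
             intros i. now apply is_derive_om_ph.
      + unfold hess, rdot, sum3, ompp, omp; simpl. ring.
    - intros ph. unfold A. rewrite sin_0. ring.
    - intros ph. unfold A. rewrite sin_PI. ring.
    - intros th. unfold B, Y, om, omp. now rewrite cos_2PI, sin_2PI, cos_0, sin_0. }
  rewrite (S2_ext _ (fun th ph => -1 * (A' th ph + B' th ph))).
  - rewrite S2_scal, E; [ring |]. unfold cont2, A', B', Y. ct.
  - intros th ph. unfold A', B'. fold (Y th ph). generalize (Y th ph). intros y.
    (* Two facts about the frame are checked here in coordinates: the Laplacian is the sum of the
       Hessian terms along [om], [omt] and [omp], and [ompp ph = - (sin th * om th ph + cos th * omt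
       th ph)], so that the first-order terms of [A' + B'] add up to [- 2 sin th] times the radial
       derivative. *)
    assert (T1 : sin th * sin th = 1 - cos th * cos th) by (pose proof (sin2_cos2 th); unfold Rsqr in *; lra).
    assert (T2 : sin ph * sin ph = 1 - cos ph * cos ph) by (pose proof (sin2_cos2 ph); unfold Rsqr in *; lra).
    unfold hess, lap, rdot, sum3, om, omt, omp, ompp; simpl.
    ring [T1 T2].
Qed.

(** * Derivatives of retarded integrals *)

(** The solution at time [tau] of the free wave equation with data [(0, g)]. Its [tau]-derivative
    [Kir'] is the solution with data [(g, 0)]. *)
Definition Kir (g : R3 -> R) (x : R3) (tau : R) : R :=
  tau * Sph (fun o => g (ray x tau o)).

Definition Kir' (g : R3 -> R) (g' : axis -> R3 -> R) (x : R3) (tau : R) : R :=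
  Sph (fun o => g (ray x tau o) + tau * rdot o g' (ray x tau o)).

Lemma is_derive_Kir g g' (x : R3) (tau : R) : grad g g' ->
  is_derive (Kir g x) tau (Kir' g g' x tau).
Proof.
  intros Hg. assert (H := Hg). destruct H as [Cg Hg'].
  assert (C1 : forall i, cont (g' i)) by (intros i; apply Hg').
  unfold Kir, Kir'. rewrite Sph_plus, Sph_scal; try ct.
  eapply is_derive_eq.
  - apply (is_derive_multR (fun y => y) (fun y => Sph (fun o => g (ray x y o))) tau 1
      (Sph (fun o => rdot o g' (ray x tau o)))).
    + auto_derive; auto.
    + apply (is_derive_Sph (fun y o => g (ray x y o)) (fun y o => rdot o g' (ray x y o))).
      * intros. now apply is_derive_ray.
      * intros y. ct.
      * ct.
  - now rewrite Rmult_1_l.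
Qed.

(** The wave equation for [Kir]. Differentiating under the mean produces twice the radial derivative
    plus [tau] times the radial Hessian, which the Darboux identity trades for [tau] times the
    Laplacian. *)
Lemma is_derive_Kir' g g' g'' (x : R3) (tau : R) : grad2 g g' g'' ->
  is_derive (Kir' g g' x) tau (Kir (lap g'') x tau).
Proof.
  intros H. assert (D := Darboux_identity g g' g'' x tau H).
  destruct H as [Hg Hg']. assert (H := Hg). destruct H as [Cg Cg'].
  assert (C1 : forall i, cont (g' i)) by (intros i; apply Cg').
  assert (C2 : forall i j, cont (g'' i j)) by (intros i j; apply Hg').
  apply (is_derive_eq _ _ (Sph (fun o => rdot o g' (ray x tau o) +
      (1 * rdot o g' (ray x tau o) + tau * hess o g'' (ray x tau o))))).
  - apply (is_derive_Sph (fun y o => g (ray x y o) + y * rdot o g' (ray x y o))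
      (fun y o => rdot o g' (ray x y o) +
      (1 * rdot o g' (ray x y o) + y * hess o g'' (ray x y o)))).
    + intros y th ph. apply is_derive_plusR; [now apply is_derive_ray |].
      apply is_derive_multR; [auto_derive; auto |].
      apply (is_derive_plusR (fun r => coord X1 (om th ph) * g' X1 (ray x r (om th ph)) +
        coord X2 (om th ph) * g' X2 (ray x r (om th ph)))
        (fun r => coord X3 (om th ph) * g' X3 (ray x r (om th ph)))).
      * apply is_derive_plusR; apply is_derive_scal; now apply is_derive_ray.
      * apply is_derive_scal; now apply is_derive_ray.
    + intros y. ct.
    + ct.
  - unfold Kir. rewrite <- Sph_scal by ct.
    rewrite <- (Rplus_0_l (Sph (fun o => tau * _))). rewrite <- D.
    rewrite <- Sph_plus by ct. apply Sph_ext. intros. ring.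
Qed.

Definition sgrad (w : spacetime -> R) (w' : axis -> spacetime -> R) : Prop :=
  cont w /\ forall i, cont (w' i) /\ Dir (dx (axis_vec i)) w (w' i).

Definition sgrad2 w w' w'' : Prop := sgrad w w' /\ forall i, sgrad (w' i) (w'' i).

Lemma Dir_dx (e : R3) (u v : spacetime -> R) :
  Dir (dx e) u v <-> forall t, Dir e (fun x => u (t, x)) (fun x => v (t, x)).
Proof.
  assert (E : forall (t : R) (x : R3) (h : R), (plus (t, x) (scal h (dx e)) : spacetime) = (t, ray x h e)).
  { intros t x h. change ((t + h * 0, ray x h e) = (t, ray x h e)).
    now rewrite Rmult_0_r, Rplus_0_r. }
  split.
  - intros H t x. generalize (H (t, x)). apply is_derive_ext. intros h. now rewrite E.
  - intros H [t x]. generalize (H t x). apply is_derive_ext. intros h. now rewrite E.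
Qed.

Lemma Dir_dt (u v : spacetime -> R) :
  Dir dt u v <-> forall t x, is_derive (fun s => u (s, x)) t (v (t, x)).
Proof.
  assert (E : forall (t : R) (x : R3) (h : R), (plus (t, x) (scal h dt) : spacetime) = (t + h, x)).
  { intros t x h. unfold dt. change ((t + h * 1, plus x (scal h zero)) = (t + h, x)).
    rewrite Rmult_1_r. f_equal. rewrite (scal_zero_r h). apply plus_zero_r. }
  split.
  - intros H t x. apply shift_derive. generalize (H (t, x)). apply is_derive_ext.
    intros h. now rewrite E.
  - intros H [t x]. apply (is_derive_ext (fun h => u (t + h, x))).
    { intros h. now rewrite E. }
    apply (shift_derive (fun s => u (s, x))). apply H.
Qed.

Lemma sgrad_slice w w' s : sgrad w w' -> grad (fun y => w (s, y)) (fun i y => w' i (s, y)).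
Proof.
  intros [Hw H]. split; [ct |]. intros i. destruct (H i) as [C D]. split; [ct |].
  now apply (Dir_dx (axis_vec i)).
Qed.

Lemma sgrad2_slice w w' w'' s : sgrad2 w w' w'' ->
  grad2 (fun y => w (s, y)) (fun i y => w' i (s, y)) (fun i j y => w'' i j (s, y)).
Proof. intros [H1 H2]. split; [now apply sgrad_slice |]. intros i. now apply sgrad_slice. Qed.

(** The candidate for the time derivative of [Duh w]: the kernel is the [tau]-derivative of
    [tau * w (s, x + tau o)]. *)
Definition DuhT (w : spacetime -> R) (w' : axis -> spacetime -> R) : spacetime -> R :=
  Ret (fun tau y o => w y + tau * rdot o w' y).

Lemma cont3_DuhT w w' : cont w -> (forall i, cont (w' i)) ->
  cont3 (fun tau y o => w y + tau * rdot o w' y).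
Proof. intros. unfold cont3. ct. Qed.

Lemma cont_DuhT w w' : cont w -> (forall i, cont (w' i)) -> cont (DuhT w w').
Proof. intros. now apply cont_Ret, cont3_DuhT. Qed.

Lemma Duh_0 w x : Duh w (0, x) = 0.
Proof. unfold Duh, Ret. simpl. apply RInt_pointR. Qed.

Lemma DuhT_0 w w' x : DuhT w w' (0, x) = 0.
Proof. unfold DuhT, Ret. simpl. apply RInt_pointR. Qed.

Lemma Duh_Kir w t x : cont w ->
  Duh w (t, x) = RInt (fun s => Kir (fun y => w (s, y)) x (t - s)) 0 t.
Proof.
  intros Hw. apply RInt_extR. intros s. unfold Kir. cbn [fst snd].
  rewrite <- Sph_scal; [reflexivity | ct].
Qed.

Lemma is_derive_tminus (f : R -> R) (t s l : R) : is_derive f (t - s) l ->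
  is_derive (fun r => f (r - s)) t l.
Proof.
  intros H. eapply is_derive_eq.
  - apply (is_derive_comp f (fun r => r - s)); [exact H | auto_derive; auto; reflexivity].
  - apply (scal_one l).
Qed.

Lemma Dir_dt_Duh w w' : sgrad w w' -> Dir dt (Duh w) (DuhT w w').
Proof.
  intros H. destruct (H) as [Hw0 Hw].
  assert (Cw' : forall i, cont (w' i)) by (intros i; apply Hw).
  apply Dir_dt. intros t x.
  apply (is_derive_ext (fun t => RInt (fun s => Kir (fun y => w (s, y)) x (t - s)) 0 t)).
  { intros r. symmetry. now apply Duh_Kir. }
  eapply is_derive_eq.
  - apply (is_derive_RInt_bound_cont (fun t s => Kir (fun y => w (s, y)) x (t - s))
      (fun t s => Kir' (fun y => w (s, y)) (fun i y => w' i (s, y)) x (t - s))).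
    + intros r s. apply is_derive_tminus. apply is_derive_Kir. now apply sgrad_slice.
    + intros r. unfold Kir. ct.
    + unfold Kir', rdot. ct.
  (* The boundary term at [s = t] is [Kir] at delay 0, which vanishes thanks to the factor [tau]. *)
  - unfold Kir at 1. replace (t - t) with 0 by ring. rewrite Rmult_0_l, Rplus_0_l.
    apply RInt_extR. intros s. reflexivity.
Qed.

Lemma Dir_dt_DuhT w w' w'' : sgrad2 w w' w'' ->
  Dir dt (DuhT w w') (fun q => w q + Duh (lap w'') q).
Proof.
  intros H. destruct (H) as [[Hw0 Hw] Hw2].
  assert (Cw' : forall i, cont (w' i)) by (intros i; apply Hw).
  assert (Cw'' : forall i j, cont (w'' i j)) by (intros i j; apply Hw2).
  apply Dir_dt. intros t x.
  rewrite Duh_Kir by ct.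
  apply (is_derive_ext (fun t => RInt (fun s => Kir' (fun y => w (s, y)) (fun i y => w' i (s, y)) x (t - s)) 0 t)).
  { intros r. apply RInt_extR. reflexivity. }
  eapply is_derive_eq.
  - apply (is_derive_RInt_bound_cont 
      (fun t s => Kir' (fun y => w (s, y)) (fun i y => w' i (s, y)) x (t - s))
      (fun t s => Kir (fun y => lap w'' (s, y)) x (t - s))).
    + intros r s. apply is_derive_tminus.
      apply (is_derive_Kir' _ _ (fun i j y => w'' i j (s, y))). now apply sgrad2_slice.
    + intros r. unfold Kir', rdot. ct.
    + unfold Kir. ct.
  (* This time the boundary term is a mean over a sphere of radius 0 and contributes [w (t, x)]: it
     is the source term of the wave equation. *)
  - f_equal. unfold Kir'. replace (t - t) with 0 by ring.
    rewrite <- (Sph_const (w (t, x))). apply Sph_ext. intros th ph.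
    rewrite Rmult_0_l, Rplus_0_r. now rewrite ray_0.
Qed.

(** Translation invariance: moving the centre [x] by [h e] moves every point of the backward cone by
    [h e], with delay and direction unchanged, so the derivative passes to [z]. *)
Lemma Dir_Ret e (z z' : R -> spacetime -> R3 -> R) : cont3 z -> cont3 z' ->
  (forall tau o, Dir (dx e) (fun y => z tau y o) (fun y => z' tau y o)) ->
  Dir (dx e) (Ret z) (Ret z').
Proof.
  intros Cz Cz' H. apply Dir_dx. intros t x. unfold Ret; cbn [fst snd].
  assert (E : forall h s (o : R3), ray (ray x h e) s o =
     ray (ray x s o) h e).
  { intros. apply R3_eq. intros i. rewrite !coord_mv. ring. }
  eapply is_derive_eq.
  - apply (is_derive_RInt_cont 
      (fun h s => Sph (fun o => z (t - s) (s, ray (ray x h e) (t - s) o) o))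
      (fun h s => Sph (fun o => z' (t - s) (s, ray (ray x h e) (t - s) o) o))).
    + intros h s. 
      apply (is_derive_Sph (fun h o => z (t - s) (s, ray (ray x h e) (t - s) o) o)
        (fun h o => z' (t - s) (s, ray (ray x h e) (t - s) o) o)).
      * intros k th ph. rewrite E.
        apply (is_derive_ext (fun y => z (t - s) (s, ray (ray x (t - s) (om th ph)) y e) (om th ph))).
        { intros y. now rewrite E. }
        apply (Dir_line e (fun y => z (t - s) (s, y) (om th ph)) (fun y => z' (t - s) (s, y) (om th ph))).
        apply (Dir_dx e (fun y => z (t - s) y (om th ph)) (fun y => z' (t - s) y (om th ph))). apply H.
      * intros k. now apply cont_Ret_slice.
      * apply (cont3_comp z' (fun _ : R * R3 => t - s)
         (fun p => (s, ray (ray x (fst p) e) (t - s) (snd p))) (fun p => snd p)); auto; ct.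
    + intros h. now apply cont_Ret_slice2.
    + apply (cont_comp _ (fun p : R * R => ((t, ray x (fst p) e) : spacetime, snd p)) (cont_Ret_integrand z' Cz')). ct.
  - apply RInt_extR. intros s. apply Sph_ext. intros. now rewrite ray_0.
Qed.

Lemma Dir_scal {V : NormedModule R_AbsRing} (e : V) c (u v : V -> R) : Dir e u v ->
  Dir e (fun q => c * u q) (fun q => c * v q).
Proof. intros H q. apply is_derive_scal. apply H. Qed.

Lemma Dir_plus {V : NormedModule R_AbsRing} (e : V) (u v u' v' : V -> R) : Dir e u v -> Dir e u' v' ->
  Dir e (fun q => u q + u' q) (fun q => v q + v' q).
Proof. intros H H' q. apply is_derive_plusR; [apply H | apply H']. Qed.

Lemma Dir_dx_Duh e w w' : cont w -> cont w' -> Dir (dx e) w w' ->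
  Dir (dx e) (Duh w) (Duh w').
Proof.
  intros. apply Dir_Ret; try now apply cont3_Duh.
  intros. now apply Dir_scal.
Qed.

Lemma Dir_dx_DuhT e w w' v v' : cont w -> cont v -> (forall i, cont (w' i)) ->
  (forall i, cont (v' i)) -> Dir (dx e) w v -> (forall i, Dir (dx e) (w' i) (v' i)) ->
  Dir (dx e) (DuhT w w') (DuhT v v').
Proof.
  intros. apply Dir_Ret; try now apply cont3_DuhT.
  intros. apply Dir_plus; auto. apply Dir_scal.
  unfold rdot, sum3. apply (Dir_plus _ (fun q => coord X1 o * w' X1 q + coord X2 o * w' X2 q)
    (fun q => coord X1 o * v' X1 q + coord X2 o * v' X2 q)); [apply Dir_plus |]; apply Dir_scal; auto.
Qed.

Lemma sgrad_Duh w w' : sgrad w w' -> sgrad (Duh w) (fun i => Duh (w' i)).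
Proof.
  intros [C H]. split; [ct |]. intros i. destruct (H i). split; [ct |].
  now apply Dir_dx_Duh.
Qed.

(** * Classical solutions from the integral equation *)

Lemma Dir_is_pderiv {V : NormedModule R_AbsRing} (D : V -> Prop) (e : V) (u v : V -> R) q :
  Dir e u v -> is_pderiv D e u q (v q).
Proof.
  intros H. generalize (proj1 (is_derive_quot _ _ _) (H q)).
  intros Hl P HP. generalize (Hl P HP). intros [d Hd]. exists d. intros h Hh Hne _.
  generalize (Hd h Hh Hne). cbv beta. rewrite Rplus_0_l.
  now rewrite plus_scal_0.
Qed.

Lemma pderiv_unique {V : NormedModule R_AbsRing} (D : V -> Prop) (e : V) (u : V -> R) q l :
  (forall d : posreal, exists h : R, h <> 0 /\ Rabs h < d /\ D (plus q (scal h e))) ->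
  is_pderiv D e u q l -> pderiv D e u q = l.
Proof.
  intros HD H. unfold pderiv, is_pderiv.
  apply (@iota_filterlim_locally R_AbsRing R_CompleteNormedModule R
    (within (fun h : R => D (plus q (scal h e))) (locally' 0))); auto.
  constructor.
  - intros [d Hd]. destruct (HD d) as (h & Hne & Hh & HDh).
    apply (Hd h); auto. change (Rabs (h - 0) < d). now rewrite Rminus_0_r.
  - apply within_filter, within_filter, locally_filter.
Qed.

(** For a direction with nonnegative time component, positive steps stay in the half space even from
    [t = 0]. This is the nontriviality of the filter that makes [pderiv] well determined. *)
Lemma half_space_approach (e q : spacetime) : 0 <= fst e -> half_space q ->
  forall d : posreal, exists h : R, h <> 0 /\ Rabs h < d /\ half_space (plus q (scal h e)).
Proof.
  intros He Hq d. pose proof (cond_pos d). exists (d / 2). repeat split; try lra.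
  - rewrite Rabs_pos_eq; lra.
  - destruct e as [e0 e'], q as [t x]. unfold half_space in *. simpl in *.
    change (0 <= t + d / 2 * e0). nra.
Qed.

Lemma pderiv_half_space e (u v : spacetime -> R) q : 0 <= fst e -> half_space q ->
  Dir e u v -> pderiv half_space e u q = v q.
Proof.
  intros. apply pderiv_unique; [now apply half_space_approach | now apply Dir_is_pderiv].
Qed.

Lemma is_pderiv_ext {V : NormedModule R_AbsRing} (D : V -> Prop) (e : V) (u u' : V -> R) q l :
  D q -> (forall y, D y -> u y = u' y) -> is_pderiv D e u q l -> is_pderiv D e u' q l.
Proof.
  intros Hq E. apply filterlim_within_ext. intros h Hh. now rewrite (E _ Hh), (E _ Hq).
Qed.

Lemma pderiv_ext {V : NormedModule R_AbsRing} (D : V -> Prop) (e : V) (u u' : V -> R) q :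
  D q -> (forall y, D y -> u y = u' y) -> pderiv D e u q = pderiv D e u' q.
Proof.
  (* Equivalent predicates have [iota] values that are close, and close reals are equal; existence
     of the derivative is not at issue here. *)
  intros Hq E. apply eq_close. apply (@close_iota R_CompleteNormedModule). intros l.
  split; apply is_pderiv_ext; auto. intros; symmetry; auto.
Qed.

Lemma C_k_ext {V : NormedModule R_AbsRing} (basis : list V) (D : V -> Prop) n :
  forall u u', (forall q, D q -> u q = u' q) -> C_k basis D n u -> C_k basis D n u'.
Proof.
  induction n as [| n IH]; intros u u' E [Hc H]; (split; [exact (continuous_on_ext D u u' E Hc) |]).
  - exact I.
  - intros e He. destruct (H e He) as [Hex HC]. split.
    + intros q Hq. destruct (Hex q Hq) as [l Hl]. exists l.
      now apply (is_pderiv_ext D e u).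
    + apply (IH (pderiv D e u)); auto. intros q Hq. now apply pderiv_ext.
Qed.

Lemma cont_continuous_on {U V : UniformSpace} (D : U -> Prop) (u : U -> V) :
  cont u -> continuous_on D u.
Proof. intros H. apply continuous_on_forall. intros; apply H. Qed.

(** Replaces [pderiv], which is controlled only on the half space, by an explicit derivative [v]
    defined everywhere. *)
Lemma C_k_half_space basis n (u : spacetime -> R) : cont u ->
  (forall e, In e basis -> 0 <= fst e /\ exists v, Dir e u v /\ C_k basis half_space n v) ->
  C_k basis half_space (S n) u.
Proof.
  intros Hu H. split; [now apply cont_continuous_on |].
  intros e He. destruct (H e He) as (H0 & v & Hv & HC). split.
  - intros q _. exists (v q). now apply Dir_is_pderiv.
  - apply (C_k_ext _ _ n v); auto. intros q Hq. symmetry. now apply pderiv_half_space.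
Qed.

Lemma partial_eq e (u u' v : spacetime -> R) q : 0 <= fst e -> half_space q ->
  (forall y, half_space y -> u y = u' y) -> Dir e u' v -> partial e u q = v q.
Proof.
  intros He Hq E Hv. unfold partial. rewrite (pderiv_ext _ _ u u'); auto.
  now apply pderiv_half_space.
Qed.

Lemma Dir_dt_Cauchy (f g : R3 -> R) : Dir dt (fun q : spacetime => f (snd q) + fst q * g (snd q))
  (fun q => g (snd q)).
Proof. apply Dir_dt. intros t x. simpl. auto_derive; auto. ring. Qed.

Lemma Dir_dt_const (f : R3 -> R) : Dir dt (fun q : spacetime => f (snd q)) (fun _ => 0).
Proof. apply Dir_dt. intros t x. simpl. auto_derive; auto. Qed.

Lemma Dir_dx_space e (f f' : R3 -> R) : Dir e f f' ->
  Dir (dx e) (fun q : spacetime => f (snd q)) (fun q => f' (snd q)).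
Proof. intros H. apply Dir_dx. intros t. exact H. Qed.

Lemma Dir_dx_Cauchy e (f g f' g' : R3 -> R) : Dir e f f' -> Dir e g g' ->
  Dir (dx e) (fun q : spacetime => f (snd q) + fst q * g (snd q))
    (fun q => f' (snd q) + fst q * g' (snd q)).
Proof.
  intros Hf Hg. apply Dir_dx. intros t. simpl. apply Dir_plus; auto. now apply Dir_scal.
Qed.

Lemma C_k_0 basis D (u : spacetime -> R) : cont u -> C_k basis D 0 u.
Proof. intros H. split; [now apply cont_continuous_on | exact I]. Qed.

Lemma in_basis e : In e (dt :: dx e1 :: dx e2 :: dx e3 :: nil) ->
  e = dt \/ exists i, e = dx (axis_vec i).
Proof.
  intros [<- | [<- | [<- | [<- | []]]]]; auto; right; [exists X1 | exists X2 | exists X3]; reflexivity.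
Qed.

Lemma fst_dx e : 0 <= fst (dx e).
Proof. simpl. lra. Qed.

Lemma fst_dt : 0 <= fst dt.
Proof. simpl. lra. Qed.

(** The second time derivative of [phi] is [W + Duh (lap W'')], and its Laplacian is
    [lap f'' + t lap g'' + Duh (lap W'')]. The retarded terms cancel in the difference, which leaves
    [|phi|^p] by the choice of [W]. The Cauchy data are those of [f + t g] because [Duh] and [DuhT]
    vanish at [t = 0]. *)
Lemma solution_of_integral_equation p (f g : R3 -> R) f' f'' g' g''
  (W : spacetime -> R) W' W'' (phi : spacetime -> R) :
  grad2 f f' f'' -> grad2 g g' g'' -> sgrad2 W W' W'' ->
  (forall q, phi q = f (snd q) + fst q * g (snd q) + Duh W q) ->
  (forall q, W q = abs_pow (phi q) p + (lap f'' (snd q) + fst q * lap g'' (snd q))) ->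
  global_solution p f g phi.
Proof.
  intros Hf Hg HW Hphi Heq.
  assert (Cf : cont f) by exact (proj1 (proj1 Hf)).
  assert (Cf' : forall i, cont (f' i)) by (intros i; apply Hf).
  assert (Cf'' : forall i j, cont (f'' i j)) by (intros i j; apply Hf).
  assert (Cg : cont g) by exact (proj1 (proj1 Hg)).
  assert (Cg' : forall i, cont (g' i)) by (intros i; apply Hg).
  assert (Cg'' : forall i j, cont (g'' i j)) by (intros i j; apply Hg).
  assert (CW : cont W) by exact (proj1 (proj1 HW)).
  assert (CW' : forall i, cont (W' i)) by (intros i; apply HW).
  assert (CW'' : forall i j, cont (W'' i j)) by (intros i j; apply HW).
  pose (u := fun q : spacetime => f (snd q) + fst q * g (snd q) + Duh W q).
  pose (ut := fun q : spacetime => g (snd q) + DuhT W W' q).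
  pose (utt := fun q : spacetime => 0 + (W q + Duh (lap W'') q)).
  pose (ui := fun i (q : spacetime) => f' i (snd q) + fst q * g' i (snd q) + Duh (W' i) q).
  (* [C_k] asks for mixed derivatives in both orders. Each has its own formula: [uit] differentiates
     [ui] in time, [uti] differentiates [ut] in space, and the indices of [W''] occur in opposite
     order. *)
  pose (uit := fun i (q : spacetime) => g' i (snd q) + DuhT (W' i) (W'' i) q).
  pose (uti := fun i (q : spacetime) => g' i (snd q) + DuhT (W' i) (fun j => W'' j i) q).
  pose (uij := fun i j (q : spacetime) => f'' i j (snd q) + fst q * g'' i j (snd q) + Duh (W'' i j) q).
  assert (Dt : Dir dt u ut).
  { apply Dir_plus; [apply Dir_dt_Cauchy | apply Dir_dt_Duh, HW]. }
  assert (Dtt : Dir dt ut utt).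
  { apply Dir_plus; [apply Dir_dt_const | now apply (Dir_dt_DuhT W W' W'')]. }
  assert (Di : forall i, Dir (dx (axis_vec i)) u (ui i)).
  { intros i. apply Dir_plus; [apply Dir_dx_Cauchy; [apply Hf | apply Hg] |].
    apply Dir_dx_Duh; auto. apply HW. }
  assert (Dit : forall i, Dir dt (ui i) (uit i)).
  { intros i. apply Dir_plus; [apply Dir_dt_Cauchy | apply Dir_dt_Duh, HW]. }
  assert (Dti : forall i, Dir (dx (axis_vec i)) ut (uti i)).
  { intros i. apply Dir_plus; [apply Dir_dx_space, Hg |].
    apply Dir_dx_DuhT; auto; [apply HW | intros j; apply HW]. }
  assert (Dij : forall i j, Dir (dx (axis_vec j)) (ui i) (uij i j)).
  { intros i j. apply Dir_plus; [apply Dir_dx_Cauchy; [apply Hf | apply Hg] |].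
    apply Dir_dx_Duh; auto. apply HW. }
  assert (Cu : cont u) by (unfold u; ct).
  assert (CDT : cont (DuhT W W')) by now apply cont_DuhT.
  assert (CDT' : forall i, cont (DuhT (W' i) (W'' i))) by (intros; now apply cont_DuhT).
  assert (CDT2 : forall i, cont (DuhT (W' i) (fun j => W'' j i))) by (intros; now apply cont_DuhT).
  assert (Cut : cont ut) by (unfold ut; ct).
  assert (CL : cont (lap W'')) by exact (cont_lap W'' (fun u => u) CW'' cont_id).
  assert (Cutt : cont utt) by (unfold utt; ct).
  assert (CDi : forall i, cont (Duh (W' i))) by (intros; now apply cont_Duh).
  assert (CDij : forall i j, cont (Duh (W'' i j))) by (intros; now apply cont_Duh).
  assert (Cui : forall i, cont (ui i)) by (intros i; unfold ui; ct).
  assert (Cuit : forall i, cont (uit i)).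
  { intros i; unfold uit. apply cont_plus; [ct | apply CDT']. }
  assert (Cuti : forall i, cont (uti i)).
  { intros i; unfold uti. apply cont_plus; [ct | apply CDT2]. }
  assert (Cuij : forall i j, cont (uij i j)) by (intros i j; unfold uij; ct).
  split; [| split; [| split]].
  - apply (C_k_ext _ _ _ u); [intros; symmetry; apply Hphi |].
    apply C_k_half_space; [exact Cu |].
    intros e He. destruct (in_basis e He) as [-> | [i ->]].
    + split; [apply fst_dt |]. exists ut. split; [exact Dt |]. apply C_k_half_space; [exact Cut |].
      intros e He'. destruct (in_basis e He') as [-> | [i ->]].
      * split; [apply fst_dt |]. exists utt. split; [exact Dtt |]. apply C_k_0, Cutt.
      * split; [apply fst_dx |]. exists (uti i). split; [exact (Dti i) |]. apply C_k_0, Cuti.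
    + split; [apply fst_dx |]. exists (ui i). split; [exact (Di i) |].
      apply C_k_half_space; [exact (Cui i) |].
      intros e He'. destruct (in_basis e He') as [-> | [j ->]].
      * split; [apply fst_dt |]. exists (uit i). split; [exact (Dit i) |]. apply C_k_0, Cuit.
      * split; [apply fst_dx |]. exists (uij i j). split; [exact (Dij i j) |]. apply C_k_0, Cuij.
  - intros t x Ht.
    assert (Et : forall y, half_space y -> partial dt phi y = ut y).
    { intros y Hy. exact (partial_eq dt phi u ut y fst_dt Hy (fun z _ => Hphi z) Dt). }
    assert (Ei : forall i y, half_space y -> partial (dx (axis_vec i)) phi y = ui i y).
    { intros i y Hy. exact (partial_eq (dx (axis_vec i)) phi u (ui i) y (fst_dx _) Hy (fun z _ => Hphi z) (Di i)). }
    assert (Eii : forall i, partial (dx (axis_vec i)) (partial (dx (axis_vec i)) phi) (t, x) = uij i i (t, x)).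
    { intros i. exact (partial_eq _ _ (ui i) (uij i i) (t, x) (fst_dx _) Ht (Ei i) (Dij i i)). }
    rewrite (partial_eq dt (partial dt phi) ut utt (t, x) fst_dt Ht Et Dtt).
    change (laplacian phi (t, x)) with (sum3 (fun i => partial (dx (axis_vec i)) (partial (dx (axis_vec i)) phi) (t, x))).
    unfold sum3. rewrite (Eii X1), (Eii X2), (Eii X3).
    unfold utt, uij. simpl fst; simpl snd. rewrite Heq. simpl fst; simpl snd.
    assert (EL : Duh (lap W'') (t, x) = Duh (W'' X1 X1) (t, x) + Duh (W'' X2 X2) (t, x) + Duh (W'' X3 X3) (t, x)).
    { unfold lap, sum3. rewrite (Duh_plus (fun q => W'' X1 X1 q + W'' X2 X2 q)), Duh_plus; auto; ct. }
    rewrite EL. unfold lap, sum3. ring.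
  - intros x. rewrite Hphi, Duh_0. simpl. ring.
  - intros x. rewrite (partial_eq dt phi u ut (0, x) fst_dt (Rle_refl 0) (fun z _ => Hphi z) Dt).
    unfold ut. rewrite DuhT_0. simpl. ring.
Qed.

(** * Smooth functions that vanish outside the unit ball *)

Definition dd (i : axis) (f : R3 -> R) : R3 -> R := pderiv (fun _ => True) (axis_vec i) f.

Lemma C_k_cont basis n (u : R3 -> R) : C_k basis (fun _ => True) n u -> cont u.
Proof.
  intros H x. apply (continuous_continuous_on (fun _ => True)).
  - apply filter_true.
  - destruct n; apply H.
Qed.

Lemma C_k_dd n i (f : R3 -> R) : C_k (e1 :: e2 :: e3 :: nil) (fun _ => True) (S n) f ->
  Dir (axis_vec i) f (dd i f) /\ C_k (e1 :: e2 :: e3 :: nil) (fun _ => True) n (dd i f).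
Proof.
  intros [_ H].
  assert (Hi : In (axis_vec i) (e1 :: e2 :: e3 :: nil)) by (destruct i; simpl; auto).
  destruct (H _ Hi) as [Hex HC]. split; auto.
  intros q. destruct (Hex q I) as [l Hl].
  unfold dd. rewrite (pderiv_unique _ _ _ _ l); auto.
  - apply is_derive_quot. intros P HP. destruct (Hl P HP) as [d Hd].
    exists d. intros h Hh Hne. generalize (Hd h Hh Hne I).
    cbv beta. rewrite Rplus_0_l. now rewrite plus_scal_0.
  - intros d. pose proof (cond_pos d). exists (d / 2). repeat split; try lra.
    rewrite Rabs_pos_eq; lra.
Qed.

(** The support condition is phrased as vanishing on an open set, where it passes to all
    derivatives; hence the class is stable under [dd]. *)
Definition bump (f : R3 -> R) : Prop := smooth f /\ forall x : R3, 1 < norm x -> f x = 0.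

Lemma bump_cont f : bump f -> cont f.
Proof. intros [H _]. exact (C_k_cont _ 0 f (H 0%nat)). Qed.

Lemma Dir_locally_0 {V : NormedModule R_AbsRing} (e : V) (u v : V -> R) q :
  Dir e u v -> locally q (fun y => u y = 0) -> v q = 0.
Proof.
  intros H Hq.
  assert (Hc : locally 0 (fun h : R => u (plus q (scal h e)) = 0)).
  { assert (C : cont (fun h : R => plus q (scal h e))) by ct.
    apply (C 0 (fun y => u y = 0)). rewrite plus_scal_0. exact Hq. }
  assert (A : is_derive (fun _ : R => 0) 0 (v q)).
  { apply (is_derive_ext_loc (fun h => u (plus q (scal h e)))); [exact Hc | apply H]. }
  rewrite <- (is_derive_unique _ _ _ A). apply Derive_const.
Qed.

Lemma bump_dd f i : bump f -> Dir (axis_vec i) f (dd i f) /\ bump (dd i f).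
Proof.
  intros [Hs Hz]. assert (D := proj1 (C_k_dd 0 i f (Hs 1%nat))). split; auto. split.
  - intros n. apply C_k_dd, Hs.
  - intros x Hx. apply (Dir_locally_0 _ _ _ _ D).
    assert (C : cont (fun y : R3 => norm y)) by ct.
    assert (Hl : locally x (fun y : R3 => 1 < norm y)) by exact (C x (fun r => 1 < r) (open_gt 1 _ Hx)).
    revert Hl. apply filter_imp. auto.
Qed.

Lemma bump_of_support f : smooth f -> (forall x : R3, supp f x -> norm x <= 1) -> bump f.
Proof.
  intros Hs H. split; auto. intros x Hx. destruct (Req_dec (f x) 0) as [E | E]; auto.
  exfalso. apply (Rlt_not_le _ _ Hx), H. intros P HP. exists x. split; auto.
  now apply (locally_singleton x P).
Qed.

Lemma bump_grad f : bump f -> grad f (fun i => dd i f).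
Proof.
  intros H. split; [now apply bump_cont |]. intros i. destruct (bump_dd f i H).
  split; auto. now apply bump_cont.
Qed.

Lemma bump_grad2 f : bump f -> grad2 f (fun i => dd i f) (fun i j => dd j (dd i f)).
Proof. intros H. split; [now apply bump_grad |]. intros i. now apply bump_grad, bump_dd. Qed.

(** * Spherical means of radial functions *)

Definition norm3 (x : R3) : R := norm x.

Lemma norm3_ge_0 x : 0 <= norm3 x.
Proof. exact (norm_ge_0 x). Qed.

Lemma cont_norm3 {U : UniformSpace} (f : U -> R3) : cont f -> cont (fun u => norm3 (f u)).
Proof. exact (cont_norm f). Qed.

Definition dot (x o : R3) : R := sum3 (fun i => coord i x * coord i o).

Lemma cont_dot {U : UniformSpace} (x o : U -> R3) :
  cont x -> cont o -> cont (fun u => dot (x u) (o u)).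
Proof.
  intros. apply (cont_sum3 (fun u i => coord i (x u) * coord i (o u))). intros i.
  apply cont_mult; now apply cont_coord.
Qed.

Ltac ct_dot :=
  match goal with
  | |- cont (fun u => norm3 (@?x u)) => apply (cont_norm3 x)
  | |- cont (fun u => dot (@?x u) (@?o u)) => apply (cont_dot x o)
  end.
Ltac ct_more ::= first [ct_dot | ct_sphere | ct_frame | ct_vector].

Lemma is_derive_compR (f g : R -> R) (x a b : R) : is_derive f (g x) a -> is_derive g x b ->
  is_derive (fun y => f (g y)) x (b * a).
Proof. intros. now apply (is_derive_comp f g). Qed.

Lemma dot_derive (x : R3) (v1 v2 v3 : R -> R) (s a b c : R) :
  is_derive v1 s a -> is_derive v2 s b -> is_derive v3 s c ->
  is_derive (fun y => dot x (v1 y, v2 y, v3 y)) s (dot x (a, b, c)).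
Proof.
  intros H1 H2 H3. unfold dot, sum3; simpl.
  apply is_derive_plusR; [apply is_derive_plusR |]; now apply is_derive_scal.
Qed.

Lemma dot_sym x o : dot x o = dot o x.
Proof. unfold dot, sum3. ring. Qed.

(** The mean is the derivative in [al] of the mean of [G (om al psi . o)], and the integrand is a
    divergence: up to sign, that of [G] times the divergence-free field which rotates the plane
    spanned by the polar axis and the azimuth [psi]. With [C] and [S] the cosine and sine of
    [ph - psi], this field has polar component [C] and azimuthal component [- cot th * S]; the area
    factor [sin th] gives [A] and [B] and removes the singularity at the poles. *)
Lemma Sph_rotation (G G' : R -> R) (al psi : R) :
  (forall c, is_derive G c (G' c)) -> cont G' ->
  Sph (fun o => G' (dot (om al psi) o) * dot (omt al psi) o) = 0.
Proof.
  intros HG CG'. assert (CG : cont G) by (apply (cont_of_derive _ _ HG)).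
  unfold Sph.
  pose (c := fun th ph => dot (om al psi) (om th ph)).
  pose (C := fun ph => cos ph * cos psi + sin ph * sin psi).
  pose (S := fun ph => sin ph * cos psi - cos ph * sin psi).
  pose (A := fun th ph => sin th * C ph * G (c th ph)).
  pose (A' := fun th ph => cos th * C ph * G (c th ph) +
     sin th * C ph * (dot (om al psi) (omt th ph) * G' (c th ph))).
  pose (B := fun th ph => - (cos th * S ph * G (c th ph))).
  pose (B' := fun th ph => - (cos th * C ph * G (c th ph) +
     cos th * S ph * (sin th * dot (om al psi) (omp ph) * G' (c th ph)))).
  assert (E : S2 (fun th ph => A' th ph + B' th ph) = 0).
  { apply (S2_div A A' B B').
    - unfold cont2, A, C, c. ct.
    - unfold cont2, A', C, c. ct.
    - unfold cont2, B', C, S, c. ct.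
    - intros th ph. unfold A, A'.
      apply (is_derive_multR (fun y => sin y * C ph) (fun y => G (c y ph))).
      + unfold C. auto_derive; auto; ring.
      + apply (is_derive_compR G (fun y => c y ph)); [apply HG |].
        apply dot_derive; auto_derive; auto; ring.
    - intros th ph. unfold B, B'. apply (is_derive_opp (fun y => cos th * S y * G (c th y))).
      apply (is_derive_multR (fun y => cos th * S y) (fun y => G (c th y))).
      + unfold S, C. auto_derive; auto; ring.
      + apply (is_derive_compR G (fun y => c th y)); [apply HG |].
        eapply is_derive_eq.
        * apply (dot_derive (om al psi) (fun y => sin th * cos y) (fun y => sin th * sin y) (fun y => cos th)
            ph (sin th * - sin ph) (sin th * cos ph) 0); auto_derive; auto; ring.
        * unfold dot, sum3, omp; simpl. ring.
    - intros ph. unfold A. rewrite sin_0. ring.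
    - intros ph. unfold A. rewrite sin_PI. ring.
    - intros th. unfold B, S, c, om. now rewrite cos_2PI, sin_2PI, cos_0, sin_0. }
  rewrite (S2_ext _ (fun th ph => -1 * (A' th ph + B' th ph))).
  - rewrite S2_scal, E; [ring |]. unfold cont2, A', B', C, S, c. ct.
  - intros th ph. unfold A', B'. fold (c th ph). generalize (G (c th ph)) (G' (c th ph)). intros u v.
    assert (T1 : sin th * sin th = 1 - cos th * cos th) by (pose proof (sin2_cos2 th); unfold Rsqr in *; lra).
    assert (T2 : sin ph * sin ph = 1 - cos ph * cos ph) by (pose proof (sin2_cos2 ph); unfold Rsqr in *; lra).
    assert (T3 : sin psi * sin psi = 1 - cos psi * cos psi) by (pose proof (sin2_cos2 psi); unfold Rsqr in *; lra).
    unfold C, S, dot, sum3, om, omt, omp; simpl.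
    ring [T1 T2 T3].
Qed.

Lemma is_derive_prim (G : R -> R) (a x : R) : cont G ->
  is_derive (fun y => RInt G a y) x (G x).
Proof.
  intros H. eapply is_derive_eq.
  - apply (is_derive_RInt_bound_cont (fun _ => G) (fun _ _ => 0)); auto.
    + intros y s. apply (is_derive_const (G s)).
    + ct.
  - rewrite RInt_constR. ring.
Qed.

(** By [Sph_rotation] the axis may be turned to the pole [al = 0]. There the inner product is
    [cos th], and [c = cos th] is uniformly distributed on [[-1, 1]] (Archimedes). *)
Lemma Sph_C1 (G G' : R -> R) al psi :
  (forall c, is_derive G c (G' c)) -> cont G' ->
  Sph (fun o => G (dot (om al psi) o)) = / 2 * RInt G (-1) 1.
Proof.
  intros HG CG'. assert (CG : cont G) by (apply (cont_of_derive _ _ HG)).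
  assert (E : Sph (fun o => G (dot (om al psi) o)) = Sph (fun o => G (dot (om 0 psi) o))).
  { apply Rminus_diag_uniq.
    rewrite <- (RInt_FTC (fun a => Sph (fun o => G (dot (om a psi) o))) (fun _ => 0)).
    - rewrite RInt_constR. ring.
    - intros a. rewrite <- (Sph_rotation G G' a psi HG CG').
      apply (is_derive_Sph (fun a o => G (dot (om a psi) o)) (fun a o => G' (dot (om a psi) o) * dot (omt a psi) o)).
      + intros y th ph. rewrite Rmult_comm. apply (is_derive_compR G (fun y => dot (om y psi) (om th ph))); [apply HG |].
        rewrite dot_sym. apply (is_derive_ext (fun y => dot (om th ph) (om y psi))).
        { intros; apply dot_sym. }
        apply dot_derive; auto_derive; auto; ring.
      + intros y. ct.
      + ct.
    - ct. }
  rewrite E. unfold Sph, S2. pose proof PI_RGT_0.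
  rewrite (RInt_extR _ (fun th => 2 * PI * (sin th * G (cos th)))).
  - rewrite RIntZ by ct.
    rewrite (RInt_FTC (fun th => -1 * RInt G (-1) (cos th)) (fun th => sin th * G (cos th))).
    + rewrite cos_0, cos_PI, RInt_pointR. field. lra.
    + intros th. eapply is_derive_eq.
      * apply is_derive_scal.
        apply (is_derive_compR (fun y => RInt G (-1) y) cos); [now apply is_derive_prim |].
        auto_derive; auto.
      * ring.
    + ct.
  - intros th. rewrite (RInt_extR _ (fun _ => sin th * G (cos th))).
    + rewrite RInt_constR. ring.
    + intros ph. do 2 f_equal. unfold dot, sum3, om; simpl. rewrite sin_0, cos_0. ring.
Qed.

(* Obtained from the [C^1] case by differentiating in a translation parameter. *)
Lemma Sph_zonal (G : R -> R) al psi : cont G ->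
  Sph (fun o => G (dot (om al psi) o)) = / 2 * RInt G (-1) 1.
Proof.
  intros CG.
  pose (H := fun c => RInt G 0 c).
  assert (DH : forall c, is_derive H c (G c)) by (intros; now apply is_derive_prim).
  assert (CH : cont H) by (apply (cont_of_derive _ _ DH)).
  assert (DHb : forall b c, is_derive (fun c => H (c + b)) c (G (c + b))).
  { intros b c. eapply is_derive_eq.
    - apply (is_derive_compR H (fun c => c + b)); [apply DH | auto_derive; auto; reflexivity].
    - ring. }
  assert (E : forall b, Sph (fun o => H (dot (om al psi) o + b)) = / 2 * RInt (fun c => H (c + b)) (-1) 1).
  { intros b. apply (Sph_C1 (fun c => H (c + b)) (fun c => G (c + b))); auto. ct. }
  assert (D1 : is_derive (fun b => Sph (fun o => H (dot (om al psi) o + b))) 0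
     (Sph (fun o => G (dot (om al psi) o + 0)))).
  { apply (is_derive_Sph (fun b o => H (dot (om al psi) o + b)) (fun b o => G (dot (om al psi) o + b))).
    - intros x th ph. eapply is_derive_eq.
      + apply (is_derive_compR H (fun b => dot (om al psi) (om th ph) + b)); [apply DH | auto_derive; auto; reflexivity].
      + ring.
    - intros x. ct.
    - ct. }
  assert (D2 : is_derive (fun b => / 2 * RInt (fun c => H (c + b)) (-1) 1) 0
     (/ 2 * RInt (fun c => G (c + 0)) (-1) 1)).
  { apply is_derive_scal.
    apply (is_derive_RInt_cont (fun b c => H (c + b)) (fun b c => G (c + b))).
    - intros x s. eapply is_derive_eq.
      + apply (is_derive_compR H (fun b => s + b)); [apply DH | auto_derive; auto; reflexivity].
      + ring.
    - intros x. ct.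
    - ct. }
  apply (is_derive_ext _ _ _ _ E) in D1.
  apply is_derive_unique in D1. apply is_derive_unique in D2.
  assert (D3 := eq_trans (eq_sym D1) D2).
  transitivity (Sph (fun o => G (dot (om al psi) o + 0))).
  - apply Sph_ext. intros. now rewrite Rplus_0_r.
  - rewrite D3. f_equal. apply RInt_extR. intros. now rewrite Rplus_0_r.
Qed.

Lemma polar (a b : R) : exists r psi, 0 <= r /\ a = r * cos psi /\ b = r * sin psi.
Proof.
  destruct (Req_dec (a * a + b * b) 0) as [E | E].
  - exists 0, 0. assert (a = 0) by nra. assert (b = 0) by nra. subst. repeat split; lra.
  - pose (r := sqrt (a * a + b * b)).
    assert (Hr : 0 < r) by (apply sqrt_lt_R0; nra).
    assert (Hr2 : r * r = a * a + b * b) by (apply sqrt_sqrt; nra).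
    assert (Ha : -1 <= a / r <= 1).
    { split; [apply Rle_div_r | apply Rle_div_l]; auto; nra. }
    assert (Hs : sqrt (1 - (a / r)²) = Rabs b / r).
    { apply sqrt_lem_1.
      - unfold Rsqr. nra.
      - apply Rdiv_le_0_compat; auto. apply Rabs_pos.
      - replace (Rabs b / r * (Rabs b / r)) with (Rabs b * Rabs b / (r * r)) by (field; lra).
        rewrite <- Rabs_mult, Rabs_pos_eq by nra.
        unfold Rsqr. replace (a / r * (a / r)) with (a * a / (r * r)) by (field; lra).
        rewrite Hr2. field. exact E. }
    exists r. destruct (Rle_dec 0 b) as [Hb | Hb].
    + exists (acos (a / r)). rewrite cos_acos, sin_acos by auto.
      rewrite Hs, Rabs_pos_eq by auto. repeat split; try lra; field; lra.
    + exists (- acos (a / r)). rewrite cos_neg, sin_neg, cos_acos, sin_acos by auto.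
      rewrite Hs, Rabs_left by lra. repeat split; try lra; field; lra.
Qed.

Lemma norm3_sq (x : R3) : norm3 x * norm3 x = dot x x.
Proof.
  destruct x as [[a b] c]. unfold norm3. rewrite norm_R3. unfold dot, sum3; simpl.
  rewrite sqrt_sqrt; nra.
Qed.

Lemma norm3_eq (x : R3) r : 0 <= r -> dot x x = r * r -> norm3 x = r.
Proof.
  intros Hr H. rewrite <- norm3_sq in H. pose proof (norm3_ge_0 x).
  apply Rsqr_inj; auto.
Qed.

Lemma coord_zero i : coord i (zero : R3) = 0.
Proof. destruct i; reflexivity. Qed.

Lemma dot_om th ph : dot (om th ph) (om th ph) = 1.
Proof.
  unfold dot, sum3, om; simpl.
  assert (T1 : sin th * sin th = 1 - cos th * cos th) by (pose proof (sin2_cos2 th); unfold Rsqr in *; lra).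
  assert (T2 : sin ph * sin ph = 1 - cos ph * cos ph) by (pose proof (sin2_cos2 ph); unfold Rsqr in *; lra).
  ring [T1 T2].
Qed.

Lemma spherical_coordinates (x : R3) : exists al psi,
  forall o, dot x o = norm3 x * dot (om al psi) o.
Proof.
  destruct x as [[a b] c].
  destruct (polar a b) as (rho & psi & Hrho & -> & ->).
  destruct (polar c rho) as (r & al & Hr & -> & ->).
  exists al, psi. intros o.
  replace (norm3 (r * sin al * cos psi, r * sin al * sin psi, r * cos al)) with r.
  - unfold dot, sum3, om; simpl. ring.
  - symmetry. apply norm3_eq; auto.
    assert (T1 : sin al * sin al = 1 - cos al * cos al) by (pose proof (sin2_cos2 al); unfold Rsqr in *; lra).
    assert (T2 : sin psi * sin psi = 1 - cos psi * cos psi) by (pose proof (sin2_cos2 psi); unfold Rsqr in *; lra).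
    unfold dot, sum3; simpl. ring [T1 T2].
Qed.

Lemma norm3_ray_om (x : R3) tau th ph :
  norm3 (ray x tau (om th ph)) = sqrt (norm3 x * norm3 x + tau * tau + 2 * tau * dot x (om th ph)).
Proof.
  assert (E : dot (ray x tau (om th ph)) (ray x tau (om th ph)) =
     norm3 x * norm3 x + tau * tau + 2 * tau * dot x (om th ph)).
  { rewrite norm3_sq.
    replace (tau * tau) with (tau * tau * dot (om th ph) (om th ph)) by (rewrite dot_om; ring).
    unfold dot, sum3. rewrite !coord_mv. ring. }
  rewrite <- E, <- norm3_sq. symmetry. apply sqrt_square. apply norm3_ge_0.
Qed.

(** Substitute [l = |x + tau o|] in the zonal integral: with [r = |x|] and [c] the cosine between
    [x] and [o], [l^2 = r^2 + tau^2 + 2 tau r c], hence [l dl = r tau dc], and [c] from -1 to 1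
    means [l] from [|r - tau|] to [r + tau]. The argument [Rabs l] makes the identity between the
    integrands hold for every real [l]. *)
Lemma Sph_radial (h : R -> R) (x : R3) tau : cont h -> 0 < norm3 x -> 0 <= tau ->
  tau * Sph (fun o => h (norm3 (ray x tau o))) =
  / (2 * norm3 x) * RInt (fun l => l * h (Rabs l)) (Rabs (norm3 x - tau)) (norm3 x + tau).
Proof.
  intros Ch Hx Ht.
  destruct (spherical_coordinates x) as (al & psi & Hdp).
  remember (norm3 x) as r eqn:Er.
  destruct (Req_dec tau 0) as [-> | Hne].
  { rewrite Rmult_0_l, Rminus_0_r, Rplus_0_r, Rabs_pos_eq, RInt_pointR by lra. ring. }
  pose (G := fun c => h (sqrt (r * r + tau * tau + 2 * tau * (r * c)))).
  assert (CG : cont G) by (unfold G; ct).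
  rewrite (Sph_ext _ (fun o => G (dot (om al psi) o))).
  2:{ intros th ph. unfold G. now rewrite norm3_ray_om, <- Er, Hdp. }
  rewrite Sph_zonal by exact CG.
  assert (E : RInt (fun l => / (r * tau) * (l * h (Rabs l))) (Rabs (r - tau)) (r + tau) = RInt G (-1) 1).
  (* [y l] is the cosine [c] as a function of the distance [l]. *)
  { pose (y := fun l => (l * l - r * r - tau * tau) / (2 * r * tau)).
    rewrite (RInt_FTC (fun l => RInt G (-1) (y l))).
    - replace (y (r + tau)) with 1 by (unfold y; field; lra).
      replace (y (Rabs (r - tau))) with (-1).
      + rewrite RInt_pointR. rring.
      + unfold y. rewrite <- Rabs_mult, Rabs_pos_eq by (apply Rle_0_sqr). field; lra.
    - intros l. eapply is_derive_eq.
      + apply (is_derive_compR (fun c => RInt G (-1) c) y (l) (G (y l)) (/ (r * tau) * l)).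
        * now apply is_derive_prim.
        * unfold y. auto_derive; auto. field; lra.
      + unfold G. replace (r * r + tau * tau + 2 * tau * (r * y l)) with (l ^ 2) by (unfold y; field; lra).
        rewrite <- (pow2_abs l), sqrt_pow2 by apply Rabs_pos. ring.
    - ct. }
  rewrite <- E, RIntZ by ct. field; lra.
Qed.

(** * John's weighted estimate *)

Lemma Rpower_pos x c : 0 < Rpower x c.
Proof. apply exp_pos. Qed.

Lemma cont_Rpower {U : UniformSpace} (f : U -> R) c : cont f -> (forall u, 0 < f u) ->
  cont (fun u => Rpower (f u) c).
Proof.
  intros Hf Hp u. unfold Rpower.
  apply (continuous_comp f (fun y => exp (c * ln y))); auto.
  apply (@ex_derive_continuous R_AbsRing). auto_derive. apply Hp.
Qed.

Lemma Rpower_anti x y c : 0 < x <= y -> c <= 0 -> Rpower y c <= Rpower x c.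
Proof.
  intros H Hc. replace c with (- - c) by ring. rewrite !(Rpower_Ropp _ (- c)).
  apply Rinv_le_contravar; [apply Rpower_pos |]. apply Rle_Rpower_l; lra.
Qed.

Lemma Rpower_le1 x c : 1 <= x -> c <= 0 -> Rpower x c <= 1.
Proof.
  intros Hx Hc. replace 1 with (Rpower 1 c).
  - apply Rpower_anti; lra.
  - unfold Rpower. rewrite ln_1, Rmult_0_r. apply exp_0.
Qed.

Lemma is_derive_Rpower x c : 0 < x -> is_derive (fun y => Rpower y c) x (c * Rpower x (c - 1)).
Proof.
  intros H. apply is_derive_Reals. now apply derivable_pt_lim_power.
Qed.

Lemma RInt_FTC_on (f f' : R -> R) a b : a <= b ->
  (forall x, a <= x <= b -> is_derive f x (f' x)) ->
  (forall x, a <= x <= b -> continuous f' x) -> RInt f' a b = f b - f a.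
Proof.
  intros Hab H Hc. apply is_RInt_unique. apply (is_RInt_derive f f');
  intros x; rewrite Rmin_left, Rmax_right by auto; auto.
Qed.

Lemma RInt_Rpower a b c : 0 <= a <= b -> c <> 0 ->
  RInt (fun y => Rpower (1 + Rabs y) (c - 1)) a b = (Rpower (1 + b) c - Rpower (1 + a) c) / c.
Proof.
  intros H Hc.
  rewrite (RInt_ext _ (fun y => Rpower (1 + y) (c - 1))).
  - rewrite (RInt_FTC_on (fun y => / c * Rpower (1 + y) c)); try lra.
    + intros x Hx. eapply is_derive_eq.
      * apply is_derive_scal. apply (is_derive_compR (fun y => Rpower y c) (fun y => 1 + y)).
        -- apply is_derive_Rpower. lra.
        -- auto_derive; auto; reflexivity.
      * field; auto.
    + intros x Hx. unfold Rpower. apply (@ex_derive_continuous R_AbsRing). auto_derive. lra.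
  - intros x. rewrite Rmin_left, Rmax_right by lra. intros Hx. rewrite Rabs_pos_eq; auto; lra.
Qed.

Lemma RInt_lower_le (f : R -> R) a b c : a <= b <= c -> cont f -> (forall x, 0 <= f x) ->
  RInt f b c <= RInt f a c.
Proof.
  intros H Hf Hp.
  assert (E : RInt f a b + RInt f b c = RInt f a c).
  { apply (RInt_Chasles f); now apply ex_RInt_cont. }
  assert (0 <= RInt f a b).
  { apply RInt_ge_0; try lra. now apply ex_RInt_cont. intros; auto. }
  lra.
Qed.

Lemma RInt_shift (f : R -> R) a b s : cont f ->
  RInt (fun y => f (s + y)) a b = RInt f (s + a) (s + b).
Proof.
  intros Hf. transitivity (RInt f (1 * a + s) (1 * b + s)).
  - rewrite <- (RInt_comp_lin f 1 s a b) by now apply ex_RInt_cont.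
    apply RInt_extR. intros y. change (f (s + y) = 1 * f (1 * y + s)).
    rewrite Rmult_1_l. f_equal; ring.
  - f_equal; ring.
Qed.

Definition decay_weight (p t r : R) : R := / (1 + t + r) * Rpower (1 + Rabs (t - r)) (2 - p).

Definition Phi (p : R) (q : spacetime) : R := decay_weight p (Rabs (fst q)) (norm3 (snd q)).

Lemma decay_weight_pos p t r : 0 <= t -> 0 <= r -> 0 < decay_weight p t r.
Proof.
  intros. unfold decay_weight. apply Rmult_lt_0_compat; [apply Rinv_0_lt_compat; lra | apply Rpower_pos].
Qed.

Lemma Phi_pos p q : 0 < Phi p q.
Proof. apply decay_weight_pos; [apply Rabs_pos | apply norm3_ge_0]. Qed.

Lemma Phi_le1 p q : 2 < p -> Phi p q <= 1.
Proof.
  intros Hp. unfold Phi, decay_weight. pose proof (Rabs_pos (fst q)). pose proof (norm3_ge_0 (snd q)).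
  pose proof (Rabs_pos (Rabs (fst q) - norm3 (snd q))).
  rewrite <- (Rmult_1_r 1). apply Rmult_le_compat.
  - left; apply Rinv_0_lt_compat; lra.
  - left; apply Rpower_pos.
  - rewrite <- Rinv_1. apply Rinv_le_contravar; lra.
  - apply Rpower_le1; lra.
Qed.

Lemma cont_inv {U : UniformSpace} (f : U -> R) : cont f -> (forall u, 0 < f u) ->
  cont (fun u => / f u).
Proof.
  intros Hf Hp u. apply (continuous_comp f Rinv); auto.
  apply (@ex_derive_continuous R_AbsRing). auto_derive. specialize (Hp u); lra.
Qed.

Lemma cont_Phi p : cont (Phi p).
Proof.
  unfold Phi, decay_weight. apply cont_mult.
  - apply (cont_inv (fun q : spacetime => 1 + Rabs (fst q) + norm3 (snd q))); [ct |].
    intros u. apply Rplus_lt_le_0_compat; [apply Rplus_lt_le_0_compat; [lra | apply Rabs_pos] | apply norm3_ge_0].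
  - apply (cont_Rpower (fun q : spacetime => 1 + Rabs (Rabs (fst q) - norm3 (snd q)))); [ct |].
    intros u. apply Rplus_lt_le_0_compat; [lra | apply Rabs_pos].
Qed.

(** The two summands pay for the two cases of [radial_integral_bound]. *)
Definition radial_const (p : R) : R := 2 / (p - 2) + 2.

Lemma radial_const_pos p : 2 < p -> 0 < radial_const p.
Proof. intros H. unfold radial_const. assert (0 < 2 / (p - 2)) by (apply Rdiv_lt_0_compat; lra). lra. Qed.

(** Put [a = |t - r|]. If [1 + t + r] is at least [2 (1 + a)], then [2 r >= (1 + t + r) / 2], and
    the integral is at most its tail [(1 + a)^(2 - p) / (p - 2)]. Otherwise [1 + a] and [1 + t + r]
    are comparable, and the length of the interval, at most [2 r], times the value [(1 + a)^(1 - p)]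
    at the left end is enough. *)
Lemma radial_integral_bound p t r : 2 < p -> 0 <= t -> 0 < r ->
  / (2 * r) * RInt (fun y => Rpower (1 + Rabs y) (1 - p)) (Rabs (t - r)) (t + r) <= radial_const p * decay_weight p t r.
Proof.
  intros Hp Ht Hr.
  assert (Ha : 0 <= Rabs (t - r)) by apply Rabs_pos.
  assert (Hab : Rabs (t - r) <= t + r) by (apply Rabs_le; lra).
  assert (Hw : t + r - Rabs (t - r) <= 2 * r) by (unfold Rabs; destruct Rcase_abs; lra).
  assert (Hi : 0 < / (2 * r)) by (apply Rinv_0_lt_compat; lra).
  unfold radial_const, decay_weight. set (a := Rabs (t - r)) in *.
  assert (Hpa := Rpower_pos (1 + a) (2 - p)). set (P := Rpower (1 + a) (2 - p)) in *.
  assert (Hp2 : 0 < / (p - 2)) by (apply Rinv_0_lt_compat; lra).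
  assert (Hb : 0 < / (1 + t + r)) by (apply Rinv_0_lt_compat; lra).
  destruct (Rle_dec (2 * (1 + a)) (1 + (t + r))) as [Hc | Hc].
  - replace (1 - p) with ((2 - p) - 1) by ring.
    rewrite RInt_Rpower by lra. fold P.
    assert (Hq := Rpower_pos (1 + (t + r)) (2 - p)).
    set (Q := Rpower (1 + (t + r)) (2 - p)) in *.
    apply Rle_trans with (/ (2 * r) * (P * / (p - 2))).
    + apply Rmult_le_compat_l; [lra |].
      replace ((Q - P) / (2 - p)) with ((P - Q) * / (p - 2)) by (field; lra). nra.
    + assert (H4 : / (2 * r) <= 2 * / (1 + t + r)).
      { replace (2 * / (1 + t + r)) with (/ ((1 + t + r) / 2)) by (field; lra).
        apply Rinv_le_contravar; lra. }
      apply Rle_trans with (2 * / (1 + t + r) * (P * / (p - 2))).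
      * apply Rmult_le_compat_r; nra.
      * assert (0 < / (1 + t + r) * P) by (apply Rmult_lt_0_compat; lra).
        replace (2 * / (1 + t + r) * (P * / (p - 2))) with (2 / (p - 2) * (/ (1 + t + r) * P)) by (field; lra).
        nra.
  - assert (HC : cont (fun y => Rpower (1 + Rabs y) (1 - p))).
    { apply (cont_Rpower (fun y => 1 + Rabs y)); [ct |]. intros u. pose proof (Rabs_pos u). lra. }
    assert (E : Rpower (1 + a) (1 - p) = P * / (1 + a)).
    { unfold P. replace (1 - p) with ((2 - p) + - (1)) by ring.
      rewrite Rpower_plus, Rpower_Ropp, Rpower_1; lra. }
    assert (H1 : RInt (fun y => Rpower (1 + Rabs y) (1 - p)) a (t + r) <= 2 * r * (P * / (1 + a))).
    { apply Rle_trans with (RInt (fun _ => P * / (1 + a)) a (t + r)).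
      - apply RInt_le_cont; auto. ct.
        intros y Hy. rewrite <- E. apply Rpower_anti; [| lra]. rewrite Rabs_pos_eq; lra.
      - rewrite RInt_constR. apply Rmult_le_compat_r; auto.
        apply Rmult_le_pos; [lra |]. left; apply Rinv_0_lt_compat; lra. }
    apply Rle_trans with (P * / (1 + a)).
    + apply Rle_trans with (/ (2 * r) * (2 * r * (P * / (1 + a)))).
      * apply Rmult_le_compat_l; lra.
      * right. field. lra.
    + assert (H2 : / (1 + a) <= 2 * / (1 + t + r)).
      { replace (2 * / (1 + t + r)) with (/ ((1 + t + r) / 2)) by (field; lra).
        apply Rinv_le_contravar; lra. }
      assert (0 < / (1 + t + r) * P) by (apply Rmult_lt_0_compat; lra).
      assert (0 < 2 / (p - 2)) by (apply Rdiv_lt_0_compat; lra).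
      apply Rle_trans with (P * (2 * / (1 + t + r))); nra.
Qed.

Lemma cont_bracket c : cont (fun y => Rpower (1 + Rabs y) c).
Proof.
  apply (cont_Rpower (fun y => 1 + Rabs y)); [ct |]. intros u. pose proof (Rabs_pos u). lra.
Qed.

(** The integral over the half-line is [/ (q - 1)]. Applied with [q = p (p - 2)], this is where the
    lower bound on [p] acts. *)
Lemma bracket_primitive_bound q y : 1 < q ->
  Rabs (RInt (fun s => Rpower (1 + Rabs s) (- q)) 0 y) <= / (q - 1).
Proof.
  intros Hq. pose proof (cont_bracket (- q)) as C.
  set (b := fun s => Rpower (1 + Rabs s) (- q)) in *.
  assert (H0 : forall y, 0 <= y -> Rabs (RInt b 0 y) <= / (q - 1)).
  { intros z Hz. unfold b. replace (- q) with ((1 - q) - 1) by ring.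
    rewrite RInt_Rpower by lra.
    assert (E : Rpower (1 + 0) (1 - q) = 1).
    { unfold Rpower. rewrite Rplus_0_r, ln_1, Rmult_0_r. apply exp_0. }
    rewrite E.
    assert (H1 := Rpower_pos (1 + z) (1 - q)).
    assert (H2 : Rpower (1 + z) (1 - q) <= 1) by (apply Rpower_le1; lra).
    assert (0 < / (q - 1)) by (apply Rinv_0_lt_compat; lra).
    replace ((Rpower (1 + z) (1 - q) - 1) / (1 - q)) with ((1 - Rpower (1 + z) (1 - q)) * / (q - 1)) by (field; lra).
    rewrite Rabs_pos_eq; nra. }
  destruct (Rle_dec 0 y) as [Hy | Hy]; auto.
  (* The primitive of an even function is odd: the sum of its values at [y] and [- y] has derivative
     0. *)
  assert (E : RInt b 0 y = - RInt b 0 (- y)).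
  { apply Rplus_opp_r_uniq.
    assert (A : RInt (fun _ => 0) 0 y = (RInt b 0 (- y) + RInt b 0 y) - (RInt b 0 (- 0) + RInt b 0 0)).
    { apply (RInt_FTC (fun y => RInt b 0 (- y) + RInt b 0 y)).
      - intros x. eapply is_derive_eq.
        + apply is_derive_plusR; [| now apply is_derive_prim].
          apply (is_derive_compR (fun y => RInt b 0 y) (fun y => - y)); [now apply is_derive_prim |].
          auto_derive; auto; reflexivity.
        + unfold b. rewrite Rabs_Ropp. ring.
      - ct. }
    rewrite RInt_constR, Ropp_0, RInt_pointR in A. lra. }
  rewrite E, Rabs_Ropp. apply H0. lra.
Qed.

Lemma norm3_reflect (x : R3) : norm3 (ray zero (-1) x) = norm3 x.
Proof.
  apply norm3_eq; [apply norm3_ge_0 |]. rewrite norm3_sq. unfold dot, sum3. rewrite !coord_mv, !coord_zero. ring.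
Qed.

(** A negative radius is reduced to a positive one by replacing [x] with [- x], since
    [|x + tau o| = |- x - tau o|]. *)
Lemma Sph_radial_abs (h : R -> R) (x : R3) tau : cont h -> 0 < norm3 x ->
  Rabs tau * Sph (fun o => h (norm3 (ray x tau o))) =
  / (2 * norm3 x) * RInt (fun l => l * h (Rabs l)) (Rabs (norm3 x - Rabs tau)) (norm3 x + Rabs tau).
Proof.
  intros Ch Hx. destruct (Rle_dec 0 tau) as [Ht | Ht].
  - rewrite (Rabs_pos_eq tau) by auto. now apply Sph_radial.
  - rewrite (Rabs_left tau) by lra.
    assert (En := norm3_reflect x).
    assert (A := Sph_radial h (ray zero (-1) x) (- tau) Ch). rewrite En in A.
    rewrite <- A by lra. f_equal. apply Sph_ext. intros th ph. f_equal.
    apply norm3_eq; [apply norm3_ge_0 |]. rewrite norm3_sq. unfold dot, sum3. rewrite !coord_mv, !coord_zero. ring.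
Qed.

(* The formula for spherical means of radial functions requires [x <> 0]. *)
Lemma le_norm_pos (F G : R3 -> R) : cont F -> cont G ->
  (forall x, 0 < norm3 x -> F x <= G x) -> forall x, F x <= G x.
Proof.
  intros HF HG H x. destruct (Rle_lt_or_eq_dec 0 (norm3 x) (norm3_ge_0 x)) as [Hx | Hx]; auto.
  apply Rnot_lt_le. intros Hlt.
  assert (C : cont (fun h : R => F (ray x h e1) - G (ray x h e1))) by ct.
  assert (Hl : locally 0 (fun h : R => 0 < F (ray x h e1) - G (ray x h e1))).
  { apply (C 0 (fun y => 0 < y)). apply (open_gt 0). rewrite ray_0. lra. }
  destruct Hl as [d Hd]. pose proof (cond_pos d).
  assert (A : 0 < F (ray x (d / 2) e1) - G (ray x (d / 2) e1)).
  { apply Hd. change (Rabs (d / 2 - 0) < d). rewrite Rabs_pos_eq; lra. }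
  assert (0 < norm3 (ray x (d / 2) e1)); [| specialize (H (ray x (d / 2) e1)); lra].
  rewrite (norm3_eq _ (d / 2)); try lra.
  assert (Hz := norm_eq_zero (x : R3) (eq_sym Hx)). rewrite Hz.
  unfold dot, sum3. rewrite !coord_mv, !coord_zero. simpl. ring.
Qed.

(** Decay of free waves. The mean is dominated by that of the radial profile [(1 + l)^(- p)], and
    [l (1 + l)^(- p) <= (1 + l)^(1 - p)] leads to the integral of [radial_integral_bound].
    Continuity in [x] covers the origin. *)
Lemma Sph_decay p (k : R3 -> R) (x : R3) t : 2 < p -> cont k ->
  (forall th ph, Rabs (k (om th ph)) <= Rpower (1 + norm3 (ray x t (om th ph))) (- p)) ->
  Rabs t * Rabs (Sph k) <= radial_const p * Phi p (t, x).
Proof.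
  intros Hp Ck Hk.
  pose (h := fun l => Rpower (1 + Rabs l) (- p)).
  assert (Ch : cont h) by apply cont_bracket.
  assert (Hh : forall y : R3, h (norm3 y) = Rpower (1 + norm3 y) (- p)).
  { intros y. unfold h. now rewrite (Rabs_pos_eq (norm3 y)) by apply norm3_ge_0. }
  apply Rle_trans with (Rabs t * Sph (fun o => h (norm3 (ray x t o)))).
  { apply Rmult_le_compat_l; [apply Rabs_pos |]. apply Sph_abs; auto. ct.
    intros. rewrite Hh. apply Hk. }
  pose proof (cont_Phi p) as CP.
  revert x Hk. intros x _. revert x.
  apply (le_norm_pos (fun x => Rabs t * Sph (fun o => h (norm3 (ray x t o)))) (fun x => radial_const p * Phi p (t, x))).
  - ct.
  - ct.
  - intros x Hx. rewrite Sph_radial_abs by auto.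
    eapply Rle_trans; [| apply (radial_integral_bound p (Rabs t) (norm3 x) Hp (Rabs_pos t) Hx)].
    apply Rmult_le_compat_l; [left; apply Rinv_0_lt_compat; lra |].
    rewrite (Rabs_minus_sym (norm3 x)), (Rplus_comm (norm3 x)).
    apply RInt_le_cont.
    + pose proof (Rabs_pos t). apply Rabs_le; lra.
    + ct.
    + apply cont_bracket.
    + intros l Hl. assert (0 <= l) by (pose proof (Rabs_pos (Rabs t - norm3 x)); lra).
      unfold h. rewrite Rabs_Rabsolu, (Rabs_pos_eq l) by auto.
      replace (- p) with ((1 - p) + - (1)) by ring.
      rewrite Rpower_plus, Rpower_Ropp, Rpower_1 by lra.
      pose proof (Rpower_pos (1 + l) (1 - p)).
      replace (l * (Rpower (1 + l) (1 - p) * / (1 + l))) with (Rpower (1 + l) (1 - p) * (l * / (1 + l))) by ring.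
      rewrite <- (Rmult_1_r (Rpower (1 + l) (1 - p))) at 2.
      apply Rmult_le_compat_l; [lra |]. apply Rle_div_l; lra.
Qed.

(** * Reduction to nonnegative times, and the Volterra bound *)

Definition reflect (q : spacetime) : spacetime := (- fst q, ray zero (-1) (snd q)).

Lemma cont_reflect : cont reflect.
Proof. unfold reflect. ct. Qed.

Lemma reflect_ray (x o : R3) h : ray zero (-1) (ray (ray zero (-1) x) h o) = ray x (- h) o.
Proof.
  apply R3_eq. intros i. rewrite !coord_mv.
  rewrite coord_zero. ring.
Qed.

(** Reflecting [x] together with [t] keeps the directions [o] fixed on the cone. The sign from the
    substitution of [- s] for [s] cancels the sign of the factor [tau] in [Kir]. *)
Lemma Duh_reflect w q : cont w -> Duh w q = Duh (fun y => w (reflect y)) (reflect q).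
Proof.
  intros Hw. destruct q as [t x]. unfold reflect at 2. simpl.
  assert (Hw' : cont (fun y => w (reflect y))) by (apply (cont_comp w); auto; apply cont_reflect).
  rewrite !Duh_Kir by auto.
  assert (CK : cont (fun s => Kir (fun y => w (s, y)) x (t - s))) by (unfold Kir; ct).
  transitivity (RInt (fun s => - Kir (fun y => w (- s, y)) x (t - - s)) 0 (- t)).
  - transitivity (RInt (fun s => Kir (fun y => w (s, y)) x (t - s)) (-1 * 0 + 0) (-1 * - t + 0)).
    { f_equal; ring. }
    rewrite <- (RInt_comp_lin (fun s => Kir (fun y => w (s, y)) x (t - s)) (-1) 0 0 (- t)) by now apply ex_RInt_cont.
    apply RInt_extR. intros s. replace (-1 * s + 0) with (- s) by ring.
    change (-1 * Kir (fun y => w (- s, y)) x (t - - s) = - Kir (fun y => w (- s, y)) x (t - - s)). ring.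
  - apply RInt_extR. intros s. unfold Kir, reflect. cbn [fst snd].
    replace (t - - s) with (- (- t - s)) by ring.
    rewrite <- Ropp_mult_distr_l, Ropp_involutive. f_equal.
    apply Sph_ext. intros th ph. now rewrite reflect_ray.
Qed.

Lemma Rabs_RInt_le (f g : R -> R) a b : a <= b -> cont f -> cont g ->
  (forall s, a <= s <= b -> Rabs (f s) <= g s) -> Rabs (RInt f a b) <= RInt g a b.
Proof.
  intros Hab Hf Hg H. apply Rle_trans with (RInt (fun s => Rabs (f s)) a b).
  - apply abs_RInt_le; auto. now apply ex_RInt_cont.
  - apply RInt_le_cont; auto. ct.
Qed.

(** The integral of [(t - s) exp (k s)] over [0 <= s <= t] is at most [exp (k t) / k^2]. The gain
    [1 / k^2] is what makes [Duh] contract in an exponentially weighted norm. *)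
Lemma Duh_exp_bound w k A T : cont w -> 0 < k -> 0 <= A ->
  (forall q, Rabs (fst q) <= T -> Rabs (w q) <= A * exp (k * Rabs (fst q))) ->
  forall q, Rabs (fst q) <= T -> Rabs (Duh w q) <= A / (k * k) * exp (k * Rabs (fst q)).
Proof.
  intros Hw Hk HA.
  assert (Hpos : forall w : spacetime -> R, cont w -> 
    (forall q, Rabs (fst q) <= T -> Rabs (w q) <= A * exp (k * Rabs (fst q))) ->
    forall q, Rabs (fst q) <= T -> 0 <= fst q -> Rabs (Duh w q) <= A / (k * k) * exp (k * Rabs (fst q))).
  { clear w Hw. intros w Hw H [t x] HT Ht. simpl in HT, Ht |- *.
    rewrite (Rabs_pos_eq t) in * by auto.
    rewrite Duh_Kir by auto.
    apply Rle_trans with (RInt (fun s => A * ((t - s) * exp (k * s))) 0 t).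
    - apply Rabs_RInt_le; auto.
      + unfold Kir. ct.
      + ct.
      + intros s Hs. unfold Kir. rewrite Rabs_mult, (Rabs_pos_eq (t - s)) by lra.
        replace (A * ((t - s) * exp (k * s))) with ((t - s) * (A * exp (k * s))) by ring.
        apply Rmult_le_compat_l; [lra |].
        rewrite <- (Sph_const (A * exp (k * s))). apply Sph_abs; try ct.
        intros th ph. specialize (H (s, ray x (t - s) (om th ph))). simpl in H.
        rewrite Rabs_pos_eq in H by lra. apply H. lra.
    - rewrite RIntZ by ct.
      (* The value of this primitive at [s = 0] is [t / k + 1 / k^2], which is nonnegative and
         dropped. *)
      rewrite (RInt_FTC (fun s => (t - s) * exp (k * s) * / k + exp (k * s) * / (k * k))).
      + replace (t - t) with 0 by ring. rewrite Rmult_0_r, exp_0.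
        assert (Hk' : 0 < / k) by now apply Rinv_0_lt_compat.
        unfold Rdiv. rewrite (Rmult_assoc A). apply Rmult_le_compat_l; auto.
        assert (H0 : 0 <= t * / k) by (apply Rmult_le_pos; lra).
        assert (H1 : 0 < / (k * k)) by (apply Rinv_0_lt_compat, Rmult_lt_0_compat; lra).
        lra.
      + intros s. auto_derive; auto. field. lra.
      + ct. }
  intros H q HT. destruct (Rle_dec 0 (fst q)) as [Ht | Ht]; [now apply Hpos |].
  rewrite Duh_reflect by auto.
  assert (E : Rabs (fst (reflect q)) = Rabs (fst q)) by (simpl; apply Rabs_Ropp).
  rewrite <- E. apply Hpos.
  - apply (cont_comp w); auto. apply cont_reflect.
  - intros y Hy. rewrite <- (Rabs_Ropp (fst y)). apply (H (reflect y)).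
    simpl. now rewrite Rabs_Ropp.
  - now rewrite E.
  - simpl. lra.
Qed.

(** For [q = p (p - 2)] this is [Phi^p] in radial variables; John's estimate itself holds for any
    [q > 1]. The absolute values make the weight continuous on all of [R * R]. *)
Definition John_weight (p q s l : R) : R :=
  Rpower (1 + Rabs s + Rabs l) (- p) * Rpower (1 + Rabs (Rabs s - Rabs l)) (- q).

Lemma cont_John_weight {U : UniformSpace} p q (s l : U -> R) : cont s -> cont l ->
  cont (fun u => John_weight p q (s u) (l u)).
Proof.
  intros Hs Hl. unfold John_weight. apply cont_mult.
  - apply (cont_Rpower (fun u => 1 + Rabs (s u) + Rabs (l u))); [ct |].
    intros u. apply Rplus_lt_le_0_compat; [apply Rplus_lt_le_0_compat; [lra |] |]; apply Rabs_pos.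
  - apply (cont_Rpower (fun u => 1 + Rabs (Rabs (s u) - Rabs (l u)))); [ct |].
    intros u. apply Rplus_lt_le_0_compat; [lra | apply Rabs_pos].
Qed.

Definition John_const (p q : R) : R := / (q - 1) * radial_const p.

(** In the null coordinate [y = s + l] the range of integration can be enlarged to
    [|t - r| <= y <= t + r] for every [s]. The integral of [b (2 s - y)] over [s] is then at most
    [/ (q - 1)], uniformly in [y], and what remains is the integral of [a] treated by
    [radial_integral_bound]. [John_const] is the product of the two constants. *)
Lemma John_estimate_pos p q w t (x : R3) : 2 < p -> 1 < q -> cont w ->
  (forall y : spacetime, Rabs (w y) <= John_weight p q (fst y) (norm3 (snd y))) ->
  0 <= t -> 0 < norm3 x -> Rabs (Duh w (t, x)) <= John_const p q * Phi p (t, x).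
Proof.
  intros Hp Hq Cw_ Hw Ht Hx.
  set (r := norm3 x) in *.
  assert (Hr : 0 < / (2 * r)) by (apply Rinv_0_lt_compat; lra).
  pose (a := fun y => Rpower (1 + Rabs y) (1 - p)).
  pose (b := fun y => Rpower (1 + Rabs y) (- q)).
  assert (Ca : cont a) by apply cont_bracket. assert (Cb : cont b) by apply cont_bracket.
  assert (Pa : forall y, 0 < a y) by (intros; apply Rpower_pos).
  assert (Pb : forall y, 0 < b y) by (intros; apply Rpower_pos).
  assert (Hab : Rabs (t - r) <= t + r) by (apply Rabs_le; lra).
  pose (I := fun s => RInt (fun y => a y * b (2 * s - y)) (Rabs (t - r)) (t + r)).
  assert (CI : cont I).
  { unfold I. apply (cont_RInt (fun s y => a y * b (2 * s - y))). ct. }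
  rewrite Duh_Kir by auto.
  apply Rle_trans with (RInt (fun s => / (2 * r) * I s) 0 t).
  - apply Rabs_RInt_le; auto.
    + unfold Kir. ct.
    + ct.
    + intros s Hs. unfold Kir. rewrite Rabs_mult.
      assert (Chs : cont (John_weight p q s)) by (apply (cont_John_weight p q (fun _ => s) (fun l => l)); ct).
      apply Rle_trans with (Rabs (t - s) * Sph (fun o => John_weight p q s (norm3 (ray x (t - s) o)))).
      { apply Rmult_le_compat_l; [apply Rabs_pos |]. apply Sph_abs; try ct. 
        intros th ph. apply (Hw (s, ray x (t - s) (om th ph))). }
      rewrite (Sph_radial_abs (John_weight p q s)) by auto. fold r.
      rewrite (Rabs_pos_eq (t - s)) by lra.
      apply Rmult_le_compat_l; [lra |].
      assert (H1 : Rabs (r - (t - s)) <= r + (t - s)) by (apply Rabs_le; lra).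
      (* The interval for [y = s + l] starts at [s + |r - (t - s)|] and always ends at [t + r];
         extending it down to [|t - r|] only adds a nonnegative contribution. *)
      assert (H2 : Rabs (t - r) <= s + Rabs (r - (t - s))).
      { unfold Rabs; repeat destruct Rcase_abs; lra. }
      apply Rle_trans with (RInt (fun l => a (s + l) * b (2 * s - (s + l))) (Rabs (r - (t - s))) (r + (t - s))).
      * apply RInt_le_cont; try ct; auto.
        intros l Hl. assert (0 <= l) by (pose proof (Rabs_pos (r - (t - s))); lra).
        unfold John_weight, a, b. rewrite Rabs_Rabsolu, (Rabs_pos_eq l), (Rabs_pos_eq s), (Rabs_pos_eq (s + l)) by lra.
        replace (2 * s - (s + l)) with (s - l) by ring.
        rewrite <- Rmult_assoc. apply Rmult_le_compat_r; [left; apply Rpower_pos |].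
        replace (- p) with ((1 - p) + - (1)) by ring.
        rewrite <- Rplus_assoc, Rpower_plus, Rpower_Ropp, Rpower_1 by lra.
        pose proof (Rpower_pos (1 + s + l) (1 - p)).
        replace (l * (Rpower (1 + s + l) (1 - p) * / (1 + s + l)))
          with (Rpower (1 + s + l) (1 - p) * (l * / (1 + s + l))) by ring.
        rewrite <- (Rmult_1_r (Rpower (1 + s + l) (1 - p))) at 2.
        apply Rmult_le_compat_l; [lra |]. apply Rle_div_l; lra.
      * rewrite (RInt_shift (fun y => a y * b (2 * s - y))) by ct.
        replace (s + (r + (t - s))) with (t + r) by ring.
        apply RInt_lower_le; [lra | ct |].
        intros y. left. now apply Rmult_lt_0_compat.
  - rewrite RIntZ by auto.
    pose (B := fun y => RInt b 0 y).
    assert (CB : cont B).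
    { apply (cont_of_derive _ b). intros y. now apply is_derive_prim. }
    (* [b (2 s - y)] is the [s]-derivative of [B (2 s - y) / 2], which again replaces Fubini. *)
    assert (E : RInt I 0 t = RInt (fun y => a y * (/ 2 * B (2 * t - y))) (Rabs (t - r)) (t + r) -
       RInt (fun y => a y * (/ 2 * B (2 * 0 - y))) (Rabs (t - r)) (t + r)).
    { apply (RInt_FTC (fun s => RInt (fun y => a y * (/ 2 * B (2 * s - y))) (Rabs (t - r)) (t + r))); auto.
      apply (is_derive_RInt_cont (fun s y => a y * (/ 2 * B (2 * s - y))) (fun s y => a y * b (2 * s - y))).
      - intros s y. apply is_derive_scal. eapply is_derive_eq.
        + apply is_derive_scal. apply (is_derive_compR B (fun s => 2 * s - y)).
          * now apply is_derive_prim.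
          * auto_derive; auto; reflexivity.
        + field.
      - intros s. ct.
      - ct. }
    rewrite E, <- RIntB by ct.
    unfold John_const. rewrite Rmult_assoc.
    assert (Hq1 : 0 < / (q - 1)) by (apply Rinv_0_lt_compat; lra).
    apply Rle_trans with (/ (q - 1) * (/ (2 * r) * RInt a (Rabs (t - r)) (t + r))).
    + replace (/ (q - 1) * (/ (2 * r) * RInt a (Rabs (t - r)) (t + r))) with
        (/ (2 * r) * (/ (q - 1) * RInt a (Rabs (t - r)) (t + r))) by ring.
      apply Rmult_le_compat_l; [lra |].
      rewrite <- RIntZ by auto. apply RInt_le_cont; auto; try ct.
      intros y _.
      assert (B1 := bracket_primitive_bound q (2 * t - y) Hq).
      assert (B2 := bracket_primitive_bound q (2 * 0 - y) Hq).
      fold b in B1, B2. fold (B (2 * t - y)) in B1. fold (B (2 * 0 - y)) in B2.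
      apply Rabs_le_between in B1. apply Rabs_le_between in B2. specialize (Pa y). nra.
    + apply Rmult_le_compat_l; [lra |].
      assert (A := radial_integral_bound p t r Hp Ht Hx).
      unfold Phi. simpl fst; simpl snd. rewrite (Rabs_pos_eq t) by auto. exact A.
Qed.

Lemma John_estimate p q w : 2 < p -> 1 < q -> cont w ->
  (forall y : spacetime, Rabs (w y) <= John_weight p q (fst y) (norm3 (snd y))) ->
  forall y, Rabs (Duh w y) <= John_const p q * Phi p y.
Proof.
  intros Hp Hq.
  assert (Hpos : forall w : spacetime -> R, cont w ->
     (forall y : spacetime, Rabs (w y) <= John_weight p q (fst y) (norm3 (snd y))) ->
     forall t x, 0 <= t -> Rabs (Duh w (t, x)) <= John_const p q * Phi p (t, x)).
  { intros v Cv Hv t x Ht. revert x. pose proof (cont_Phi p) as CP.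
    apply (le_norm_pos (fun x => Rabs (Duh v (t, x))) (fun x => John_const p q * Phi p (t, x))); try ct.
    intros x Hx. now apply John_estimate_pos. }
  intros Hw H [t x]. destruct (Rle_dec 0 t) as [Ht | Ht]; [now apply Hpos |].
  rewrite Duh_reflect by auto.
  assert (E : Phi p (t, x) = Phi p (reflect (t, x))).
  { unfold Phi, reflect. cbn [fst snd]. now rewrite Rabs_Ropp, norm3_reflect. }
  rewrite E. apply Hpos.
  - apply (cont_comp w); auto. apply cont_reflect.
  - intros y. specialize (H (reflect y)). unfold reflect in H at 2 3. cbn [fst snd] in H.
    rewrite norm3_reflect in H. unfold John_weight in *. now rewrite Rabs_Ropp in H.
  - simpl. lra.
Qed.

(** * The power nonlinearity *)

Lemma abs_pow_nz u a : u <> 0 -> abs_pow u a = Rpower (Rabs u) a.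
Proof. intros H. unfold abs_pow. now destruct Req_EM_T. Qed.

Lemma abs_pow_0 a : abs_pow 0 a = 0.
Proof. unfold abs_pow. now destruct Req_EM_T. Qed.

Lemma abs_pow_ge0 u a : 0 <= abs_pow u a.
Proof.
  unfold abs_pow. destruct Req_EM_T; [lra |]. left; apply Rpower_pos.
Qed.

Lemma abs_pow_abs u a : abs_pow (Rabs u) a = abs_pow u a.
Proof.
  destruct (Req_dec u 0) as [-> | H]; [now rewrite Rabs_R0 |].
  rewrite !abs_pow_nz; auto using Rabs_no_R0. now rewrite Rabs_Rabsolu.
Qed.

Lemma abs_pow_le u v a : 0 <= a -> Rabs u <= Rabs v -> abs_pow u a <= abs_pow v a.
Proof.
  intros Ha H. destruct (Req_dec u 0) as [-> | Hu].
  - rewrite abs_pow_0. apply abs_pow_ge0.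
  - assert (0 < Rabs u) by now apply Rabs_pos_lt.
    assert (v <> 0) by (intros ->; rewrite Rabs_R0 in H; lra).
    rewrite !abs_pow_nz by auto. apply Rle_Rpower_l; auto.
Qed.

Lemma abs_pow_mult u v a : abs_pow (u * v) a = abs_pow u a * abs_pow v a.
Proof.
  destruct (Req_dec u 0) as [-> | Hu]; [rewrite Rmult_0_l, abs_pow_0; ring |].
  destruct (Req_dec v 0) as [-> | Hv]; [rewrite Rmult_0_r, abs_pow_0; ring |].
  rewrite !abs_pow_nz by (auto; now apply Rmult_integral_contrapositive).
  rewrite Rabs_mult. symmetry. apply Rpower_mult_distr; now apply Rabs_pos_lt.
Qed.

Lemma abs_pow_1 a : abs_pow 1 a = 1.
Proof.
  rewrite abs_pow_nz by lra. rewrite Rabs_R1. unfold Rpower. rewrite ln_1, Rmult_0_r. apply exp_0.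
Qed.

Lemma abs_pow_pow u n a : abs_pow (u ^ n) a = abs_pow u a ^ n.
Proof.
  induction n as [| n IH]; simpl; [apply abs_pow_1 |]. now rewrite abs_pow_mult, IH.
Qed.

Lemma abs_pow_le1 u a : 0 <= a -> Rabs u <= 1 -> abs_pow u a <= 1.
Proof.
  intros Ha H. rewrite <- (abs_pow_1 a). apply abs_pow_le; auto. now rewrite Rabs_R1.
Qed.

Lemma abs_pow_lt1 u a : 0 < a -> Rabs u < 1 -> abs_pow u a < 1.
Proof.
  intros Ha H. destruct (Req_dec u 0) as [-> | Hu]; [rewrite abs_pow_0; lra |].
  rewrite abs_pow_nz, <- (abs_pow_1 a), abs_pow_nz by lra. rewrite Rabs_R1.
  apply Rlt_Rpower_l; auto. split; auto. now apply Rabs_pos_lt.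
Qed.

Lemma abs_pow_plus u a b : abs_pow u (a + b) = abs_pow u a * abs_pow u b.
Proof.
  destruct (Req_dec u 0) as [-> | Hu]; [rewrite !abs_pow_0; ring |].
  rewrite !abs_pow_nz by auto. apply Rpower_plus.
Qed.

Lemma abs_pow_2 u : abs_pow u 2 = u * u.
Proof.
  destruct (Req_dec u 0) as [-> | Hu]; [rewrite abs_pow_0; ring |].
  rewrite abs_pow_nz by auto. replace 2 with (1 + 1) by ring.
  assert (0 < Rabs u) by now apply Rabs_pos_lt.
  rewrite Rpower_plus, Rpower_1 by auto. rewrite <- Rabs_mult. apply Rabs_pos_eq. nra.
Qed.

(** For [0 <= z <= s] one has [z s^(a - 1) <= z^a] because [a - 1 <= 0]. Adding this for [z = x] and
    [z = y], with [s = x + y], gives the claim. *)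
Lemma abs_pow_subadd x y a : 0 < a <= 1 -> 0 <= x -> 0 <= y ->
  abs_pow (x + y) a <= abs_pow x a + abs_pow y a.
Proof.
  intros Ha Hx Hy.
  destruct (Req_dec (x + y) 0) as [E | E].
  { rewrite E, abs_pow_0. pose proof (abs_pow_ge0 x a). pose proof (abs_pow_ge0 y a). lra. }
  set (s := x + y) in *. assert (Hs : 0 < s) by (unfold s in *; lra).
  assert (H : forall z, 0 <= z <= s -> z * Rpower s (a - 1) <= abs_pow z a).
  { intros z Hz. destruct (Req_dec z 0) as [-> | Hz0].
    - rewrite abs_pow_0. lra.
    - rewrite abs_pow_nz, Rabs_pos_eq by lra.
      replace a with (1 + (a - 1)) at 2 by ring. rewrite Rpower_plus, Rpower_1 by lra.
      apply Rmult_le_compat_l; [lra |]. apply Rpower_anti; lra. }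
  assert (H1 := H x ltac:(unfold s; lra)). assert (H2 := H y ltac:(unfold s; lra)).
  rewrite (abs_pow_nz s), Rabs_pos_eq by lra.
  replace a with (1 + (a - 1)) at 1 by ring. rewrite Rpower_plus, Rpower_1 by lra.
  unfold s at 1. lra.
Qed.

Lemma abs_pow_Holder u v a : 0 < a <= 1 ->
  Rabs (abs_pow u a - abs_pow v a) <= abs_pow (u - v) a.
Proof.
  intros Ha.
  assert (H : forall u v, abs_pow u a - abs_pow v a <= abs_pow (u - v) a).
  { clear u v. intros u v.
    assert (abs_pow u a <= abs_pow (Rabs v + Rabs (u - v)) a).
    { apply abs_pow_le; [lra |]. rewrite (Rabs_pos_eq (_ + _)).
      - replace u with (v + (u - v)) at 1 by ring. apply Rabs_triang.
      - pose proof (Rabs_pos v). pose proof (Rabs_pos (u - v)). lra. }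
    assert (A := abs_pow_subadd (Rabs v) (Rabs (u - v)) a Ha (Rabs_pos _) (Rabs_pos _)).
    rewrite !abs_pow_abs in A. lra. }
  apply Rabs_le. split; [| apply H].
  assert (A := H v u). replace (v - u) with (- (u - v)) in A by ring.
  rewrite <- (abs_pow_abs (- (u - v))), Rabs_Ropp, abs_pow_abs in A. lra.
Qed.

Lemma cont_abs_pow a : 0 < a <= 1 -> cont (fun u => abs_pow u a).
Proof.
  intros Ha u. apply filterlim_locally. intros eps.
  assert (Hd : 0 < Rpower eps (/ a)) by apply Rpower_pos.
  exists (mkposreal _ Hd). intros v Hv. change (Rabs (v - u) < Rpower eps (/ a)) in Hv.
  change (Rabs (abs_pow v a - abs_pow u a) < eps).
  eapply Rle_lt_trans; [now apply abs_pow_Holder |].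
  pose proof (cond_pos eps).
  destruct (Req_dec (v - u) 0) as [E | E]; [rewrite E, abs_pow_0; auto |].
  rewrite abs_pow_nz by auto.
  replace (pos eps) with (Rpower (Rpower eps (/ a)) a).
  - apply Rlt_Rpower_l; [lra |]. split; auto. now apply Rabs_pos_lt.
  - rewrite Rpower_mult. replace (/ a * a) with 1 by (field; lra). now apply Rpower_1.
Qed.

Lemma is_derive_abs_pow u a : u <> 0 -> is_derive (fun y => abs_pow y a) u (a * abs_pow u a / u).
Proof.
  intros Hu. rewrite abs_pow_nz by auto.
  destruct (Rle_or_lt 0 u) as [H | H].
  - apply (is_derive_ext_loc (fun y => Rpower y a)).
    + assert (Hu' : 0 < u) by lra.
      generalize (open_gt 0 u Hu'). apply filter_imp. intros y Hy.
      rewrite abs_pow_nz by lra. now rewrite Rabs_pos_eq by lra.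
    + eapply is_derive_eq; [apply is_derive_Rpower; lra |].
      rewrite Rabs_pos_eq by auto.
      unfold Rminus. rewrite Rpower_plus, Rpower_Ropp, Rpower_1 by lra. field; auto.
  - apply (is_derive_ext_loc (fun y => Rpower (- y) a)).
    + generalize (open_lt 0 u H). apply filter_imp. intros y Hy.
      rewrite abs_pow_nz by lra. now rewrite Rabs_left by lra.
    + eapply is_derive_eq.
      * apply (is_derive_compR (fun y => Rpower y a) (fun y => - y)).
        -- apply is_derive_Rpower; lra.
        -- auto_derive; auto; reflexivity.
      * rewrite Rabs_left by auto.
        unfold Rminus. rewrite Rpower_plus, Rpower_Ropp, Rpower_1 by lra. field; auto.
Qed.

(** [F1] and [F2] are the first and second derivatives of [|u|^p]. Powers of [u] are split off so
    that only the exponent [p - 2], which lies in [(0, 1]], is left inside [abs_pow]; there the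
    Hoelder inequality holds. *)
Definition F1 (p u : R) : R := p * (u * abs_pow u (p - 2)).
Definition F2 (p u : R) : R := p * ((p - 1) * abs_pow u (p - 2)).

(** At [u = 0] the factor [|y|^a] is merely continuous, and the vanishing of the factor [y] saves
    the product rule. *)
Lemma is_derive_u_abs_pow a u : 0 < a <= 1 ->
  is_derive (fun y => y * abs_pow y a) u ((a + 1) * abs_pow u a).
Proof.
  intros Ha. destruct (Req_dec u 0) as [-> | Hu].
  - eapply is_derive_eq.
    + apply (is_derive_mult_zero (fun y => y) (fun y => abs_pow y a) 0 1).
      * auto_derive; auto.
      * reflexivity.
      * now apply cont_abs_pow.
    + rewrite abs_pow_0. ring.
  - eapply is_derive_eq.
    + apply (is_derive_multR (fun y => y) (fun y => abs_pow y a) u 1).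
      * auto_derive; auto.
      * now apply is_derive_abs_pow.
    + field. auto.
Qed.

Lemma is_derive_F p u : 2 < p <= 3 -> is_derive (fun y => abs_pow y p) u (F1 p u).
Proof.
  intros Hp.
  apply (is_derive_ext (fun y => y * (y * abs_pow y (p - 2)))).
  { intros y. replace p with (2 + (p - 2)) at 2 by ring. rewrite abs_pow_plus, abs_pow_2.
    symmetry. apply Rmult_assoc. }
  eapply is_derive_eq.
  - apply (is_derive_multR (fun y => y) (fun y => y * abs_pow y (p - 2)) u 1).
    + auto_derive; auto.
    + apply is_derive_u_abs_pow. lra.
  - unfold F1. ring.
Qed.

Lemma is_derive_F1 p u : 2 < p <= 3 -> is_derive (F1 p) u (F2 p u).
Proof.
  intros Hp. unfold F1, F2. apply is_derive_scal.
  eapply is_derive_eq; [apply is_derive_u_abs_pow; lra |]. ring.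
Qed.

Lemma cont_F p : 2 < p <= 3 -> cont (fun y => abs_pow y p).
Proof. intros Hp. apply (cont_of_derive _ (F1 p)). intros; now apply is_derive_F. Qed.

Lemma cont_F1 p : 2 < p <= 3 -> cont (F1 p).
Proof. intros Hp. apply (cont_of_derive _ (F2 p)). intros; now apply is_derive_F1. Qed.

Lemma cont_F2 p : 2 < p <= 3 -> cont (F2 p).
Proof.
  intros Hp. assert (C : cont (fun u => abs_pow u (p - 2))) by (apply cont_abs_pow; lra).
  unfold F2. apply (cont_mult (fun _ => p)); [ct |]. apply (cont_mult (fun _ => p - 1)); [ct |]. exact C.
Qed.

Lemma F1_bound p u : 2 < p <= 3 -> Rabs u <= 1 -> Rabs (F1 p u) <= 3.
Proof.
  intros Hp Hu. unfold F1. rewrite !Rabs_mult, (Rabs_pos_eq p) by lra.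
  rewrite (Rabs_pos_eq (abs_pow _ _)) by apply abs_pow_ge0.
  assert (H := abs_pow_le1 u (p - 2) ltac:(lra) Hu). pose proof (abs_pow_ge0 u (p - 2)).
  pose proof (Rabs_pos u).
  assert (Rabs u * abs_pow u (p - 2) <= 1 * 1) by (apply Rmult_le_compat; lra).
  assert (0 <= Rabs u * abs_pow u (p - 2)) by (apply Rmult_le_pos; lra). nra.
Qed.

Lemma F2_bound p u : 2 < p <= 3 -> Rabs u <= 1 -> Rabs (F2 p u) <= 6.
Proof.
  intros Hp Hu. unfold F2. rewrite !Rabs_mult, (Rabs_pos_eq p), (Rabs_pos_eq (p - 1)) by lra.
  rewrite (Rabs_pos_eq (abs_pow _ _)) by apply abs_pow_ge0.
  assert (H := abs_pow_le1 u (p - 2) ltac:(lra) Hu). pose proof (abs_pow_ge0 u (p - 2)).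
  assert ((p - 1) * abs_pow u (p - 2) <= 2 * 1) by (apply Rmult_le_compat; lra).
  assert (0 <= (p - 1) * abs_pow u (p - 2)) by (apply Rmult_le_pos; lra). nra.
Qed.

Lemma Lipschitz_of_derive (f f' : R -> R) K : (forall x, is_derive f x (f' x)) ->
  (forall x, Rabs x <= 1 -> Rabs (f' x) <= K) ->
  forall a b, Rabs a <= 1 -> Rabs b <= 1 -> Rabs (f a - f b) <= K * Rabs (a - b).
Proof.
  intros Hd HK a b Ha Hb.
  destruct (MVT_gen f b a f') as (c & Hc & E).
  - intros; apply Hd.
  - intros x _. apply continuity_pt_filterlim. apply (cont_of_derive _ _ Hd).
  - rewrite E, Rabs_mult. apply Rmult_le_compat_r; [apply Rabs_pos |]. apply HK.
    apply Rabs_le_between in Ha. apply Rabs_le_between in Hb. apply Rabs_le.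
    unfold Rmin, Rmax in Hc. destruct (Rle_dec b a); lra.
Qed.

Lemma F_Lip p a b : 2 < p <= 3 -> Rabs a <= 1 -> Rabs b <= 1 ->
  Rabs (abs_pow a p - abs_pow b p) <= 3 * Rabs (a - b).
Proof.
  intros Hp. apply (Lipschitz_of_derive (fun y => abs_pow y p) (F1 p)).
  - intros; now apply is_derive_F.
  - intros; now apply F1_bound.
Qed.

Lemma F1_Lip p a b : 2 < p <= 3 -> Rabs a <= 1 -> Rabs b <= 1 ->
  Rabs (F1 p a - F1 p b) <= 6 * Rabs (a - b).
Proof.
  intros Hp. apply (Lipschitz_of_derive (F1 p) (F2 p)).
  - intros; now apply is_derive_F1.
  - intros; now apply F2_bound.
Qed.

Lemma F2_Holder p a b : 2 < p <= 3 ->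
  Rabs (F2 p a - F2 p b) <= 6 * abs_pow (a - b) (p - 2).
Proof.
  intros Hp. unfold F2.
  replace (p * ((p - 1) * abs_pow a (p - 2)) - p * ((p - 1) * abs_pow b (p - 2)))
    with (p * (p - 1) * (abs_pow a (p - 2) - abs_pow b (p - 2))) by ring.
  rewrite Rabs_mult, (Rabs_pos_eq (p * (p - 1))) by nra.
  apply Rmult_le_compat; [nra | apply Rabs_pos | nra |]. apply abs_pow_Holder. lra.
Qed.

(** [Phi^p] is exactly the John weight with [q = p (p - 2)], and [N^p <= N^2] since [N <= 1] and
    [p > 2]. The second factor [N] is the source of smallness. *)
Lemma F_weighted p u N (q : spacetime) : 2 < p -> 0 < N <= 1 -> Rabs u <= N * Phi p q ->
  Rabs (abs_pow u p) <= N * N * John_weight p (p * (p - 2)) (fst q) (norm3 (snd q)).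
Proof.
  intros Hp HN Hu. rewrite Rabs_pos_eq by apply abs_pow_ge0.
  pose proof (Phi_pos p q) as HP.
  apply Rle_trans with (abs_pow (N * Phi p q) p).
  { apply abs_pow_le; [lra |]. rewrite (Rabs_pos_eq (N * _)); auto. nra. }
  rewrite abs_pow_mult. apply Rmult_le_compat; try apply abs_pow_ge0.
  - replace p with (2 + (p - 2)) by ring. rewrite abs_pow_plus, abs_pow_2.
    rewrite <- (Rmult_1_r (N * N)) at 2. apply Rmult_le_compat_l; [nra |].
    apply abs_pow_le1; [lra |]. rewrite Rabs_pos_eq; lra.
  - right. rewrite abs_pow_nz, Rabs_pos_eq by lra.
    unfold Phi, decay_weight, John_weight. rewrite (Rabs_pos_eq (norm3 (snd q))) by apply norm3_ge_0.
    assert (H1 : 0 < 1 + Rabs (fst q) + norm3 (snd q)).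
    { apply Rplus_lt_le_0_compat; [apply Rplus_lt_le_0_compat; [lra | apply Rabs_pos] | apply norm3_ge_0]. }
    rewrite <- Rpower_mult_distr; [| now apply Rinv_0_lt_compat | apply Rpower_pos].
    f_equal.
    + replace (/ (1 + Rabs (fst q) + norm3 (snd q))) with (Rpower (1 + Rabs (fst q) + norm3 (snd q)) (-(1))).
      * rewrite Rpower_mult. f_equal. ring.
      * rewrite Rpower_Ropp, Rpower_1; auto.
    + rewrite Rpower_mult. f_equal. ring.
Qed.

(** * Volterra iteration on time strips *)

Lemma John_estimate_scaled p q w M : 2 < p -> 1 < q -> cont w -> 0 < M ->
  (forall y : spacetime, Rabs (w y) <= M * John_weight p q (fst y) (norm3 (snd y))) ->
  forall y, Rabs (Duh w y) <= M * John_const p q * Phi p y.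
Proof.
  intros Hp Hq Cw_ HM H y.
  assert (A := John_estimate p q (fun y => / M * w y) Hp Hq).
  assert (HM' : 0 < / M) by now apply Rinv_0_lt_compat.
  replace (Duh w y) with (M * Duh (fun y => / M * w y) y).
  - rewrite Rabs_mult, (Rabs_pos_eq M), Rmult_assoc by lra. apply Rmult_le_compat_l; [lra |].
    apply A; [ct |]. intros z. rewrite Rabs_mult, (Rabs_pos_eq (/ M)) by lra.
    specialize (H z). apply Rle_trans with (/ M * (M * John_weight p q (fst z) (norm3 (snd z)))).
    + apply Rmult_le_compat_l; lra.
    + right. field. lra.
  - rewrite Duh_scal by auto. field. lra.
Qed.

Definition geometric_steps (T : R) (v : nat -> spacetime -> R) : Prop :=
  exists C rho, 0 <= C /\ 0 <= rho < 1 /\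
    forall n q, Rabs (fst q) <= T -> Rabs (v (S n) q - v n q) <= C * rho ^ n.

Definition bounded_steps (T : R) (v : nat -> spacetime -> R) : Prop :=
  exists A, 0 <= A /\ forall n q, Rabs (fst q) <= T -> Rabs (v n q) <= A.

Definition strip_bounded (w : spacetime -> R) : Prop :=
  forall T, exists A, 0 <= A /\ forall q, Rabs (fst q) <= T -> Rabs (w q) <= A.

Lemma exp_ge1 k t : 0 <= k -> 1 <= exp (k * Rabs t).
Proof.
  intros Hk. rewrite <- exp_0. assert (0 <= k * Rabs t) by (apply Rmult_le_pos; [auto | apply Rabs_pos]).
  destruct (Rle_lt_or_eq_dec _ _ H) as [H1 | <-]; [left; now apply exp_increasing | lra].
Qed.

Lemma exp_le_strip k t T : 0 <= k -> Rabs t <= T -> exp (k * Rabs t) <= exp (k * T).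
Proof.
  intros Hk Ht. assert (H : k * Rabs t <= k * T) by now apply Rmult_le_compat_l.
  destruct (Rle_lt_or_eq_dec _ _ H) as [H1 | ->]; [left; now apply exp_increasing | lra].
Qed.

(* In the norm weighted by [exp (- k |t|)], [Duh] is a contraction for large [k]. *)
Lemma Volterra_bounded_steps T (v w : nat -> spacetime -> R) (a : spacetime -> R) A K C :
  (forall n, cont (w n)) ->
  (forall n q, v (S n) q = a q + Duh (w n) q) ->
  0 <= K -> 0 <= C -> 0 <= A ->
  (forall q, Rabs (fst q) <= T -> Rabs (a q) <= A) ->
  (forall q, Rabs (fst q) <= T -> Rabs (v 0%nat q) <= A) ->
  (forall n q, Rabs (fst q) <= T -> Rabs (w n q) <= K * Rabs (v n q) + C) ->
  bounded_steps T v.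
Proof.
  intros Cw_ Hrec HK HC HA Ha Hv Hw.
  (* The choice of [k] gives [K / k^2 <= 1 / 2], and [D = 2 (A + C)] solves [A + D / 2 + C = D], so
     that the bound reproduces itself. *)
  pose (k := 2 * K + 1). pose (D := 2 * (A + C)).
  assert (Hk : 1 <= k) by (unfold k; lra).
  assert (HKk : K / (k * k) <= / 2).
  { apply Rle_div_l; [nra |]. unfold k. nra. }
  assert (HCk : C / (k * k) <= C).
  { apply Rle_div_l; [nra |]. assert (1 <= k * k) by nra. nra. }
  assert (HD : 0 <= D) by (unfold D; lra).
  assert (B : forall n q, Rabs (fst q) <= T -> Rabs (v n q) <= D * exp (k * Rabs (fst q))).
  { induction n as [| n IH]; intros q Hq; assert (He := exp_ge1 k (fst q) ltac:(lra)).
    - specialize (Hv q Hq). unfold D in *. nra.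
    - rewrite Hrec.
      assert (E := Duh_exp_bound (w n) k (K * D + C) T (Cw_ n) ltac:(lra) ltac:(nra)).
      assert (E' : Rabs (Duh (w n) q) <= (K * D + C) / (k * k) * exp (k * Rabs (fst q))).
      { apply E; auto. intros y Hy. specialize (IH y Hy). specialize (Hw n y Hy).
        assert (He' := exp_ge1 k (fst y) ltac:(lra)).
        assert (K * Rabs (v n y) <= K * (D * exp (k * Rabs (fst y)))) by now apply Rmult_le_compat_l.
        nra. }
      eapply Rle_trans; [apply Rabs_triang |]. specialize (Ha q Hq).
      assert ((K * D + C) / (k * k) <= D / 2 + C).
      { replace ((K * D + C) / (k * k)) with (K / (k * k) * D + C / (k * k)) by (field; lra). nra. }
      assert ((K * D + C) / (k * k) * exp (k * Rabs (fst q)) <= (D / 2 + C) * exp (k * Rabs (fst q))).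
      { apply Rmult_le_compat_r; lra. }
      unfold D in *. nra. }
  exists (D * exp (k * T)). split; [apply Rmult_le_pos; [auto | left; apply exp_pos] |].
  intros n q Hq. eapply Rle_trans; [now apply B |]. apply Rmult_le_compat_l; auto.
  apply exp_le_strip; lra.
Qed.

(** The term [C * rho ^ n] allows coefficients that change with [n], as they do for the derivatives
    of the iterates, provided that the changes are themselves geometric. *)
Lemma Volterra_geometric_steps T (v w : nat -> spacetime -> R) (a : spacetime -> R) A K C rho :
  (forall n, cont (w n)) ->
  (forall n q, v (S n) q = a q + Duh (w n) q) ->
  0 <= K -> 0 <= C -> 0 <= A -> 0 <= rho < 1 ->
  (forall q, Rabs (fst q) <= T -> Rabs (v 1%nat q - v 0%nat q) <= A) ->
  (forall n q, Rabs (fst q) <= T -> Rabs (w (S n) q - w n q) <=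
     K * Rabs (v (S n) q - v n q) + C * rho ^ n) ->
  geometric_steps T v.
Proof.
  intros Cw_ Hrec HK HC HA Hrho Hv Hw.
  (* One step multiplies the bound by at most [3 / 4]: with [D = A + 4 C], half of [D] plus [C] is
     at most [3 D / 4]. The ratio [r] must also dominate [rho]. *)
  pose (k := 2 * K + 1). pose (D := A + 4 * C). pose (r := Rmax rho (3 / 4)).
  assert (Hr : rho <= r /\ 3 / 4 <= r < 1).
  { unfold r. split; [apply Rmax_l |]. split; [apply Rmax_r |]. apply Rmax_lub_lt; lra. }
  assert (Hk : 1 <= k) by (unfold k; lra).
  assert (HKk : K / (k * k) <= / 2).
  { apply Rle_div_l; [nra |]. unfold k. nra. }
  assert (HCk : C / (k * k) <= C).
  { apply Rle_div_l; [nra |]. assert (1 <= k * k) by nra. nra. }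
  assert (HD : 0 <= D) by (unfold D; lra).
  assert (B : forall n q, Rabs (fst q) <= T ->
    Rabs (v (S n) q - v n q) <= D * r ^ n * exp (k * Rabs (fst q))).
  { induction n as [| n IH]; intros q Hq; assert (He := exp_ge1 k (fst q) ltac:(lra)).
    - specialize (Hv q Hq). unfold D in *. simpl. nra.
    - assert (Hrn : 0 < r ^ n) by (apply pow_lt; lra).
      rewrite (Hrec (S n)), (Hrec n).
      replace (a q + Duh (w (S n)) q - (a q + Duh (w n) q)) with (Duh (w (S n)) q - Duh (w n) q) by ring.
      rewrite <- Duh_minus by auto.
      assert (E' : Rabs (Duh (fun y => w (S n) y - w n y) q) <=
         (K * (D * r ^ n) + C * r ^ n) / (k * k) * exp (k * Rabs (fst q))).
      { apply (Duh_exp_bound _ k _ T); auto; try lra.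
        - pose proof (Cw_ n). pose proof (Cw_ (S n)). ct.
        - apply Rplus_le_le_0_compat; repeat apply Rmult_le_pos; lra.
        - intros y Hy. specialize (IH y Hy). specialize (Hw n y Hy).
          assert (He' := exp_ge1 k (fst y) ltac:(lra)).
          assert (K * Rabs (v (S n) y - v n y) <= K * (D * r ^ n * exp (k * Rabs (fst y)))) by now apply Rmult_le_compat_l.
          assert (Hp : rho ^ n <= r ^ n) by (apply pow_incr; lra).
          assert (C * rho ^ n <= C * r ^ n) by now apply Rmult_le_compat_l.
          assert (0 <= C * r ^ n) by (apply Rmult_le_pos; lra).
          nra. }
      eapply Rle_trans; [apply E' |]. apply Rmult_le_compat_r; [lra |].
      replace ((K * (D * r ^ n) + C * r ^ n) / (k * k)) with
        ((K / (k * k) * D + C / (k * k)) * r ^ n) by (field; lra).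
      simpl. rewrite <- Rmult_assoc. apply Rmult_le_compat_r; [lra |].
      assert (K / (k * k) * D <= / 2 * D) by now apply Rmult_le_compat_r.
      assert (D * (3 / 4) <= D * r) by (apply Rmult_le_compat_l; lra).
      unfold D in *. lra. }
  exists (D * exp (k * T)), r. repeat split; try lra.
  - apply Rmult_le_pos; [auto | left; apply exp_pos].
  - intros n q Hq. eapply Rle_trans; [now apply B |].
    replace (D * exp (k * T) * r ^ n) with (D * r ^ n * exp (k * T)) by ring.
    apply Rmult_le_compat_l; [apply Rmult_le_pos; auto; apply pow_le; lra |].
    apply exp_le_strip; lra.
Qed.

Lemma Rmax_ratio r r' : 0 <= r < 1 -> 0 <= r' < 1 ->
  r <= Rmax r r' /\ r' <= Rmax r r' /\ 0 <= Rmax r r' < 1.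
Proof.
  intros H H'. split; [apply Rmax_l |]. split; [apply Rmax_r |]. split.
  - apply Rle_trans with r; [lra | apply Rmax_l].
  - apply Rmax_lub_lt; lra.
Qed.

Lemma geometric_max T (v : nat -> spacetime -> R) C rho r : 0 <= C -> 0 <= rho <= r ->
  (forall n q, Rabs (fst q) <= T -> Rabs (v (S n) q - v n q) <= C * rho ^ n) ->
  forall n q, Rabs (fst q) <= T -> Rabs (v (S n) q - v n q) <= C * r ^ n.
Proof.
  intros HC Hr H n q Hq. eapply Rle_trans; [now apply H |].
  apply Rmult_le_compat_l; auto. apply pow_incr; lra.
Qed.

(** Boundedness is included because the difference of two products involves the factors themselves
    as well as their differences. *)
Definition controlled T v := geometric_steps T v /\ bounded_steps T v.

Lemma controlled_mult T v w : controlled T v -> controlled T w -> controlled T (fun n q => v n q * w n q).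
Proof.
  intros [(C & r & HC & Hr & Hv) (A & HA & Bv)] [(C' & r' & HC' & Hr' & Hw) (A' & HA' & Bw)].
  split.
  - pose (s := Rmax r r').
    assert (Hs := Rmax_ratio r r' ltac:(lra) ltac:(lra)). fold s in Hs.
    exists (C * A' + A * C'), s. repeat split; try lra.
    + apply Rplus_le_le_0_compat; now apply Rmult_le_pos.
    + intros n q Hq.
      assert (H1 := geometric_max T v C r s HC ltac:(lra) Hv n q Hq).
      assert (H2 := geometric_max T w C' r' s HC' ltac:(lra) Hw n q Hq).
      replace (v (S n) q * w (S n) q - v n q * w n q) with
        ((v (S n) q - v n q) * w (S n) q + v n q * (w (S n) q - w n q)) by ring.
      eapply Rle_trans; [apply Rabs_triang |]. rewrite !Rabs_mult.
      assert (Rabs (v (S n) q - v n q) * Rabs (w (S n) q) <= C * s ^ n * A').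
      { apply Rmult_le_compat; auto using Rabs_pos. }
      assert (Rabs (v n q) * Rabs (w (S n) q - w n q) <= A * (C' * s ^ n)).
      { apply Rmult_le_compat; auto using Rabs_pos. }
      lra.
  - exists (A * A'). split; [now apply Rmult_le_pos |]. intros n q Hq.
    rewrite Rabs_mult. apply Rmult_le_compat; auto using Rabs_pos.
Qed.

(** * Limits of sequences that converge geometrically on strips *)

Definition strip_cvg (v : nat -> spacetime -> R) (L : spacetime -> R) : Prop :=
  forall T, exists C rho, 0 <= C /\ 0 <= rho < 1 /\
    forall n q, Rabs (fst q) <= T -> Rabs (v n q - L q) <= C * rho ^ n.

Lemma geometric_tail (a : nat -> R) C rho : 0 <= C -> 0 <= rho < 1 ->
  (forall n, Rabs (a (S n) - a n) <= C * rho ^ n) ->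
  forall n m, Rabs (a (n + m)%nat - a n) <= C / (1 - rho) * rho ^ n.
Proof.
  intros HC Hr H n m.
  (* The factor [1 - rho ^ m] makes this the exact geometric sum, a form that passes through the
     induction. *)
  assert (B : Rabs (a (n + m)%nat - a n) <= C / (1 - rho) * rho ^ n * (1 - rho ^ m)).
  { induction m as [| m IH].
    - rewrite Nat.add_0_r. replace (a n - a n) with 0 by ring. rewrite Rabs_R0. simpl. lra.
    - replace (n + S m)%nat with (S (n + m)) by lia.
      replace (a (S (n + m)) - a n) with ((a (S (n + m)) - a (n + m)%nat) + (a (n + m)%nat - a n)) by ring.
      eapply Rle_trans; [apply Rabs_triang |]. specialize (H (n + m)%nat).
      rewrite pow_add in H.
      replace (C / (1 - rho) * rho ^ n * (1 - rho ^ S m)) with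
        (C * (rho ^ n * rho ^ m) + C / (1 - rho) * rho ^ n * (1 - rho ^ m)).
      + lra.
      + simpl. field. lra. }
  eapply Rle_trans; [apply B |].
  assert (0 <= rho ^ m) by (apply pow_le; lra).
  assert (0 <= rho ^ n) by (apply pow_le; lra).
  assert (0 <= C / (1 - rho)) by (apply Rdiv_le_0_compat; lra).
  assert (0 <= C / (1 - rho) * rho ^ n) by now apply Rmult_le_pos. nra.
Qed.

Lemma pow_small C rho eps : 0 <= C -> 0 <= rho < 1 -> 0 < eps -> exists n, C * rho ^ n < eps.
Proof.
  intros HC Hr He.
  destruct (pow_lt_1_zero rho ltac:(rewrite Rabs_pos_eq; lra) (eps / (C + 1))) as [n Hn].
  - apply Rdiv_lt_0_compat; lra.
  - exists n. specialize (Hn n (le_n n)). rewrite Rabs_pos_eq in Hn by (apply pow_le; lra).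
    apply Rlt_div_r in Hn; [| lra].
    assert (0 <= rho ^ n) by (apply pow_le; lra). nra.
Qed.

Definition pointwise_limit (v : nat -> spacetime -> R) (q : spacetime) : R :=
  real (Lim_seq (fun n => v n q)).

Lemma strip_cvg_pointwise_limit v : (forall T, geometric_steps T v) -> strip_cvg v (pointwise_limit v).
Proof.
  intros H T. destruct (H T) as (C & rho & HC & Hr & Hv).
  exists (C / (1 - rho)), rho. split; [apply Rdiv_le_0_compat; lra |]. split; auto.
  intros n q Hq.
  pose (a := fun n => v n q).
  assert (Ht := geometric_tail a C rho HC Hr (fun n => Hv n q Hq)).
  assert (Hc : ex_finite_lim_seq a).
  { apply ex_lim_seq_cauchy_corr. intros eps.
    assert (HC' : 0 <= 2 * (C / (1 - rho))).
    { apply Rmult_le_pos; [lra |]. apply Rdiv_le_0_compat; lra. }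
    destruct (pow_small _ rho eps HC' Hr (cond_pos eps)) as [N HN].
    exists N. intros i j Hi Hj.
    assert (H1 := Ht N (i - N)%nat). assert (H2 := Ht N (j - N)%nat).
    replace (N + (i - N))%nat with i in H1 by lia.
    replace (N + (j - N))%nat with j in H2 by lia.
    replace (a i - a j) with ((a i - a N) - (a j - a N)) by ring.
    eapply Rle_lt_trans; [apply Rabs_triang |]. rewrite Rabs_Ropp. lra. }
  destruct Hc as [l Hl].
  assert (E : pointwise_limit v q = l) by (unfold pointwise_limit; change (real (Lim_seq a) = l); now rewrite (is_lim_seq_unique _ _ Hl)).
  rewrite E. rewrite Rabs_minus_sym.
  assert (Hl2 : is_lim_seq (fun m => Rabs (a (m + n)%nat - a n)) (Rabs (l - a n))).
  { apply (is_lim_seq_abs _ (l - a n)). apply is_lim_seq_minus'.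
    - now apply is_lim_seq_incr_n.
    - apply is_lim_seq_const. }
  apply (is_lim_seq_le (fun m => Rabs (a (m + n)%nat - a n)) (fun _ => C / (1 - rho) * rho ^ n)
    (Rabs (l - a n)) (C / (1 - rho) * rho ^ n)); auto.
  - intros m. rewrite Nat.add_comm. apply Ht.
  - apply is_lim_seq_const.
Qed.

Lemma strip_cvg_cont v L : (forall n, cont (v n)) -> strip_cvg v L -> cont L.
Proof.
  intros Cv H. cut (forall q : spacetime, continuous L q); [intros X; exact X |].
  intros q. apply filterlim_locally. intros eps.
  (* A wider strip, so that it contains a whole neighbourhood of [q]. *)
  destruct (H (Rabs (fst q) + 1)) as (C & rho & HC & Hr & Hv).
  assert (He : 0 < eps / 3) by (pose proof (cond_pos eps); lra).
  destruct (pow_small C rho (eps / 3) HC Hr He) as [n Hn].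
  assert (L1 := proj1 (filterlim_locally _ _) (Cv n q) (mkposreal _ He)).
  assert (L2 : locally q (fun y => Rabs (fst y) <= Rabs (fst q) + 1)).
  { exists (mkposreal 1 Rlt_0_1). intros y [Hy _]. change (Rabs (fst y - fst q) < 1) in Hy.
    replace (fst y) with ((fst y - fst q) + fst q) by ring.
    eapply Rle_trans; [apply Rabs_triang | lra]. }
  generalize (filter_and _ _ L1 L2). apply filter_imp. intros y [Hy1 Hy2].
  change (Rabs (v n y - v n q) < eps / 3) in Hy1. change (Rabs (L y - L q) < eps).
  assert (H1 := Hv n y Hy2).
  assert (H2 := Hv n q ltac:(pose proof (Rabs_pos (fst q)); lra)).
  replace (L y - L q) with (- (v n y - L y) + ((v n y - v n q) + (v n q - L q))) by ring.
  eapply Rle_lt_trans; [apply Rabs_triang |]. rewrite Rabs_Ropp.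
  eapply Rle_lt_trans; [apply Rplus_le_compat_l, Rabs_triang |]. lra.
Qed.

Lemma eq_0_of_geometric_bound x C rho : 0 <= C -> 0 <= rho < 1 ->
  (forall n, Rabs x <= C * rho ^ n) -> x = 0.
Proof.
  intros HC Hr H. destruct (Req_dec x 0) as [E | E]; auto.
  destruct (pow_small C rho (Rabs x) HC Hr (Rabs_pos_lt _ E)) as [n Hn].
  specialize (H n). lra.
Qed.

Lemma Rabs_RInt_0_le (f : R -> R) h M : cont f -> (forall s, Rabs (f s) <= M) ->
  Rabs (RInt f 0 h) <= Rabs h * M.
Proof.
  intros Hf HM. destruct (Rle_dec 0 h) as [Hh | Hh].
  - rewrite (Rabs_pos_eq h) by auto. replace (h * M) with (RInt (fun _ => M) 0 h).
    + apply Rabs_RInt_le; auto. ct.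
    + rewrite RInt_constR. rring.
  - assert (E : RInt f 0 h = - RInt f h 0).
    { symmetry. apply (opp_RInt_swap f). now apply ex_RInt_cont. }
    rewrite E, Rabs_Ropp, (Rabs_left h) by lra. replace (- h * M) with (RInt (fun _ => M) h 0).
    + apply Rabs_RInt_le; auto. lra. ct.
    + rewrite RInt_constR. rring.
Qed.

Lemma fst_plus_dx (q : spacetime) h e : fst (plus q (scal h (dx e)) : spacetime) = fst q.
Proof. destruct q as [t x]. change (t + h * 0 = t). ring. Qed.

(** Pass to the limit in the integrated identity: the increment of [v n] over a step [h] is the
    integral of [v' n]. A line in a space direction keeps [t] fixed, so uniform convergence on one
    strip suffices; the integral identity for [L] is then differentiated. *)
Lemma strip_cvg_Dir e v v' L L' : (forall n, cont (v' n)) -> (forall n, Dir (dx e) (v n) (v' n)) ->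
  strip_cvg v L -> strip_cvg v' L' -> Dir (dx e) L L'.
Proof.
  intros Cv' D Hv Hv' q.
  assert (CL' : cont L') by (apply (strip_cvg_cont v'); auto).
  assert (E : forall h : R, L (plus q (scal h (dx e))) =
     L q + RInt (fun s : R => L' (plus q (scal s (dx e)))) 0 h).
  { intros h.
    destruct (Hv (Rabs (fst q))) as (C & rho & HC & Hr & H1).
    destruct (Hv' (Rabs (fst q))) as (C' & rho' & HC' & Hr' & H2).
    apply Rminus_diag_uniq.
    pose (s := Rmax rho rho').
    assert (Hs := Rmax_ratio rho rho' ltac:(lra) ltac:(lra)). fold s in Hs.
    apply (eq_0_of_geometric_bound _ (2 * C + Rabs h * C') s).
    - pose proof (Rmult_le_pos _ _ (Rabs_pos h) HC'). lra.
    - lra.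
    - intros n.
      assert (C1 : cont (fun k : R => v' n (plus q (scal k (dx e))))).
      { pose proof (Cv' n). ct. }
      assert (C2 : cont (fun k : R => L' (plus q (scal k (dx e))))) by ct.
      assert (EF : RInt (fun k : R => v' n (plus q (scal k (dx e)))) 0 h =
        v n (plus q (scal h (dx e))) - v n (plus q (scal 0 (dx e)))).
      { apply (RInt_FTC (fun k : R => v n (plus q (scal k (dx e))))); auto.
        intros k. exact (Dir_line (dx e) (v n) (v' n) (D n) q k). }
      assert (E0 : (plus q (scal 0 (dx e)) : spacetime) = q).
      { exact (plus_scal_0 q (dx e)). }
      rewrite E0 in EF.
      assert (B1 : Rabs (RInt (fun k : R => v' n (plus q (scal k (dx e))) - L' (plus q (scal k (dx e)))) 0 h)
         <= Rabs h * (C' * rho' ^ n)).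
      { apply Rabs_RInt_0_le; [ct |]. intros k. apply H2. rewrite fst_plus_dx. apply Rle_refl. }
      rewrite RIntB, EF in B1 by auto.
      assert (B2 := H1 n q (Rle_refl _)).
      assert (B3 := H1 n (plus q (scal h (dx e))) ltac:(rewrite fst_plus_dx; apply Rle_refl)).
      set (I := RInt (fun k : R => L' (plus q (scal k (dx e)))) 0 h) in *.
      set (qh := plus q (scal h (dx e)) : spacetime) in *.
      replace (L qh - (L q + I)) with ((v n qh - v n q - I) + ((v n q - L q) + - (v n qh - L qh))) by ring.
      eapply Rle_trans; [apply Rabs_triang |].
      eapply Rle_trans; [apply Rplus_le_compat_l, Rabs_triang |]. rewrite Rabs_Ropp.
      assert (P1 : C * rho ^ n <= C * s ^ n) by (apply Rmult_le_compat_l; auto; apply pow_incr; lra).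
      assert (P2 : C' * rho' ^ n <= C' * s ^ n) by (apply Rmult_le_compat_l; auto; apply pow_incr; lra).
      assert (P3 := Rmult_le_compat_l _ _ _ (Rabs_pos h) P2). lra. }
  apply (is_derive_ext (fun h : R => L q + RInt (fun s : R => L' (plus q (scal s (dx e)))) 0 h)).
  { intros h. symmetry. apply E. }
  eapply is_derive_eq.
  - apply is_derive_plusR; [apply (is_derive_const (L q)) |].
    apply (is_derive_prim (fun s : R => L' (plus q (scal s (dx e))))). ct.
  - exact (eq_trans (Rplus_0_l _) (f_equal L' (plus_scal_0 q (dx e)))).
Qed.

Lemma strip_cvg_Duh w W : (forall n, cont (w n)) -> strip_cvg w W -> strip_cvg (fun n => Duh (w n)) (Duh W).
Proof.
  intros Cw_ H T. assert (CW : cont W) by now apply (strip_cvg_cont w).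
  destruct (H T) as (C & rho & HC & Hr & Hv).
  exists (C * exp (1 * T)), rho. split; [apply Rmult_le_pos; [auto | left; apply exp_pos] |].
  split; auto. intros n q Hq. rewrite <- Duh_minus by auto.
  assert (Hp : 0 <= rho ^ n) by (apply pow_le; lra).
  assert (A := Duh_exp_bound (fun y => w n y - W y) 1 (C * rho ^ n) T).
  eapply Rle_trans.
  - apply A; auto; try lra.
    + pose proof (Cw_ n). ct.
    + now apply Rmult_le_pos.
    + intros y Hy. eapply Rle_trans; [now apply Hv |].
      assert (He := exp_ge1 1 (fst y) ltac:(lra)).
      assert (0 <= C * rho ^ n) by now apply Rmult_le_pos. nra.
  - replace (C * rho ^ n / (1 * 1)) with (C * rho ^ n) by field.
    replace (C * exp (1 * T) * rho ^ n) with (C * rho ^ n * exp (1 * T)) by ring.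
    apply Rmult_le_compat_l; [now apply Rmult_le_pos |]. apply exp_le_strip; lra.
Qed.

(** * The fixed point and its derivatives *)

Lemma Dir_comp {V : NormedModule R_AbsRing} (e : V) (f f' : R -> R) (u v : V -> R) :
  (forall x, is_derive f x (f' x)) -> Dir e u v ->
  Dir e (fun q => f (u q)) (fun q => f' (u q) * v q).
Proof.
  intros Hf H q. eapply is_derive_eq.
  - apply (is_derive_compR f (fun h : R => u (plus q (scal h e)))); [apply Hf | apply H].
  - exact (eq_trans (f_equal (fun z => v q * f' (u z)) (plus_scal_0 q e)) (Rmult_comm _ _)).
Qed.

Lemma Dir_mult {V : NormedModule R_AbsRing} (e : V) (u v u' v' : V -> R) :
  Dir e u u' -> Dir e v v' ->
  Dir e (fun q => u q * v q) (fun q => u' q * v q + u q * v' q).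
Proof.
  intros Hu Hv q. eapply is_derive_eq.
  - apply is_derive_multR; [apply Hu | apply Hv].
  - exact (f_equal (fun z => u' q * v z + u z * v' q) (plus_scal_0 q e)).
Qed.

Lemma Dir_ext {V : NormedModule R_AbsRing} (e : V) (u v v' : V -> R) :
  (forall q, v q = v' q) -> Dir e u v -> Dir e u v'.
Proof. intros E H q. rewrite <- E. apply H. Qed.

Lemma sgrad_ext (w : spacetime -> R) v v' : (forall i q, v i q = v' i q) -> sgrad w v -> sgrad w v'.
Proof.
  intros E [C H]. split; auto. intros i. destruct (H i) as [C' D]. split.
  - apply (cont_ext (v i)); auto.
  - apply (Dir_ext _ _ (v i)); auto.
Qed.

Lemma sgrad_plus u u' v v' : sgrad u u' -> sgrad v v' ->
  sgrad (fun q => u q + v q) (fun i q => u' i q + v' i q).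
Proof.
  intros [Cu Hu] [Cv Hv]. split; [ct |]. intros i. destruct (Hu i), (Hv i).
  split; [ct | now apply Dir_plus].
Qed.

Lemma sgrad_mult u u' v v' : sgrad u u' -> sgrad v v' ->
  sgrad (fun q => u q * v q) (fun i q => u' i q * v q + u q * v' i q).
Proof.
  intros [Cu Hu] [Cv Hv]. split; [ct |]. intros i. destruct (Hu i), (Hv i).
  split; [ct | now apply Dir_mult].
Qed.

Lemma sgrad_scal c u u' : sgrad u u' -> sgrad (fun q => c * u q) (fun i q => c * u' i q).
Proof.
  intros [Cu Hu]. split; [ct |]. intros i. destruct (Hu i). split; [ct | now apply Dir_scal].
Qed.

Lemma sgrad_comp (f f' : R -> R) u u' : (forall x, is_derive f x (f' x)) -> cont f' -> sgrad u u' ->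
  sgrad (fun q => f (u q)) (fun i q => f' (u q) * u' i q).
Proof.
  intros Hf Cf' [Cu Hu]. assert (Cf : cont f) by apply (cont_of_derive _ _ Hf).
  split; [ct |]. intros i. destruct (Hu i). split; [ct | now apply Dir_comp].
Qed.

Lemma sgrad2_plus u u' u'' v v' v'' : sgrad2 u u' u'' -> sgrad2 v v' v'' ->
  sgrad2 (fun q => u q + v q) (fun i q => u' i q + v' i q) (fun i j q => u'' i j q + v'' i j q).
Proof. intros [H1 H2] [H3 H4]. split; [now apply sgrad_plus | intros i; now apply sgrad_plus]. Qed.

Lemma sgrad2_scal c u u' u'' : sgrad2 u u' u'' ->
  sgrad2 (fun q => c * u q) (fun i q => c * u' i q) (fun i j q => c * u'' i j q).
Proof. intros [H1 H2]. split; [now apply sgrad_scal | intros i; now apply sgrad_scal]. Qed.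

Lemma sgrad2_Duh u u' u'' : sgrad2 u u' u'' ->
  sgrad2 (Duh u) (fun i => Duh (u' i)) (fun i j => Duh (u'' i j)).
Proof. intros [H1 H2]. split; [now apply sgrad_Duh | intros i; now apply sgrad_Duh]. Qed.

Lemma sgrad2_F p u u' u'' : 2 < p <= 3 -> sgrad2 u u' u'' ->
  sgrad2 (fun q => abs_pow (u q) p) (fun i q => F1 p (u q) * u' i q)
    (fun i j q => F1 p (u q) * u'' i j q + F2 p (u q) * (u' j q * u' i q)).
Proof.
  intros Hp [H1 H2]. split.
  - apply (sgrad_comp (fun y => abs_pow y p)); auto.
    + intros; now apply is_derive_F.
    + now apply cont_F1.
  - intros i. apply (sgrad_ext _ (fun j q => F2 p (u q) * u' j q * u' i q + F1 p (u q) * u'' i j q)).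
    + intros; ring.
    + apply (sgrad_mult (fun q => F1 p (u q)) (fun j q => F2 p (u q) * u' j q)); auto.
      apply sgrad_comp; auto.
      * intros; now apply is_derive_F1.
      * now apply cont_F2.
Qed.

Fixpoint iterate (p : R) (U : spacetime -> R) (n : nat) : spacetime -> R :=
  match n with
  | O => U
  | S m => fun q => U q + Duh (fun y => abs_pow (iterate p U m y) p) q
  end.

(** The differentiated recursion, affine in [iterate_d1] itself with coefficient [F1] of the
    iterate. The second derivatives below obey a recursion with the same coefficient and an
    inhomogeneity quadratic in the first derivatives. *)
Fixpoint iterate_d1 p U (U' : axis -> spacetime -> R) (n : nat) (i : axis) : spacetime -> R :=
  match n with
  | O => U' i
  | S m => fun q => U' i q + Duh (fun y => F1 p (iterate p U m y) * iterate_d1 p U U' m i y) q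
  end.

Fixpoint iterate_d2 p U U' (U'' : axis -> axis -> spacetime -> R) (n : nat) (i j : axis) : spacetime -> R :=
  match n with
  | O => U'' i j
  | S m => fun q => U'' i j q + Duh (fun y => F1 p (iterate p U m y) * iterate_d2 p U U' U'' m i j y +
      F2 p (iterate p U m y) * (iterate_d1 p U U' m j y * iterate_d1 p U U' m i y)) q
  end.

Lemma iterate_sgrad2 p U U' U'' n : 2 < p <= 3 -> sgrad2 U U' U'' ->
  sgrad2 (iterate p U n) (iterate_d1 p U U' n) (iterate_d2 p U U' U'' n).
Proof.
  intros Hp H. induction n as [| n IH]; [exact H |]. simpl.
  apply (sgrad2_plus U U' U'' (Duh (fun y => abs_pow (iterate p U n y) p))); auto.
  apply (sgrad2_Duh (fun y => abs_pow (iterate p U n y) p)). now apply sgrad2_F.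
Qed.

(** Half of [N] is reserved for the linear part. The other half covers the Duhamel term, which is at
    most [John_const * N] times [N * Phi]. *)
Lemma iterate_bound p U N : 2 < p <= 3 -> 1 < p * (p - 2) -> cont U -> 0 < N <= 1 ->
  John_const p (p * (p - 2)) * N <= / 2 ->
  (forall q, Rabs (U q) <= N / 2 * Phi p q) ->
  forall n, cont (iterate p U n) /\ forall q, Rabs (iterate p U n q) <= N * Phi p q.
Proof.
  intros Hp Hq CU HN HC HU. pose proof (cont_F p Hp) as CF.
  induction n as [| n [IHc IH]]; simpl.
  - split; auto. intros q. specialize (HU q). pose proof (Phi_pos p q). nra.
  - assert (C : cont (fun y => abs_pow (iterate p U n y) p)).
    { apply (cont_comp (fun y => abs_pow y p)); auto. }
    split; [apply cont_plus; [exact CU | apply cont_Duh, C] |]. intros q.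
    assert (A := John_estimate_scaled p (p * (p - 2)) _ (N * N) ltac:(lra) Hq C ltac:(nra)
      (fun y => F_weighted p _ N y ltac:(lra) HN (IH y)) q).
    eapply Rle_trans; [apply Rabs_triang |]. specialize (HU q).
    pose proof (Phi_pos p q).
    replace (N * N * John_const p (p * (p - 2)) * Phi p q) with
      (John_const p (p * (p - 2)) * N * (N * Phi p q)) in A by ring.
    assert (0 < N * Phi p q) by (apply Rmult_lt_0_compat; lra).
    assert (A' : John_const p (p * (p - 2)) * N * (N * Phi p q) <= / 2 * (N * Phi p q)) by (apply Rmult_le_compat_r; lra).
    apply Rle_trans with (N / 2 * Phi p q + / 2 * (N * Phi p q)); [| lra].
    apply Rplus_le_compat; [exact HU | exact (Rle_trans _ _ _ A A')].
Qed.

Lemma F1_controlled p T u : 2 < p <= 3 -> (forall n q, Rabs (u n q) <= 1) -> geometric_steps T u ->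
  controlled T (fun n q => F1 p (u n q)).
Proof.
  intros Hp Hu (C & r & HC & Hr & H). split.
  - exists (6 * C), r. repeat split; try lra. intros n q Hq.
    eapply Rle_trans; [apply F1_Lip; auto |]. specialize (H n q Hq). lra.
  - exists 3. split; [lra |]. intros; now apply F1_bound.
Qed.

(** [F2] is only Hoelder of order [p - 2], so steps of size [C r^n] become steps of size a multiple
    of [(r^(p - 2))^n], still geometric with ratio below 1. *)
Lemma F2_controlled p T u : 2 < p <= 3 -> (forall n q, Rabs (u n q) <= 1) -> geometric_steps T u ->
  controlled T (fun n q => F2 p (u n q)).
Proof.
  intros Hp Hu (C & r & HC & Hr & H). split.
  - exists (6 * abs_pow C (p - 2)), (abs_pow r (p - 2)).
    pose proof (abs_pow_ge0 C (p - 2)). pose proof (abs_pow_ge0 r (p - 2)).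
    repeat split; try lra.
    + apply abs_pow_lt1; [lra |]. rewrite Rabs_pos_eq; lra.
    + intros n q Hq. eapply Rle_trans; [now apply F2_Holder |].
      rewrite Rmult_assoc. apply Rmult_le_compat_l; [lra |].
      rewrite <- abs_pow_pow, <- abs_pow_mult. apply abs_pow_le; [lra |].
      eapply Rle_trans; [now apply H | apply Rle_abs].
  - exists 6. split; [lra |]. intros; now apply F2_bound.
Qed.

(** Boundedness has to come first: the difference of consecutive sources contains
    [(b (S n) - b n) * v n], which is geometrically small only once [v n] is known to be bounded. *)
Lemma affine_controlled T (v b c : nat -> spacetime -> R) a :
  (forall n, cont (v n)) -> (forall n, cont (b n)) -> (forall n, cont (c n)) ->
  (forall n q, v (S n) q = a q + Duh (fun y => b n y * v n y + c n y) q) ->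
  v 0%nat = a -> strip_bounded a -> controlled T b -> controlled T c -> controlled T v.
Proof.
  intros Cv Cb Cc Hrec H0 Ha Hb Hc.
  destruct (Ha T) as (A & HA & BA).
  destruct Hb as [Gb Bb]. destruct Hc as [Gc Bc].
  destruct (Bb) as (K & HK & BK). destruct (Bc) as (C & HC & BC).
  assert (Cw_ : forall n, cont (fun y => b n y * v n y + c n y)) by (intros n; ct).
  assert (Bv : bounded_steps T v).
  { apply (Volterra_bounded_steps T v (fun n y => b n y * v n y + c n y) a A K C); auto.
    - rewrite H0. exact BA.
    - intros n q Hq. eapply Rle_trans; [apply Rabs_triang |]. rewrite Rabs_mult.
      apply Rplus_le_compat; auto. apply Rmult_le_compat_r; auto using Rabs_pos. }
  split; auto. destruct (Bv) as (V & HV & BV).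
  destruct Gb as (C1 & r1 & HC1 & Hr1 & G1). destruct Gc as (C2 & r2 & HC2 & Hr2 & G2).
  pose (s := Rmax r1 r2).
  assert (Hs := Rmax_ratio r1 r2 ltac:(lra) ltac:(lra)). fold s in Hs.
  apply (Volterra_geometric_steps T v (fun n y => b n y * v n y + c n y) a (V + V) K (C1 * V + C2) s); auto; try lra.
  - apply Rplus_le_le_0_compat; auto. now apply Rmult_le_pos.
  - intros q Hq. eapply Rle_trans; [apply Rabs_triang |]. rewrite Rabs_Ropp.
    apply Rplus_le_compat; auto.
  - intros n q Hq.
    assert (H1 := geometric_max T b C1 r1 s HC1 ltac:(lra) G1 n q Hq).
    assert (H2 := geometric_max T c C2 r2 s HC2 ltac:(lra) G2 n q Hq).
    replace (b (S n) q * v (S n) q + c (S n) q - (b n q * v n q + c n q)) with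
      (b (S n) q * (v (S n) q - v n q) + ((b (S n) q - b n q) * v n q + (c (S n) q - c n q))) by ring.
    eapply Rle_trans; [apply Rabs_triang |].
    eapply Rle_trans; [apply Rplus_le_compat_l, Rabs_triang |].
    rewrite !Rabs_mult.
    assert (Rabs (b (S n) q) * Rabs (v (S n) q - v n q) <= K * Rabs (v (S n) q - v n q)).
    { apply Rmult_le_compat_r; auto using Rabs_pos. }
    assert (Rabs (b (S n) q - b n q) * Rabs (v n q) <= C1 * s ^ n * V).
    { apply Rmult_le_compat; auto using Rabs_pos. }
    lra.
Qed.

(** Convergence climbs one order at a time: the steps of the iterates are geometric, hence [F1] and
    [F2] along them are controlled, hence the first derivatives, and finally the second, whose
    inhomogeneity is a product of controlled sequences. *)
Lemma fixed_point p U U' U'' N : 2 < p <= 3 -> 1 < p * (p - 2) -> sgrad2 U U' U'' ->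
  (forall i, strip_bounded (U' i)) -> (forall i j, strip_bounded (U'' i j)) -> 0 < N <= 1 ->
  John_const p (p * (p - 2)) * N <= / 2 ->
  (forall q, Rabs (U q) <= N / 2 * Phi p q) ->
  exists phi phi' phi'', sgrad2 phi phi' phi'' /\
    forall q, phi q = U q + Duh (fun y => abs_pow (phi y) p) q.
Proof.
  intros Hp Hq HU SB1 SB2 HN HC Hdec.
  assert (CU : cont U) by exact (proj1 (proj1 HU)).
  assert (G := fun n => iterate_sgrad2 p U U' U'' n Hp HU).
  assert (Cu : forall n, cont (iterate p U n)) by (intros n; exact (proj1 (proj1 (G n)))).
  assert (Cu' : forall n i, cont (iterate_d1 p U U' n i)) by (intros n i; exact (proj1 (proj2 (proj1 (G n)) i))).
  assert (Cu'' : forall n i j, cont (iterate_d2 p U U' U'' n i j)).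
  { intros n i j. exact (proj1 (proj2 (proj2 (G n) i) j)). }
  pose proof (cont_F p Hp) as CF. pose proof (cont_F1 p Hp) as CF1. pose proof (cont_F2 p Hp) as CF2.
  assert (B1 : forall n q, Rabs (iterate p U n q) <= 1).
  { intros n q. destruct (iterate_bound p U N Hp Hq CU HN HC Hdec n) as [_ H]. specialize (H q).
    pose proof (Phi_le1 p q ltac:(lra)). pose proof (Phi_pos p q). nra. }
  assert (CFu : forall n, cont (fun y => abs_pow (iterate p U n y) p)).
  { intros n. apply (cont_comp (fun y => abs_pow y p)); auto. }
  assert (CF1u : forall n, cont (fun y => F1 p (iterate p U n y))) by (intros n; apply (cont_comp (F1 p)); auto).
  assert (CF2u : forall n, cont (fun y => F2 p (iterate p U n y))) by (intros n; apply (cont_comp (F2 p)); auto).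
  assert (g0 : forall T, geometric_steps T (iterate p U)).
  { intros T. apply (Volterra_geometric_steps T _ (fun n y => abs_pow (iterate p U n y) p) U 2 3 0 0); auto; try lra.
    - intros q _. eapply Rle_trans; [apply Rabs_triang |]. rewrite Rabs_Ropp.
      assert (H1 := B1 1%nat q). assert (H2 := B1 0%nat q). lra.
    - intros n q _. rewrite Rmult_0_l, Rplus_0_r. apply F_Lip; auto. }
  assert (g1 : forall T i, controlled T (fun n => iterate_d1 p U U' n i)).
  { intros T i. refine (affine_controlled T (fun n => iterate_d1 p U U' n i) (fun n y => F1 p (iterate p U n y))
      (fun _ _ => 0) (U' i) (fun n => Cu' n i) CF1u (fun _ => cont_const 0) _ eq_refl (SB1 i)
      (F1_controlled p T _ Hp B1 (g0 T)) _).
    - intros n q. apply (f_equal (Rplus (U' i q))). apply Ret_ext. intros. cbv beta. now rewrite Rplus_0_r.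
    - split.
      + exists 0, 0. repeat split; try lra. intros. rewrite Rminus_0_r, Rabs_R0. lra.
      + exists 0. split; [lra |]. intros. rewrite Rabs_R0. lra. }
  assert (g2 : forall T i j, controlled T (fun n => iterate_d2 p U U' U'' n i j)).
  { intros T i j. refine (affine_controlled T (fun n => iterate_d2 p U U' U'' n i j) (fun n y => F1 p (iterate p U n y))
      (fun n y => F2 p (iterate p U n y) * (iterate_d1 p U U' n j y * iterate_d1 p U U' n i y)) (U'' i j)
      (fun n => Cu'' n i j) CF1u _ (fun _ _ => eq_refl) eq_refl (SB2 i j)
      (F1_controlled p T _ Hp B1 (g0 T)) _).
    - intros n. apply cont_mult; [apply CF2u |]. apply cont_mult; apply Cu'.
    - apply (controlled_mult T (fun n y => F2 p (iterate p U n y)) (fun n y => iterate_d1 p U U' n j y * iterate_d1 p U U' n i y)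
        (F2_controlled p T _ Hp B1 (g0 T))).
      exact (controlled_mult T (fun n => iterate_d1 p U U' n j) (fun n => iterate_d1 p U U' n i) (g1 T j) (g1 T i)). }
  assert (V0 : strip_cvg (iterate p U) (pointwise_limit (iterate p U))) by now apply strip_cvg_pointwise_limit.
  assert (V1 : forall i, strip_cvg (fun n => iterate_d1 p U U' n i) (pointwise_limit (fun n => iterate_d1 p U U' n i))).
  { intros i. apply strip_cvg_pointwise_limit. intros T. apply g1. }
  assert (V2 : forall i j, strip_cvg (fun n => iterate_d2 p U U' U'' n i j) (pointwise_limit (fun n => iterate_d2 p U U' U'' n i j))).
  { intros i j. apply strip_cvg_pointwise_limit. intros T. apply g2. }
  set (phi := pointwise_limit (iterate p U)) in *.
  exists phi, (fun i => pointwise_limit (fun n => iterate_d1 p U U' n i)), (fun i j => pointwise_limit (fun n => iterate_d2 p U U' U'' n i j)).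
  assert (Cphi : cont phi) by (apply (strip_cvg_cont (iterate p U)); auto).
  split; [split; [split; [exact Cphi |] |] |].
  - intros i. split.
    + apply (strip_cvg_cont (fun n => iterate_d1 p U U' n i)); auto.
    + apply (strip_cvg_Dir _ (iterate p U) (fun n => iterate_d1 p U U' n i)); auto.
      intros n. exact (proj2 (proj2 (proj1 (G n)) i)).
  - intros i. split.
    + apply (strip_cvg_cont (fun n => iterate_d1 p U U' n i)); auto.
    + intros j. split.
      * apply (strip_cvg_cont (fun n => iterate_d2 p U U' U'' n i j)); auto.
      * apply (strip_cvg_Dir _ (fun n => iterate_d1 p U U' n i) (fun n => iterate_d2 p U U' U'' n i j)); auto.
        intros n. exact (proj2 (proj2 (proj2 (G n) i) j)).
  (* The bound by 1 passes to the limit; it is needed because [F_Lip] compares values in [[-1, 1]]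
     only. *)
  - assert (Bphi : forall q, Rabs (phi q) <= 1).
    { intros q. apply Rle_plus_epsilon. intros eps He.
      destruct (V0 (Rabs (fst q))) as (C & r & HC' & Hr & H).
      destruct (pow_small C r eps HC' Hr He) as [n Hn].
      specialize (H n q (Rle_refl _)). specialize (B1 n q).
      replace (phi q) with (iterate p U n q - (iterate p U n q - phi q)) by ring.
      eapply Rle_trans; [apply Rabs_triang |]. rewrite Rabs_Ropp. lra. }
    assert (VF : strip_cvg (fun n y => abs_pow (iterate p U n y) p) (fun y => abs_pow (phi y) p)).
    { intros T. destruct (V0 T) as (C & r & HC' & Hr & H). exists (3 * C), r.
      repeat split; try lra. intros n q Hq'.
      eapply Rle_trans; [now apply F_Lip |]. specialize (H n q Hq'). lra. }
    apply strip_cvg_Duh in VF; auto.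
    (* The recursion expresses iterate [S n] through iterate [n], so the defect of the fixed-point
       equation is below a geometric sequence for every [n], hence 0. *)
    intros q. apply Rminus_diag_uniq.
    destruct (V0 (Rabs (fst q))) as (C & r & HC' & Hr & H).
    destruct (VF (Rabs (fst q))) as (C1 & r1 & HC1 & Hr1 & H1).
    pose (s := Rmax r r1).
    assert (Hs := Rmax_ratio r r1 ltac:(lra) ltac:(lra)). fold s in Hs.
    apply (eq_0_of_geometric_bound _ (C + C1) s); try lra.
    intros n. specialize (H (S n) q (Rle_refl _)). specialize (H1 n q (Rle_refl _)).
    simpl iterate in H.
    set (D := Duh (fun y => abs_pow (phi y) p) q) in *.
    set (Dn := Duh (fun y => abs_pow (iterate p U n y) p) q) in *.
    replace (phi q - (U q + D)) with (- (U q + Dn - phi q) + (Dn - D)) by ring.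
    eapply Rle_trans; [apply Rabs_triang |]. rewrite Rabs_Ropp.
    assert (P0 : r ^ S n <= r ^ n).
    { simpl. assert (0 <= r ^ n) by (apply pow_le; lra). nra. }
    assert (P1 : r ^ n <= s ^ n) by (apply pow_incr; lra).
    assert (P2 : r1 ^ n <= s ^ n) by (apply pow_incr; lra).
    assert (C * r ^ S n <= C * s ^ n) by (apply Rmult_le_compat_l; lra).
    assert (C1 * r1 ^ n <= C1 * s ^ n) by (apply Rmult_le_compat_l; lra).
    lra.
Qed.

(** * The linear part *)

Lemma norm3_components a b c : Rabs a <= norm3 (a, b, c) /\ Rabs b <= norm3 (a, b, c) /\ Rabs c <= norm3 (a, b, c).
Proof.
  unfold norm3. rewrite norm_R3.
  rewrite <- (sqrt_Rsqr_abs a), <- (sqrt_Rsqr_abs b), <- (sqrt_Rsqr_abs c).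
  unfold Rsqr. repeat split; apply sqrt_le_1_alt; nra.
Qed.

Lemma bump_out f a b c : bump f -> 1 < Rabs a \/ 1 < Rabs b \/ 1 < Rabs c -> f (a, b, c) = 0.
Proof.
  intros [_ H] Hc. apply H. change (1 < norm3 (a, b, c)).
  destruct (norm3_components a b c) as (H1 & H2 & H3). lra.
Qed.

(** Integrate [f'] from -2, a point where [f] is known to vanish; at the endpoint -1 the hypothesis
    would say nothing. *)
Lemma compact_support_bound (f f' : R -> R) x : (forall x, is_derive f x (f' x)) -> cont f' ->
  (forall x, 1 < Rabs x -> f x = 0) -> Rabs (f x) <= RInt (fun s => Rabs (f' s)) (-2) 2.
Proof.
  intros Hd Cf H.
  assert (Hp : 0 <= RInt (fun s => Rabs (f' s)) (-2) 2).
  { apply RInt_ge_0; [lra | apply ex_RInt_cont; ct |]. intros; apply Rabs_pos. }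
  destruct (Rle_dec (Rabs x) 2) as [Hx | Hx].
  - apply Rabs_le_between in Hx.
    assert (E : RInt f' (-2) x = f x).
    { rewrite (RInt_FTC f) by auto. rewrite (H (-2)); [apply Rminus_0_r |]. rewrite Rabs_left; lra. }
    rewrite <- E.
    apply Rle_trans with (RInt (fun s => Rabs (f' s)) (-2) x).
    + apply Rabs_RInt_le; auto; try lra. ct. intros; lra.
    + assert (E2 : RInt (fun s => Rabs (f' s)) (-2) x + RInt (fun s => Rabs (f' s)) x 2 =
        RInt (fun s => Rabs (f' s)) (-2) 2).
      { apply (RInt_Chasles (fun s => Rabs (f' s))); apply ex_RInt_cont; ct. }
      assert (0 <= RInt (fun s => Rabs (f' s)) x 2).
      { apply RInt_ge_0; [lra | apply ex_RInt_cont; ct |]. intros; apply Rabs_pos. }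
      lra.
  - rewrite H by lra. now rewrite Rabs_R0.
Qed.

(* [|f| <= int int int |d1 d2 d3 f|] over a box that contains the support. *)
Lemma bump_bounded f : bump f -> exists C, 0 <= C /\ forall x, Rabs (f x) <= C.
Proof.
  intros Hf.
  assert (H1 := proj2 (bump_dd f X1 Hf)).
  assert (H2 := proj2 (bump_dd _ X2 H1)).
  assert (H3 := proj2 (bump_dd _ X3 H2)).
  set (f1 := dd X1 f) in *. set (f2 := dd X2 f1) in *. set (f3 := dd X3 f2) in *.
  pose proof (bump_cont _ H1) as C1. pose proof (bump_cont _ H2) as C2. pose proof (bump_cont _ H3) as C3.
  assert (B1 : forall a b c, Rabs (f (a, b, c)) <= RInt (fun s => Rabs (f1 (s, b, c))) (-2) 2).
  { intros a b c. apply (compact_support_bound (fun s => f (s, b, c)) (fun s => f1 (s, b, c))).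
    - intros x. eapply is_derive_eq.
      + apply (chain3 f _ (fun s => s) (fun _ => b) (fun _ => c) x 1 0 0 (bump_grad f Hf)); auto_derive; auto.
      + unfold rdot, sum3; simpl. fold f1. ring.
    - ct.
    - intros x Hx. apply bump_out; auto. }
  assert (B2 : forall a b c, Rabs (f1 (a, b, c)) <= RInt (fun s => Rabs (f2 (a, s, c))) (-2) 2).
  { intros a b c. apply (compact_support_bound (fun s => f1 (a, s, c)) (fun s => f2 (a, s, c))).
    - intros x. eapply is_derive_eq.
      + apply (chain3 f1 _ (fun _ => a) (fun s => s) (fun _ => c) x 0 1 0 (bump_grad f1 H1)); auto_derive; auto.
      + unfold rdot, sum3; simpl. fold f2. ring.
    - ct.
    - intros x Hx. apply bump_out; auto. }
  assert (B3 : forall a b c, Rabs (f2 (a, b, c)) <= RInt (fun s => Rabs (f3 (a, b, s))) (-2) 2).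
  { intros a b c. apply (compact_support_bound (fun s => f2 (a, b, s)) (fun s => f3 (a, b, s))).
    - intros x. eapply is_derive_eq.
      + apply (chain3 f2 _ (fun _ => a) (fun _ => b) (fun s => s) x 0 0 1 (bump_grad f2 H2)); auto_derive; auto.
      + unfold rdot, sum3; simpl. fold f3. ring.
    - ct.
    - intros x Hx. apply bump_out; auto. }
  pose (I3 := fun a b => RInt (fun s => Rabs (f3 (a, b, s))) (-2) 2).
  assert (CI3 : cont (fun p : R * R => I3 (fst p) (snd p))).
  { apply (cont_RInt (fun (p : R * R) s => Rabs (f3 (fst p, snd p, s)))). ct. }
  pose (I2 := fun a => RInt (fun s => I3 a s) (-2) 2).
  assert (CI2 : cont I2) by exact (cont_RInt I3 (-2) 2 CI3).
  assert (P3 : forall a b, 0 <= I3 a b).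
  { intros a b. apply RInt_ge_0; [lra | apply ex_RInt_cont; ct |]. intros; apply Rabs_pos. }
  assert (CI3' : forall a, cont (I3 a)) by (intros a; exact (cont_slice I3 a CI3)).
  assert (P2 : forall a, 0 <= I2 a).
  { intros a. apply RInt_ge_0; [lra | apply ex_RInt_cont; apply CI3' |]. intros; apply P3. }
  exists (RInt I2 (-2) 2). split.
  - apply RInt_ge_0; [lra | now apply ex_RInt_cont |]. intros; apply P2.
  - intros [[a b] c]. eapply Rle_trans; [apply B1 |].
    apply RInt_le_cont; [lra | ct | exact CI2 |].
    intros s _. eapply Rle_trans; [apply B2 |].
    apply RInt_le_cont; [lra | ct | exact (CI3' s) |].
    intros r _. apply B3.
Qed.

Lemma bump_decay f p : 0 <= p -> bump f ->
  exists D, 0 < D /\ forall x, Rabs (f x) <= D * Rpower (1 + norm3 x) (- p).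
Proof.
  intros Hp Hf. destruct (bump_bounded f Hf) as (C & HC & H).
  pose proof (Rpower_pos 2 p).
  (* On the unit ball the weight is at least [2^(- p)]; [C + 1] keeps the constant positive when
     [C = 0]. *)
  exists ((C + 1) * Rpower 2 p). split; [apply Rmult_lt_0_compat; lra |].
  intros x. destruct (Rle_dec (norm3 x) 1) as [Hx | Hx].
  - apply Rle_trans with ((C + 1) * Rpower 2 p * Rpower 2 (- p)).
    + rewrite Rmult_assoc, <- Rpower_plus. replace (p + - p) with 0 by ring.
      rewrite Rpower_O by lra. specialize (H x). lra.
    + apply Rmult_le_compat_l; [apply Rmult_le_pos; lra |].
      pose proof (norm3_ge_0 x). apply Rpower_anti; lra.
  - rewrite (proj2 Hf) by (apply Rnot_le_lt; exact Hx). rewrite Rabs_R0.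
    apply Rmult_le_pos; [apply Rmult_le_pos; lra |]. left; apply Rpower_pos.
Qed.

Lemma Sph_decay_scaled p D (k : R3 -> R) (x : R3) t : 2 < p -> 0 < D -> cont k ->
  (forall th ph, Rabs (k (om th ph)) <= D * Rpower (1 + norm3 (ray x t (om th ph))) (- p)) ->
  Rabs t * Rabs (Sph k) <= D * (radial_const p * Phi p (t, x)).
Proof.
  intros Hp HD Ck H. assert (HD' : 0 < / D) by now apply Rinv_0_lt_compat.
  assert (A := Sph_decay p (fun o => / D * k o) x t Hp).
  rewrite Sph_scal, Rabs_mult, (Rabs_pos_eq (/ D)) in A by (auto; lra).
  replace (Rabs t * Rabs (Sph k)) with (D * (Rabs t * (/ D * Rabs (Sph k)))) by (field; lra).
  apply Rmult_le_compat_l; [lra |]. apply A; [ct |].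
  intros th ph. rewrite Rabs_mult, (Rabs_pos_eq (/ D)) by lra.
  apply Rle_trans with (/ D * (D * Rpower (1 + norm3 (ray x t (om th ph))) (- p))).
  - apply Rmult_le_compat_l; [lra | apply H].
  - right. field. lra.
Qed.

Lemma norm3_ray_om_le x tau th ph : Rabs tau <= 1 ->
  norm3 x <= norm3 (ray x tau (om th ph)) + 1 /\ norm3 (ray x tau (om th ph)) <= norm3 x + 1.
Proof.
  intros Ht.
  assert (H : forall (x : R3) tau, Rabs tau <= 1 -> norm3 (ray x tau (om th ph)) <= norm3 x + 1).
  { clear. intros x tau Ht. unfold ray.
    assert (A := norm_triangle (x : R3) (scal tau (om th ph))).
    assert (B := norm_scal tau (om th ph : R3)).
    assert (E : norm3 (om th ph) = 1) by (apply norm3_eq; [lra | rewrite dot_om; ring]).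
    change (norm (plus x (scal tau (om th ph))) <= norm x + 1).
    eapply Rle_trans; [exact A |]. apply Rplus_le_compat_l. eapply Rle_trans; [exact B |].
    change (Rabs tau * norm3 (om th ph) <= 1). rewrite E. lra. }
  split; [| now apply H].
  replace (norm3 x) with (norm3 (ray (ray x tau (om th ph)) (- tau) (om th ph))).
  - apply H. now rewrite Rabs_Ropp.
  - f_equal. apply R3_eq. intros i. rewrite !coord_mv. ring.
Qed.

(** Complements [Sph_decay], whose factor [|t|] is useless near [t = 0]. Here a point at distance
    [y] from the origin on the sphere satisfies [|x| <= y + 1], so both [1 + |t| + |x|] and
    [1 + ||t| - |x||] are at most [3 (1 + y)]. The powers [1] and [p - 2] of this factor 3 multiply
    to [3^(p - 1)]. *)
Lemma Sph_decay_short p D (k : R3 -> R) (x : R3) t : 2 < p -> 0 < D -> cont k -> Rabs t <= 1 ->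
  (forall th ph, Rabs (k (om th ph)) <= D * Rpower (1 + norm3 (ray x t (om th ph))) (- p)) ->
  Rabs (Sph k) <= D * (Rpower 3 (p - 1) * Phi p (t, x)).
Proof.
  intros Hp HD Ck Ht H. rewrite <- (Sph_const (D * (Rpower 3 (p - 1) * Phi p (t, x)))).
  apply Sph_abs; auto; [ct |]. intros th ph. eapply Rle_trans; [apply H |].
  apply Rmult_le_compat_l; [lra |].
  destruct (norm3_ray_om_le x t th ph Ht) as [H1 H2].
  set (y := norm3 (ray x t (om th ph))) in *.
  assert (Hy : 0 <= y) by apply norm3_ge_0. pose proof (norm3_ge_0 x) as Hx. pose proof (Rabs_pos t) as Ht0.
  unfold Phi, decay_weight. simpl fst; simpl snd.
  apply Rle_trans with (Rpower 3 (p - 1) * (Rpower (3 * (1 + y)) (-(1)) * Rpower (3 * (1 + y)) (2 - p))).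
  - rewrite <- Rpower_plus, <- Rpower_mult_distr by lra. rewrite <- Rmult_assoc, <- Rpower_plus.
    replace (p - 1 + (- (1) + (2 - p))) with 0 by ring. rewrite Rpower_O, Rmult_1_l by lra.
    apply Rle_Rpower; lra.
  - apply Rmult_le_compat_l; [left; apply Rpower_pos |].
    apply Rmult_le_compat; try (left; apply Rpower_pos).
    + rewrite Rpower_Ropp, Rpower_1 by lra. apply Rinv_le_contravar; lra.
    + apply Rpower_anti; [| lra]. split.
      * pose proof (Rabs_pos (Rabs t - norm3 x)). lra.
      * unfold Rabs at 1. destruct Rcase_abs; lra.
Qed.

Lemma rdot_om_bound (g : axis -> R3 -> R) th ph (y : R3) B : (forall i, Rabs (g i y) <= B) ->
  Rabs (rdot (om th ph) g y) <= 3 * B.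
Proof.
  intros H.
  assert (Hc : forall i, Rabs (coord i (om th ph)) <= 1).
  { intros i. assert (E : norm3 (om th ph) = 1) by (apply norm3_eq; [lra | rewrite dot_om; ring]).
    unfold om in *. destruct (norm3_components (sin th * cos ph) (sin th * sin ph) (cos th)) as (H1 & H2 & H3).
    destruct i; simpl; lra. }
  assert (Hi : forall i, Rabs (coord i (om th ph) * g i y) <= 1 * B).
  { intros i. rewrite Rabs_mult. apply Rmult_le_compat; auto using Rabs_pos. }
  unfold rdot, sum3. eapply Rle_trans; [apply Rabs_triang |].
  assert (A := Rabs_triang (coord X1 (om th ph) * g X1 y) (coord X2 (om th ph) * g X2 y)).
  assert (A1 := Hi X1). assert (A2 := Hi X2). assert (A3 := Hi X3). lra.
Qed.

(** * Kirchhoff's formula and the decay of the linear part *)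

Definition linear_source (f g : R3 -> R) (q : spacetime) : R :=
  lap (fun i j => dd j (dd i f)) (snd q) + fst q * lap (fun i j => dd j (dd i g)) (snd q).

(** [f + t g] has the right Cauchy data, and its Laplacian, fed into [Duh], corrects it to the
    solution of the free wave equation. All time dependence beyond an affine function thus sits
    inside [Duh]. *)
Definition linear_part (f g : R3 -> R) (q : spacetime) : R :=
  f (snd q) + fst q * g (snd q) + Duh (linear_source f g) q.

Lemma bump_dd2_cont f i j : bump f -> cont (dd j (dd i f)).
Proof. intros H. now apply bump_cont, bump_dd, bump_dd. Qed.

Lemma cont_linear_source f g : bump f -> bump g -> cont (linear_source f g).
Proof.
  intros Hf Hg. unfold linear_source.
  assert (C1 : forall i j, cont (dd j (dd i f))) by (intros; now apply bump_dd2_cont).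
  assert (C2 : forall i j, cont (dd j (dd i g))) by (intros; now apply bump_dd2_cont).
  apply cont_plus; [| apply cont_mult; [ct |]].
  - apply (cont_lap (fun i j => dd j (dd i f)) (fun q : spacetime => snd q)); auto. ct.
  - apply (cont_lap (fun i j => dd j (dd i g)) (fun q : spacetime => snd q)); auto. ct.
Qed.

Lemma Kir_0 g (x : R3) : Kir g x 0 = 0.
Proof. unfold Kir. ring. Qed.

Lemma Kir'_0 g g' (x : R3) : Kir' g g' x 0 = g x.
Proof.
  unfold Kir'. rewrite <- (Sph_const (g x)). apply Sph_ext. intros. rewrite ray_0. ring.
Qed.

Lemma cont_Kir g (x : R3) : cont g -> cont (Kir g x).
Proof. intros. unfold Kir. ct. Qed.

(** Makes the decay visible. The Duhamel integrand is the [s]-derivative of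
    [- Kir' f - s Kir' g - Kir g], all taken at [t - s]. At [s = t] this equals [- f - t g] and
    cancels the affine part; at [s = 0] it leaves Kirchhoff's expression. *)
Lemma Kirchhoff f g t (x : R3) : bump f -> bump g ->
  linear_part f g (t, x) = Kir' f (fun i => dd i f) x t + Kir g x t.
Proof.
  intros Hf Hg. unfold linear_part. simpl fst; simpl snd.
  rewrite Duh_Kir by now apply cont_linear_source.
  set (f' := fun i => dd i f). set (g' := fun i => dd i g).
  set (f'' := fun i j => dd j (dd i f)). set (g'' := fun i j => dd j (dd i g)).
  assert (Gf : grad2 f f' f'') by now apply bump_grad2.
  assert (Gg : grad2 g g' g'') by now apply bump_grad2.
  assert (Cf : forall i j, cont (f'' i j)) by (intros; now apply bump_dd2_cont).
  assert (Cg : forall i j, cont (g'' i j)) by (intros; now apply bump_dd2_cont).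
  assert (CLf : cont (lap f'')) by exact (cont_lap f'' (fun u => u) Cf cont_id).
  assert (CLg : cont (lap g'')) by exact (cont_lap g'' (fun u => u) Cg cont_id).
  assert (E : RInt (fun s => Kir (lap f'') x (t - s) + s * Kir (lap g'') x (t - s)) 0 t =
     (- Kir' f f' x (t - t) - t * Kir' g g' x (t - t) - Kir g x (t - t)) -
     (- Kir' f f' x (t - 0) - 0 * Kir' g g' x (t - 0) - Kir g x (t - 0))).
  { apply (RInt_FTC (fun s => - Kir' f f' x (t - s) - s * Kir' g g' x (t - s) - Kir g x (t - s))).
    - intros s.
      assert (D : forall (k : R -> R) l, is_derive k (t - s) l -> is_derive (fun r => k (t - r)) s (- l)).
      { intros k l H. eapply is_derive_eq.
        - apply (is_derive_compR k (fun r => t - r)); [exact H | auto_derive; auto; reflexivity].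
        - ring. }
      eapply is_derive_eq.
      + apply is_derive_minusR; [apply is_derive_minusR |].
        * apply (is_derive_opp (fun s => Kir' f f' x (t - s))).
          apply D. now apply (is_derive_Kir' f f' f'').
        * apply (is_derive_multR (fun s => s) (fun s => Kir' g g' x (t - s))).
          -- auto_derive; auto; reflexivity.
          -- apply D. now apply (is_derive_Kir' g g' g'').
        * apply D. exact (is_derive_Kir g g' x (t - s) (proj1 Gg)).
      + match goal with |- @eq _ ?a ?b => change (@eq R a b) end.
        change (opp (- Kir (lap f'') x (t - s))) with (- - Kir (lap f'') x (t - s)). ring.
    - pose proof (cont_Kir _ x CLf). pose proof (cont_Kir _ x CLg). ct. }
  rewrite (RInt_extR _ (fun s => Kir (lap f'') x (t - s) + s * Kir (lap g'') x (t - s))), E.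
  - replace (t - t) with 0 by ring. rewrite Rminus_0_r, Kir_0, !Kir'_0. ring.
  - intros s. unfold Kir. rewrite (Sph_ext _ (fun o => lap f'' (ray x (t - s) o) + s * lap g'' (ray x (t - s) o))).
    + rewrite Sph_plus, Sph_scal; [ring | ct | ct | ct].
    + reflexivity.
Qed.

Lemma linear_part_decay p f g : 2 < p -> bump f -> bump g ->
  exists C0, 0 < C0 /\ forall q, Rabs (linear_part f g q) <= C0 * Phi p q.
Proof.
  intros Hp Hf Hg.
  assert (Hmax : exists D, 0 < D /\ forall k, (k = f \/ k = g \/ exists i, k = dd i f) ->
     forall x, Rabs (k x) <= D * Rpower (1 + norm3 x) (- p)).
  { destruct (bump_decay f p ltac:(lra) Hf) as (D1 & P1 & B1).
    destruct (bump_decay g p ltac:(lra) Hg) as (D2 & P2 & B2).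
    destruct (bump_decay (dd X1 f) p ltac:(lra) (proj2 (bump_dd f X1 Hf))) as (D3 & P3 & B3).
    destruct (bump_decay (dd X2 f) p ltac:(lra) (proj2 (bump_dd f X2 Hf))) as (D4 & P4 & B4).
    destruct (bump_decay (dd X3 f) p ltac:(lra) (proj2 (bump_dd f X3 Hf))) as (D5 & P5 & B5).
    exists (D1 + D2 + D3 + D4 + D5). split; [lra |].
    intros k Hk x. pose proof (Rpower_pos (1 + norm3 x) (- p)).
    destruct Hk as [-> | [-> | [[] ->]]]; [specialize (B1 x) | specialize (B2 x) | specialize (B3 x) | specialize (B4 x) | specialize (B5 x)]; nra. }
  destruct Hmax as (D & HD & HB).
  pose proof (bump_cont _ Hf) as Cf. pose proof (bump_cont _ Hg) as Cg.
  assert (Cf' : forall i, cont (dd i f)) by (intros i; now apply bump_cont, bump_dd).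
  pose (c := radial_const p). assert (Hc : 0 < c) by (apply radial_const_pos; lra).
  pose (c3 := Rpower 3 (p - 1)). assert (Hc3 : 0 < c3) by apply Rpower_pos.
  exists (D * (c + c3) + 3 * D * c + D * c). split.
  { assert (0 < D * c) by now apply Rmult_lt_0_compat. assert (0 < D * c3) by now apply Rmult_lt_0_compat. lra. }
  intros [t x]. rewrite Kirchhoff by auto.
  pose proof (Phi_pos p (t, x)) as HP.
  set (P := Phi p (t, x)) in *.
  assert (B1 : Rabs t * Rabs (Sph (fun o => f (ray x t o))) <= D * (c * P)).
  { apply Sph_decay_scaled; [lra | lra | ct |]. intros. apply HB; auto. }
  assert (CR : cont (fun o => rdot o (fun i => dd i f) (ray x t o))).
  { apply (cont_rdot (fun o => o) (fun i => dd i f) (fun o => ray x t o)); [ct | exact Cf' | ct]. }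
  assert (B2 : Rabs t * Rabs (Sph (fun o => rdot o (fun i => dd i f) (ray x t o))) <= 3 * D * (c * P)).
  { apply Sph_decay_scaled; [lra | lra | exact CR |].
    intros. rewrite Rmult_assoc. apply (rdot_om_bound (fun i => dd i f)). intros i. apply HB; eauto. }
  assert (B3 : Rabs t * Rabs (Sph (fun o => g (ray x t o))) <= D * (c * P)).
  { apply Sph_decay_scaled; [lra | lra | ct |]. intros. apply HB; auto. }
  (* The one term without a factor [t]. For [|t| >= 1] the factor can be inserted at no cost; for
     [|t| <= 1] the short-time bound takes over, which accounts for the sum [c + c3]. *)
  assert (B4 : Rabs (Sph (fun o => f (ray x t o))) <= D * ((c + c3) * P)).
  { destruct (Rle_dec (Rabs t) 1) as [Ht | Ht].
    - apply Rle_trans with (D * (c3 * P)).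
      + apply Sph_decay_short; [lra | lra | ct | lra |]. intros. apply HB; auto.
      + apply Rmult_le_compat_l; [lra |]. apply Rmult_le_compat_r; lra.
    - apply Rle_trans with (D * (c * P)).
      + pose proof (Rabs_pos (Sph (fun o => f (ray x t o)))). nra.
      + apply Rmult_le_compat_l; [lra |]. apply Rmult_le_compat_r; lra. }
  unfold Kir', Kir. rewrite Sph_plus, Sph_scal; [| exact CR | ct | apply cont_mult; [ct | exact CR]].
  eapply Rle_trans; [apply Rabs_triang |].
    eapply Rle_trans; [apply Rplus_le_compat_r, Rabs_triang |]. rewrite !Rabs_mult.
    replace ((D * (c + c3) + 3 * D * c + D * c) * P) with
      (D * ((c + c3) * P) + 3 * D * (c * P) + D * (c * P)) by ring.
    lra.
Qed.

(** * Bounds on strips and space derivatives of the linear part *)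

Lemma strip_bounded_plus u v : strip_bounded u -> strip_bounded v -> strip_bounded (fun q => u q + v q).
Proof.
  intros Hu Hv T. destruct (Hu T) as (A & HA & BA), (Hv T) as (B & HB & BB).
  exists (A + B). split; [lra |]. intros q Hq. eapply Rle_trans; [apply Rabs_triang |].
  specialize (BA q Hq). specialize (BB q Hq). lra.
Qed.

Lemma strip_bounded_time u : strip_bounded u -> strip_bounded (fun q => fst q * u q).
Proof.
  intros Hu T. destruct (Hu T) as (A & HA & BA). exists (Rabs T * A).
  split; [apply Rmult_le_pos; auto using Rabs_pos |]. intros q Hq. rewrite Rabs_mult.
  apply Rmult_le_compat; auto using Rabs_pos. eapply Rle_trans; [apply Hq | apply Rle_abs].
Qed.

Lemma strip_bounded_scal c u : strip_bounded u -> strip_bounded (fun q => c * u q).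
Proof.
  intros Hu T. destruct (Hu T) as (A & HA & BA). exists (Rabs c * A).
  split; [apply Rmult_le_pos; auto using Rabs_pos |]. intros q Hq. rewrite Rabs_mult.
  apply Rmult_le_compat_l; auto using Rabs_pos.
Qed.

Lemma strip_bounded_bump f : bump f -> strip_bounded (fun q => f (snd q)).
Proof. intros Hf T. destruct (bump_bounded f Hf) as (C & HC & H). exists C. auto. Qed.

Lemma strip_bounded_Duh w : cont w -> strip_bounded w -> strip_bounded (Duh w).
Proof.
  intros Cw_ Hw T. destruct (Hw T) as (A & HA & BA).
  exists (A * exp (1 * T)). split; [apply Rmult_le_pos; [auto | left; apply exp_pos] |].
  intros q Hq. eapply Rle_trans.
  - apply (Duh_exp_bound w 1 A T); auto; [lra |].
    intros y Hy. eapply Rle_trans; [now apply BA |].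
    assert (He := exp_ge1 1 (fst y) ltac:(lra)). nra.
  - replace (A / (1 * 1)) with A by field. apply Rmult_le_compat_l; auto. apply exp_le_strip; lra.
Qed.

Definition affine_in_time (a b : R3 -> R) (q : spacetime) : R := a (snd q) + fst q * b (snd q).

Lemma sgrad_affine_in_time a b : bump a -> bump b ->
  sgrad (affine_in_time a b) (fun i => affine_in_time (dd i a) (dd i b)).
Proof.
  intros Ha Hb.
  pose proof (bump_cont _ Ha) as Ca. pose proof (bump_cont _ Hb) as Cb.
  split; [unfold affine_in_time; ct |]. intros i.
  destruct (bump_dd a i Ha) as [Da Ba]. destruct (bump_dd b i Hb) as [Db Bb].
  pose proof (bump_cont _ Ba) as Ca'. pose proof (bump_cont _ Bb) as Cb'.
  split; [unfold affine_in_time; ct |]. now apply Dir_dx_Cauchy.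
Qed.

Lemma sgrad2_affine_in_time a b : bump a -> bump b ->
  sgrad2 (affine_in_time a b) (fun i => affine_in_time (dd i a) (dd i b)) (fun i j => affine_in_time (dd j (dd i a)) (dd j (dd i b))).
Proof.
  intros Ha Hb. split; [now apply sgrad_affine_in_time |]. intros i. apply sgrad_affine_in_time; now apply bump_dd.
Qed.

Lemma strip_bounded_affine_in_time a b : bump a -> bump b -> strip_bounded (affine_in_time a b).
Proof. intros. apply strip_bounded_plus; [now apply strip_bounded_bump | apply strip_bounded_time; now apply strip_bounded_bump]. Qed.

Definition second_dd (f : R3 -> R) (i : axis) : R3 -> R := dd i (dd i f).

(** The source is a sum of three functions affine in time, one for each second derivative along an
    axis. Its own second derivatives use four derivatives of the data. *)
Lemma linear_source_smooth f g : bump f -> bump g ->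
  exists S' S'', sgrad2 (linear_source f g) S' S'' /\ (forall i, strip_bounded (S' i)) /\ (forall i j, strip_bounded (S'' i j)).
Proof.
  intros Hf Hg.
  assert (Bf : forall i, bump (second_dd f i)) by (intros i; now apply bump_dd, bump_dd).
  assert (Bg : forall i, bump (second_dd g i)) by (intros i; now apply bump_dd, bump_dd).
  assert (H := fun k => sgrad2_affine_in_time (second_dd f k) (second_dd g k) (Bf k) (Bg k)).
  assert (G := sgrad2_plus _ _ _ _ _ _ (sgrad2_plus _ _ _ _ _ _ (H X1) (H X2)) (H X3)).
  pose (L := fun (a b : axis -> R3 -> R) (q : spacetime) => affine_in_time (a X1) (b X1) q + affine_in_time (a X2) (b X2) q + affine_in_time (a X3) (b X3) q).
  exists (fun i => L (fun k => dd i (second_dd f k)) (fun k => dd i (second_dd g k))).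
  exists (fun i j => L (fun k => dd j (dd i (second_dd f k))) (fun k => dd j (dd i (second_dd g k)))).
  split; [| split].
  - destruct G as [[C G1] G2]. split; [split | exact G2].
    + now apply cont_linear_source.
    + intros i. destruct (G1 i) as [C1 D1]. split; [exact C1 |].
      intros q. refine (is_derive_ext _ _ _ _ _ (D1 q)).
      intros h. unfold linear_source, affine_in_time, second_dd, lap, sum3. rring.
  - intros i. unfold L. apply strip_bounded_plus; [apply strip_bounded_plus |]; apply strip_bounded_affine_in_time; now apply bump_dd.
  - intros i j. unfold L. apply strip_bounded_plus; [apply strip_bounded_plus |]; apply strip_bounded_affine_in_time; now apply bump_dd, bump_dd.
Qed.

Lemma grad_scal c f f' : grad f f' -> grad (fun x => c * f x) (fun i x => c * f' i x).
Proof.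
  intros [Cf H]. split; [ct |]. intros i. destruct (H i). split; [ct | now apply Dir_scal].
Qed.

Lemma grad2_scal c f f' f'' : grad2 f f' f'' ->
  grad2 (fun x => c * f x) (fun i x => c * f' i x) (fun i j x => c * f'' i j x).
Proof. intros [H1 H2]. split; [now apply grad_scal | intros i; now apply grad_scal]. Qed.

(** * Choice of the size of the data and assembly of the solution *)

Theorem mainTheorem2 (p : R) (f g : R3 -> R)
  (hp : 1 + sqrt 2 < p < 3)
  (hf : C0_infty f) (hg : C0_infty g)
  (hsf : forall x : R3, supp f x -> norm x <= 1)
  (hsg : forall x : R3, supp g x -> norm x <= 1) :
  exists eps0 : R, 0 < eps0 /\
    forall eps : R, 0 < eps < eps0 ->
      exists phi : spacetime -> R,
        global_solution p (fun x => eps * f x) (fun x => eps * g x) phi.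
Proof.
  assert (Hs : sqrt 2 * sqrt 2 = 2) by (apply sqrt_sqrt; lra).
  assert (Hs0 : 0 <= sqrt 2) by apply sqrt_pos.
  assert (Hp : 2 < p <= 3) by nra.
  (* [p (p - 2) = (p - 1)^2 - 1], and [p - 1 > sqrt 2]. *)
  assert (Hq : 1 < p * (p - 2)) by nra.
  assert (Bf : bump f) by (apply bump_of_support; [apply hf | exact hsf]).
  assert (Bg : bump g) by (apply bump_of_support; [apply hg | exact hsg]).
  destruct (linear_part_decay p f g ltac:(lra) Bf Bg) as (C0 & HC0 & Hdec).
  destruct (linear_source_smooth f g Bf Bg) as (S' & S'' & HS & SB1 & SB2).
  (* With [K >= 1] and [K >= John_const], the single condition [K * N <= 1 / 2] yields both [N <= 1]
     and the smallness required of [John_const * N]. *)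
  pose (K := Rabs (John_const p (p * (p - 2))) + 1).
  assert (HK : 1 <= K) by (unfold K; pose proof (Rabs_pos (John_const p (p * (p - 2)))); lra).
  exists (/ (4 * C0 * K)). split; [apply Rinv_0_lt_compat; nra |].
  intros eps Heps.
  assert (HN : 4 * C0 * K * eps < 1).
  { apply Rlt_le_trans with (4 * C0 * K * / (4 * C0 * K)).
    - apply Rmult_lt_compat_l; [nra | lra].
    - right. field. lra. }
  (* Chosen so that the decay bound [eps * C0 * Phi] of the linear part is exactly [N / 2 * Phi]. *)
  pose (N := 2 * C0 * eps).
  assert (HN0 : 0 < N) by (unfold N; repeat apply Rmult_lt_0_compat; lra).
  assert (HNK : K * N <= / 2) by (unfold N; lra).
  assert (HN1 : 0 < N <= 1) by nra.
  assert (HC : John_const p (p * (p - 2)) * N <= / 2).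
  { apply Rle_trans with (K * N); [| exact HNK]. apply Rmult_le_compat_r; [lra |].
    unfold K. pose proof (Rle_abs (John_const p (p * (p - 2)))). lra. }
  assert (CS : cont (linear_source f g)) by now apply cont_linear_source.
  assert (CS' : forall i, cont (S' i)) by (intros i; apply HS).
  assert (CS'' : forall i j, cont (S'' i j)) by (intros i j; apply HS).
  destruct (fixed_point p (fun q => eps * (affine_in_time f g q + Duh (linear_source f g) q))
    (fun i q => eps * (affine_in_time (dd i f) (dd i g) q + Duh (S' i) q))
    (fun i j q => eps * (affine_in_time (dd j (dd i f)) (dd j (dd i g)) q + Duh (S'' i j) q))
    N Hp Hq) as (phi & phi' & phi'' & Hphi & Eq); auto.
  - apply (sgrad2_scal eps (fun q => affine_in_time f g q + Duh (linear_source f g) q)).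
    apply (sgrad2_plus _ _ _ (Duh (linear_source f g))); [now apply sgrad2_affine_in_time | now apply sgrad2_Duh].
  - intros i. apply strip_bounded_scal, strip_bounded_plus; [apply strip_bounded_affine_in_time; now apply bump_dd | now apply strip_bounded_Duh].
  - intros i j. apply strip_bounded_scal, strip_bounded_plus; [apply strip_bounded_affine_in_time; now apply bump_dd, bump_dd | now apply strip_bounded_Duh].
  - intros q. rewrite Rabs_mult, (Rabs_pos_eq eps) by lra.
    replace (N / 2 * Phi p q) with (eps * (C0 * Phi p q)) by (unfold N; field).
    apply Rmult_le_compat_l; [lra | apply Hdec].
  - exists phi.
    assert (HF := sgrad2_F p phi phi' phi'' Hp Hphi).
    assert (HW := sgrad2_plus _ _ _ _ _ _ HF (sgrad2_scal eps _ _ _ HS)).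
    assert (CF : cont (fun q => abs_pow (phi q) p)) by exact (proj1 (proj1 HF)).
    eapply solution_of_integral_equation.
    + apply grad2_scal, bump_grad2, Bf.
    + apply grad2_scal, bump_grad2, Bg.
    + exact HW.
    + intros q. cbv beta. rewrite Eq.
      (* Linearity of [Duh] merges the linear source and the nonlinearity into the single source [W]
         expected by [solution_of_integral_equation]. *)
      rewrite (Duh_plus (fun q => abs_pow (phi q) p) (fun q => eps * linear_source f g q)); [| exact CF | ct].
      rewrite Duh_scal by exact CS. unfold affine_in_time. ring.
    + intros q. cbv beta. unfold linear_source, lap, sum3. ring.
Qed.
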